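(* Let $\beta\in(0,1)$, $\gamma\in(0,\bar\gamma]$, and assume the following. (A1) $\mathbb{A}_x$ and $\mathbb{B}_x$ are compact for every $x\in\mathbb{E}$. (A2) The correspondences $x\mapsto\mathbb{A}_x$ and $x\mapsto\mathbb{B}_x$ are continuous. (A3) $(x,a,b)\mapsto r(x,a,b)$ is continuous. (A4) For all bounded continuous $v:\mathbb{E}\to\mathbb{R}$, $(x,a,b)\mapsto\int v(x')Q(dx'|x,a,b)$ is continuous. a) $V_\infty$ is the unique solution $v\in\mathcal{C}$ with $1\le v(x,\gamma)\le e^{\gamma\frac{\bar r}{1-\beta}}$ of the Shapley equation $v=Tv$; that is, $$V_\infty(x,\gamma)=(TV_\infty)(x,\gamma)=\inf_\nu\sup_\mu\int V_\infty(x',\beta\gamma)\,\tilde Q(dx'|x,\gamma,\mu,\nu),$$ where $\mu$ ranges over $\mathbb{P}(\mathbb{A}_x)$ and $\nu$ over $\mathbb{P}(\mathbb{B}_x)$. b) There exist measurable functions $(\mu^*,\nu^* ):\mathbb{E}\times(0,\bar\gamma]\to\mathbb{P}(\mathbb{A})\times\mathbb{P}(\mathbb{B})$ with $\mu^*(x,\gamma)\in\mathbb{P}(\mathbb{A}_x)$ and $\nu^*(x,\gamma)\in\mathbb{P}(\mathbb{B}_x)$ such that $(\mu^*(x,\gamma),\nu^*(x,\gamma))$ is a saddle point of $$(\mu,\nu)\mapsto(LV_\infty)(x,\gamma,\mu,\nu),\qquad(\mu,\nu)\in\mathbb{P}(\mathbb{A}_x)\times\mathbb{P}(\mathbb{B}_x).$$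 Then $V_\infty$ is the value of the infinite horizon stochastic game, and the policies $\pi^*=(f_n^* )_{n\ge0}$, $\sigma^*=(g_n^* )_{n\ge0}$ with $f_n^*(x):=\mu^*(x,\gamma\beta^n)$ and $g_n^*(x):=\nu^*(x,\gamma\beta^n)$ are optimal for player 1 and player 2, respectively (for the game with risk-sensitivity parameter $\gamma$).
   Context: Game model. $\mathbb{E}$ (state space), $\mathbb{A}$ and $\mathbb{B}$ (action spaces of players 1 and 2) are Borel spaces. There is a measurable set $D_{\mathbb A}\subset\mathbb{E}\times\mathbb{A}$ containing the graph of a measurable map $\mathbb{E}\to\mathbb{A}$, and $\mathbb{A}_x=\{a:(x,a)\in D_{\mathbb A}\}$ is the (non-empty) set of admissible actions of player 1 in state $x$; analogously $D_{\mathbb B}$ and $\mathbb{B}_x$ for player 2. $Q$ is a transition (probability) kernel from $\mathbb{E}\times\mathbb{A}\times\mathbb{B}$ to $\mathbb{E}$, and $r:\mathbb{E}\times\mathbb{A}\times\mathbb{B}\to\mathbb{R}$ is a measurable reward function with $0\le r\le\bar r$ for a constant $\bar r$. A correspondence $x\mapsto\mathbb{A}_x$ is continuous if it is upper-semicontinuous ($\{x\in\mathbb{E}:\mathbb{A}_x\cap C\ne\emptyset\}$ is closed for every closed $C\subset\mathbb{A}$) and lower-semicontinuous ($\{x\in\mathbb{E}:\mathbb{A}_x\cap D\neq\emptyset\}$ is open for every open $D\subset\mathbb{A}$). For a Borel space $S$, $\mathbb{P}(S)$ is the set of probability measures on $S$ with the weak topology. $\mathbb{F}$ is the set of measurable maps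 $f:\mathbb{E}\to\mathbb{P}(\mathbb{A})$ with $f(x)\in\mathbb{P}(\mathbb{A}_x)$ for all $x$; $\mathbb{G}$ is the set of measurable maps $g:\mathbb{E}\to\mathbb{P}(\mathbb{B})$ with $g(x)\in\mathbb{P}(\mathbb{B}_x)$ for all $x$. A (randomized Markovian) policy of player 1 (player 2) is a sequence $(f_n)_{n\ge0}$ in $\mathbb{F}$ ($(g_n)_{n\ge0}$ in $\mathbb{G}$). Policies $\pi=(f_n),\sigma=(g_n)$ and an initial state $x$ define (Ionescu Tulcea) the law $\mathrm{P}_x^{\pi\sigma}$ of the process $(X_0,A_0,B_0,X_1,A_1,B_1,\ldots)$ with $X_0=x$, where given $X_n$ the actions $A_n,B_n$ are chosen independently according to $f_n(X_n)$ and $g_n(X_n)$ and $X_{n+1}\sim Q(\cdot|X_n,A_n,B_n)$; $\mathbb{E}_x^{\pi\sigma}$ is the corresponding expectation. Fix $\bar\gamma>0$. For $(x,\gamma)\in\mathbb{E}\times(0,\bar\gamma]$, $$V_{\infty\pi\sigma}(x,\gamma):=\mathbb{E}_x^{\pi\sigma}\Big[\exp\Big(\gamma\sum_{k=0}^{\infty}\beta^k r(X_k,A_k,B_k)\Big)\Big],\qquad V_\infty(x,\gamma):=\inf_\sigma\sup_\pi V_{\infty\pi\sigma}(x,\gamma).$$ $V_\infty$ is called the value of the infinite horizon game if $\inf_\sigma\sup_\pi V_{\infty\pi\sigma}=\sup_\pi\inf_\sigma V_{\infty\pi\sigma}$. A policy $\pi^*$ is optimal for player 1 if $V_{\infty\pi^*\sigma}(x,\gamma)\ge\sup_\pi\inf_{\sigma'}V_{\infty\pi\sigma'}(x,\gamma)$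 for all $\sigma$ (and all $x$); $\sigma^*$ is optimal for player 2 if $V_{\infty\pi\sigma^*}(x,\gamma)\le\inf_\sigma\sup_{\pi'}V_{\infty\pi'\sigma}(x,\gamma)$ for all $\pi$ (and all $x$). A pair $(\mu^*,\nu^* )$ is a saddle point of a function $h(\mu,\nu)$ if $h(\mu,\nu^* )\le h(\mu^*,\nu^* )\le h(\mu^*,\nu)$ for all $\mu,\nu$. $\mathcal{C}$ is the set of bounded continuous functions on $\mathbb{E}\times(0,\bar\gamma]$. Define $\tilde Q(dx'|x,\gamma,a,b):=e^{\gamma r(x,a,b)}Q(dx'|x,a,b)$, and for $\mu\in\mathbb{P}(\mathbb{A}_x)$, $\nu\in\mathbb{P}(\mathbb{B}_x)$, $\tilde Q(dx'|x,\gamma,\mu,\nu):=\int\int\tilde Q(dx'|x,\gamma,a,b)\mu(da)\nu(db)$. For bounded measurable $v:\mathbb{E}\times(0,\bar\gamma]\to\mathbb{R}$, $$(Lv)(x,\gamma,\mu,\nu):=\int v(x',\beta\gamma)\,\tilde Q(dx'|x,\gamma,\mu,\nu),\qquad (Tv)(x,\gamma):=\inf_{\nu\in\mathbb{P}(\mathbb{B}_x)}\sup_{\mu\in\mathbb{P}(\mathbb{A}_x)}(Lv)(x,\gamma,\mu,\nu).$$ *)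

(* Defs.v *)
From HB Require Import structures.
From mathcomp Require Import all_boot all_order all_algebra.
From mathcomp Require Import all_classical all_reals all_analysis.

Set Implicit Arguments.
Unset Strict Implicit.
Unset Printing Implicit Defensive.

Import Order.TTheory GRing.Theory Num.Theory.
Import numFieldNormedType.Exports.

Local Open Scope classical_set_scope.
Local Open Scope ring_scope.

Definition borel (S : ptopologicalType) : measurableType (@open S).-sigma :=
  g_sigma_algebraType (@open S).

Definition polish_space (R : realType) (X : metricType R) : Prop :=
  (forall F : set_system X, ProperFilter F -> cauchy F ->
     exists l : X, F --> l) /\
  (exists2 D : set X, countable D & dense D).

(* A Borel space is a space homeomorphic to a Borel subset of a Polish space:
   f is a homeomorphism onto its range. *)
Definition borel_space (R : realType) (S : ptopologicalType) : Prop :=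
  exists (X : metricType R) (f : S -> X),
    [/\ polish_space X,
        injective f,
        (forall U : set S, open U <-> exists2 W : set X, open W & U = f @^-1` W)
      & <<s @open X >> (range f)].

Definition bounded_continuous (R : realType) (T : topologicalType)
    (phi : T -> R) : Prop :=
  continuous phi /\ exists M : R, forall s, `|phi s| <= M.

Section weak_topology.
Context (R : realType) (S : ptopologicalType).

Definition test_integrals (mu : probability (borel S) R) :
    prod_topology
      (fun _ : {phi : S -> R | bounded_continuous phi} => R : topologicalType) :=
  fun phi => \int[mu]_s (sval phi s).

(* The weak topology: the coarsest one making all the test integrals
   mu |-> \int phi dmu continuous. *)
Definition Pweak : ptopologicalType := initial_topology test_integrals.

End weak_topology.

Section correspondence.
Context (X Y : ptopologicalType).
Implicit Type D : set (X * Y).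

Definition adm D (x : X) : set Y := [set y | D (x, y)].

Definition usc_corr D : Prop := forall C : set Y, closed C ->
  closed [set x | adm D x `&` C !=set0].

Definition lsc_corr D : Prop := forall O : set Y, open O ->
  open [set x | adm D x `&` O !=set0].

Definition continuous_corr D : Prop := usc_corr D /\ lsc_corr D.

Definition action_constraint D : Prop :=
  measurable (D : set (borel X * borel Y)%type) /\
  exists2 h : borel X -> borel Y,
    measurable_fun [set: borel X] h & forall x, D (x, h x).

(* P(Y_x), as the probability measures on Y carried by Y_x. *)
Definition Padm (R : realType) D (x : X) : set (probability (borel Y) R) :=
  [set mu | mu (adm D x) = 1%E].

Definition decision_rule (R : realType) D
    (f : X -> probability (borel Y) R) : Prop :=
  measurable_fun [set: borel X] (f : borel X -> borel (Pweak R Y)) /\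
  forall x, Padm D x (f x).

Definition policy (R : realType) D
    (f : nat -> X -> probability (borel Y) R) : Prop :=
  forall n, decision_rule D (f n).

End correspondence.

Record game (R : realType) (E A B : ptopologicalType) := Game {
  DA : set (E * A) ;
  DB : set (E * B) ;
  Q : R.-pker (borel E * borel A * borel B)%type ~> borel E ;
  r : E * A * B -> R ;
  rbar : R ;
  DA_constraint : action_constraint DA ;
  DB_constraint : action_constraint DB ;
  r_measurable :
    measurable_fun [set: (borel E * borel A * borel B)%type] r ;
  r_bounded : forall z, 0 <= r z <= rbar
}.

Section process.
Context (R : realType) (E A B : ptopologicalType).

Definition step : Type := (borel E * borel A * borel B)%type.

Definition X_ (n : nat) (w : nat -> step) : E := (w n).1.1.
Definition A_ (n : nat) (w : nat -> step) : A := (w n).1.2.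
Definition B_ (n : nat) (w : nat -> step) : B := (w n).2.

Definition cylinders (I : set nat) : set (set (nat -> step)) :=
  [set (fun w : nat -> step => w k) @^-1` S
    | k in I & S in @measurable _ (borel E * borel A * borel B)%type].

Definition traj : measurableType (cylinders setT).-sigma :=
  g_sigma_algebraType (cylinders setT).

(* sigma(X_0, A_0, B_0, ..., X_n, A_n, B_n) *)
Definition history (n : nat) : set (set (nat -> step)) :=
  <<s cylinders [set k | (k <= n)%N] >>.

(* sigma(X_0, A_0, B_0, ..., A_(n-1), B_(n-1), X_n) *)
Definition history_before_action (n : nat) : set (set (nat -> step)) :=
  <<s cylinders [set k | (k < n)%N] `|`
      [set X_ n @^-1` C | C in @measurable _ (borel E)] >>.

Variable G : game R E A B.
Implicit Types (f : nat -> E -> probability (borel A) R)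
  (g : nat -> E -> probability (borel B) R).

Definition is_law f g (x : E) (P : probability traj R) : Prop :=
  [/\ (forall C : set (borel E), measurable C -> P (X_ 0 @^-1` C) = \d_(x : borel E) C),
      (forall n (H : set traj) (U : set (borel A)) (W : set (borel B)),
         history_before_action n H -> measurable U -> measurable W ->
         P (H `&` (A_ n @^-1` U `&` B_ n @^-1` W)) =
         \int[P]_(w in H) (f n (X_ n w) U * g n (X_ n w) W))%E
    & (forall n (H : set traj) (C : set (borel E)),
         history n H -> measurable C ->
         P (H `&` X_ n.+1 @^-1` C) =
         \int[P]_(w in H) Q G (X_ n w, A_ n w, B_ n w) C)%E].

(* When f and g are policies, the Ionescu Tulcea theorem gives a P satisfying
   is_law f g x, with uniquely determined values on measurable sets; get selects
   such a P. *)
Definition law f g (x : E) : probability traj R := get (is_law f g x).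

Definition total_reward (beta : R) (w : traj) : R :=
  limn (series (fun k => beta ^+ k * r G (X_ k w, A_ k w, B_ k w))).

Definition Vpol (beta : R) f g (x : E) (gamma : R) : \bar R :=
  'E_(law f g x)[fun w => expR (gamma * total_reward beta w)].

Definition upper_value (beta : R) (x : E) (gamma : R) : \bar R :=
  ereal_inf [set ereal_sup [set Vpol beta f g x gamma
                             | f in policy (DA G)]
              | g in policy (DB G)].

Definition lower_value (beta : R) (x : E) (gamma : R) : \bar R :=
  ereal_sup [set ereal_inf [set Vpol beta f g x gamma
                             | g in policy (DB G)]
              | f in policy (DA G)].

(* The upper value is finite on the relevant domain; in shapley_solution the
   lower bound 1 <= v also excludes the junk value fine (+oo) = 0. *)
Definition Vinf (beta : R) (p : E * R) : R := fine (upper_value beta p.1 p.2).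

Definition optimal1 (beta gamma : R) f : Prop :=
  policy (DA G) f /\
  forall g, policy (DB G) g -> forall x,
    (lower_value beta x gamma <= Vpol beta f g x gamma)%E.

Definition optimal2 (beta gamma : R) g : Prop :=
  policy (DB G) g /\
  forall f, policy (DA G) f -> forall x,
    (Vpol beta f g x gamma <= upper_value beta x gamma)%E.

Definition tildeQ (x : E) (gamma : R) (a : A) (b : B)
    (S : set (borel E)) : \bar R :=
  ((expR (gamma * r G (x, a, b)))%:E * Q G (x, a, b) S)%E.

(* The library integral accepts any set function as integrator; on measurable
   sets tildeQmix x gamma mu nu is the finite measure
   \int\int tildeQ(. | x, gamma, a, b) mu(da) nu(db). *)
Definition tildeQmix (x : E) (gamma : R) (mu : probability (borel A) R)
    (nu : probability (borel B) R) (S : set (borel E)) : \bar R :=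
  (\int[nu]_b \int[mu]_a tildeQ x gamma a b S)%E.

Definition Lop (beta : R) (v : E * R -> R) (x : E) (gamma : R)
    (mu : probability (borel A) R) (nu : probability (borel B) R) : \bar R :=
  (\int[tildeQmix x gamma mu nu]_x' (v (x', (beta * gamma)%R))%:E)%E.

Definition Top (beta : R) (v : E * R -> R) (x : E) (gamma : R) : \bar R :=
  ereal_inf [set ereal_sup [set Lop beta v x gamma mu nu
                             | mu in @Padm E A R (DA G) x]
              | nu in @Padm E B R (DB G) x].

Definition dom (gammabar : R) : set (E * R) :=
  [set p | 0 < p.2 <= gammabar].

(* Functions on E x ]0, gammabar] are total functions on E x R; only their
   restriction to dom gammabar matters. *)
Definition bounded_continuous_on (gammabar : R) (v : E * R -> R) : Prop :=
  {within dom gammabar, continuous v} /\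
  exists M : R, forall p, dom gammabar p -> `|v p| <= M.

Definition shapley_solution (beta gammabar : R) (v : E * R -> R) : Prop :=
  [/\ bounded_continuous_on gammabar v,
      (forall p, dom gammabar p ->
         1 <= v p <= expR (p.2 * (rbar G / (1 - beta))))
    & (forall p, dom gammabar p -> (v p)%:E = Top beta v p.1 p.2)].

Definition saddle_point (M N : Type) (h : M -> N -> \bar R) (SM : set M)
    (SN : set N) (mu0 : M) (nu0 : N) : Prop :=
  [/\ SM mu0, SN nu0,
      (forall mu, SM mu -> (h mu nu0 <= h mu0 nu0)%E)
    & (forall nu, SN nu -> (h mu0 nu0 <= h mu0 nu)%E)].

Definition saddle_selector (beta gammabar : R)
    (mus : E * R -> probability (borel A) R)
    (nus : E * R -> probability (borel B) R) : Prop :=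
  [/\ measurable_fun (dom gammabar : set (borel E * R)%type)
        (mus : (borel E * R)%type -> borel (Pweak R A)),
      measurable_fun (dom gammabar : set (borel E * R)%type)
        (nus : (borel E * R)%type -> borel (Pweak R B))
    & (forall p, dom gammabar p ->
         saddle_point (Lop beta (Vinf beta) p.1 p.2)
           (@Padm E A R (DA G) p.1) (@Padm E B R (DB G) p.1)
           (mus p) (nus p))].

End process.

(* Main.v *)
Require Import Defs.
From HB Require Import structures.
From mathcomp Require Import all_boot all_order all_algebra.
From mathcomp Require Import all_classical all_reals all_analysis.
From mathcomp Require Import measurable_realfun giry ring lra.
Set Implicit Arguments.
Unset Strict Implicit.
Unset Printing Implicit Defensive.
Import Order.TTheory GRing.Theory Num.Theory.
Import numFieldNormedType.Exports.
Local Open Scope classical_set_scope.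
Local Open Scope ring_scope.

(* Since gamma enters the state as gamma beta^n, the game is a stochastic game
   on E x [0, gammabar] with the multiplicative one-step payoff
   F_v = e^(gamma r) int v(x', beta gamma) dQ.  For continuous v, F_v is jointly
   continuous, so the one-shot games have a value, continuous in the state
   because optimal strategies pass to weak limits along ultrafilters (the
   supports lie near the compact sets A_x), and measurable optimal strategies,
   found by lexicographic minimization of countably many test integrals.
   The iterates T^n 1 increase and satisfy
   T^(n+m) 1 <= e^(beta^n gamma rbar / (1 - beta)) T^n 1, hence converge uniformly
   to a continuous fixed point V.  If one player follows the selectors of V, then
   E[e^(gamma S_n) V(X_n, gamma beta^n)], with S_n the discounted reward before
   time n, is monotone in n and tends to the total payoff; so V is the value of
   the game, for every fixed point V, which also gives uniqueness. *)

(** * Measures, kernels and integrals *)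

(** The Shapley operator need not contract the sup norm, since the weight e^(gamma r) can expand
    differences. It is monotone and positively homogeneous, and a bound v <= k w at parameter beta
    gamma gives T v <= k T w at gamma; so a factor e^(a gamma), valid for every gamma, turns into
    e^(a beta gamma). The constant c = rbar / (1 - beta) solves c = rbar + beta c, which is why the
    bracket 1 <= v <= e^(gamma c) is preserved. The admissible sets move with the state, and this
    shapes the continuity proof: upper semicontinuity concentrates optimal laws near the limiting
    compact set, so that a weak limit exists, and lower semicontinuity approximates each reply of
    the opponent at the limit by replies available nearby. The weak topology is handled through test
    integrals and ultrafilters, so limit laws have to be constructed; they and the law of the play
    come from one Caratheodory extension criterion. Statements on player 2 follow from those on
    player 1 by reflecting the payoff f into M - f. *)

Lemma probability_ex d (T : measurableType d) (R : realType)
    (m : set T -> \bar R) :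
  m set0 = 0%E -> (forall A, 0 <= m A)%E -> semi_sigma_additive m ->
  m setT = 1%E -> exists P : probability T R, (P : set T -> \bar R) = m.
Proof.
move=> m0 mge0 madd m1.
pose M := isMeasure.Build d T R m m0 mge0 madd.
pose mM : {measure set T -> \bar R} := HB.pack m M.
pose PP := Measure_isProbability.Build d T R mM m1.
pose P : probability T R := HB.pack (mM : set T -> \bar R) M PP.
by exists P.
Qed.

Section cover_extension.
Context (R : realType) (T : pointedType).
Variable m : set T -> \bar R.
Hypothesis m0 : m set0 = 0%E.
Hypothesis m_ge0 : forall X, (0 <= m X)%E.

(* Equipping T with the discrete sigma-algebra allows covers by arbitrary sets. *)
Definition cover_ext : set T -> \bar R :=
  @mu_ext _ (g_sigma_algebraType [set: set T]) R m.

Lemma cover_ext_le (X : set T) (F : (set T)^nat) :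
  X `<=` \bigcup_k F k -> (cover_ext X <= \sum_(k <oo) m (F k))%E.
Proof.
move=> XF; apply: ereal_inf_lbound; exists F => //.
by split => // i; exact: sub_sigma_algebra.
Qed.

Lemma cover_ext_le1 (X Y : set T) : X `<=` Y -> (cover_ext X <= m Y)%E.
Proof.
move=> XY.
have := @cover_ext_le X (fun k => if k is 0%N then Y else set0).
have -> : (\sum_(k <oo) m (if k is 0%N then Y else set0) = m Y)%E.
  apply/cvg_lim => //; rewrite -cvg_shiftS.
  rewrite (_ : [sequence _]_n = cst (m Y)); first exact: cvg_cst.
  by apply/funext => n /=; rewrite big_nat_recl//= big1 ?adde0.
by apply; apply: (subset_trans XY) => t Yt; exists 0%N.
Qed.

Lemma le_cover_ext : {homo cover_ext : A B / A `<=` B >-> (A <= B)%E}.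
Proof. exact: (@le_mu_ext _ (g_sigma_algebraType [set: set T]) R m). Qed.

Lemma cover_ext_sigma_subadditive : sigma_subadditive cover_ext.
Proof.
exact: (@mu_ext_sigma_subadditive _ (g_sigma_algebraType [set: set T]) R m m_ge0).
Qed.

Lemma cover_ext_inf (X : set T) (c : \bar R) :
  (forall F : (set T)^nat, X `<=` \bigcup_k F k ->
     (c <= \sum_(k <oo) m (F k))%E) -> (c <= cover_ext X)%E.
Proof. by move=> h; apply: le_ereal_inf_tmp => _ [F [_ XF] <-]; exact: h. Qed.

Let om : {outer_measure set T -> \bar R} :=
  HB.pack cover_ext (isOuterMeasure.Build R T cover_ext
    (@mu_ext0 _ (g_sigma_algebraType [set: set T]) R m m0 m_ge0)
    (@mu_ext_ge0 _ (g_sigma_algebraType [set: set T]) R m m_ge0)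
    le_cover_ext cover_ext_sigma_subadditive).

Lemma cover_ext_ge0 A : (0 <= cover_ext A)%E.
Proof. exact: (outer_measure_ge0 om). Qed.

(** Caratheodory's criterion tested on the covering weight [m] only: if each [A] in [G] splits every
    [m B], summing over a cover of an arbitrary set shows that [A] splits the outer measure. The
    Caratheodory sets then contain the generated sigma-algebra. Weak limits and the law of the play
    are both built this way. *)
Lemma cover_ext_probability (G : set (set T)) :
  (forall A, G A -> forall B,
     (cover_ext (B `&` A) + cover_ext (B `\` A) <= m B)%E) ->
  cover_ext setT = 1%E ->
  exists P : probability (g_sigma_algebraType G) R,
    (P : set T -> \bar R) = cover_ext.
Proof.
move=> Gm ext1.
have sub : <<s G >> `<=` om.-cara.-measurable.
  apply: smallest_sub.
    split; [exact: measurable0|by move=> X mX; rewrite setTD; exact: measurableC|].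
    by move=> u_ mu_; exact: bigcupT_measurable.
  move=> A GA; apply: (@le_caratheodory_measurable R T om) => X.
  apply: cover_ext_inf => F XF.
  apply: (@le_trans _ _ (\sum_(k <oo) (cover_ext (F k `&` A) +
                                       cover_ext (F k `\` A)))%E).
    rewrite nneseriesD//; last 2 first.
      by move=> *; exact: cover_ext_ge0.
      by move=> *; exact: cover_ext_ge0.
    apply: leeD.
      apply: le_trans (cover_ext_sigma_subadditive _).
      apply: le_cover_ext => x [Xx Ax]; have [k _ Fk] := XF _ Xx.
      by exists k.
    apply: le_trans (cover_ext_sigma_subadditive _).
    apply: le_cover_ext => x [Xx Ax]; have [k _ Fk] := XF _ Xx.
    by exists k.
  apply: lee_nneseries => [k _|k _]; last exact: Gm.
  by move=> _; apply: adde_ge0; exact: cover_ext_ge0.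
apply: (@probability_ex _ (g_sigma_algebraType G)) => //.
- exact: (outer_measure0 om).
- exact: cover_ext_ge0.
- move=> F mF tF mUF; apply: (@caratheodory_measure_sigma_additive R T om) => //.
    by move=> i; exact: (sub _ (mF i)).
  exact: (sub _ mUF).
Qed.

End cover_extension.

Section kernel_bind.
Context d d' (X : measurableType d) (Y : measurableType d') (R : realType).

(** Kernels are kept as plain functions with a measurability predicate, so that decision rules and
    functions obtained by choice can serve as kernels directly. *)
Definition is_kernel (k : X -> probability Y R) :=
  forall U, measurable U -> measurable_fun [set: X] (k ^~ U : X -> \bar R).

Lemma measurable_integral_kernel (k : X -> probability Y R)
    (h : X * Y -> \bar R) : is_kernel k -> (forall z, 0 <= h z)%E ->
  measurable_fun setT h ->
  measurable_fun setT (fun x => \int[k x]_y h (x, y))%E.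
Proof.
move=> kk h0 mh.
pose k' : X -> {measure set Y -> \bar R} := k.
have k1 x : k' x setT = 1%E by exact: probability_setT.
pose K1 := isKernel.Build _ _ X Y R k' kk.
pose K2 : R.-ker X ~> Y := HB.pack k' K1.
pose K3 := Kernel_isProbability.Build _ _ X Y R K2 k1.
pose K : R.-pker X ~> Y := HB.pack (K2 : X -> {measure set Y -> \bar R}) K1 K3.
exact: (measurable_fun_integral_finite_kernel h K h0 mh).
Qed.

Lemma kernel_bind_ex (mu : probability X R) (k : X -> probability Y R) :
  is_kernel k ->
  exists P : probability Y R,
    (forall U, measurable U -> P U = \int[mu]_x k x U)%E /\
    (forall f : Y -> \bar R, (forall y, 0 <= f y)%E -> measurable_fun setT f ->
       \int[P]_y f y = \int[mu]_x \int[k x]_y f y)%E.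
Proof.
move=> kk.
pose k' : X -> giry Y R := k.
have mk' : measurable_fun setT k' by exact: measurable_giry_codensity.
pose M := giry_join (giry_map mk' mu).
have ME U : measurable U -> M U = (\int[mu]_x k x U)%E.
  move=> mU; rewrite /M /giry_join /= giry_int_map//.
  exact: measurable_giry_ev.
have M1 : M setT = 1%E.
  rewrite ME//; under eq_integral do rewrite probability_setT.
  transitivity (1 * mu setT)%E; first exact: integral_cst.
  by rewrite probability_setT mul1e.
have [P PE] := @probability_ex _ Y R M (measure0 M) (measure_ge0 M)
  (@measure_semi_sigma_additive _ _ _ M) M1.
exists P; split => [U mU|f f0 mf]; first by rewrite PE ME.
transitivity (\int[M]_y f y)%E.
  apply: eq_measure_integral => U mU _.
  exact: (congr1 (fun g : set Y -> \bar R => g U) PE).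
have := @giry_int_join _ _ R (giry_map mk' mu) f mf f0.
rewrite /giry_int => ->.
have := @giry_int_map _ _ _ _ R _ mk' mu (fun P => giry_int P f).
rewrite /giry_int /= => ->//.
  exact: measurable_giry_int.
by move=> ?; exact: integral_ge0.
Qed.

(** The bind of the Giry monad. [get] picks a law satisfying the mass formula and the integral
    formula; [kernel_bind_ex] provides one when [k] is a kernel. *)
Definition kernel_bind (mu : probability X R) (k : X -> probability Y R)
  : probability Y R := get [set P : probability Y R |
    (forall U, measurable U -> P U = \int[mu]_x k x U)%E /\
    (forall f : Y -> \bar R, (forall y, 0 <= f y)%E -> measurable_fun setT f ->
       \int[P]_y f y = \int[mu]_x \int[k x]_y f y)%E].

Lemma kernel_bindE mu k U : is_kernel k -> measurable U ->
  kernel_bind mu k U = (\int[mu]_x k x U)%E.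
Proof.
by move=> kk mU; have [+ _] := getPex (kernel_bind_ex mu kk); exact.
Qed.

Lemma integral_kernel_bind mu k f : is_kernel k -> (forall y, 0 <= f y)%E ->
  measurable_fun setT f ->
  (\int[kernel_bind mu k]_y f y = \int[mu]_x \int[k x]_y f y)%E.
Proof.
by move=> kk; have [_ +] := getPex (kernel_bind_ex mu kk); exact.
Qed.

End kernel_bind.

Lemma is_kernel_bind d d' d'' (X : measurableType d) (Y : measurableType d')
    (Z : measurableType d'') (R : realType) (mu : X -> probability Y R)
    (k : X * Y -> probability Z R) : is_kernel mu -> is_kernel k ->
  is_kernel (fun x => kernel_bind (mu x) (fun y => k (x, y))).
Proof.
move=> kmu kk U mU.
have kx x : is_kernel (fun y => k (x, y)).
  move=> V mV.
  exact: (measurableT_comp (kk V mV) (measurable_pair1 x)).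
under eq_fun do rewrite kernel_bindE//.
exact: (@measurable_integral_kernel _ _ _ _ _ mu (fun z => k z U)) (kk U mU).
Qed.

Lemma is_kernel_dirac d d' (X : measurableType d) (Y : measurableType d')
    (R : realType) (f : X -> Y) : measurable_fun setT f ->
  is_kernel (fun x => \d_(f x) : probability Y R).
Proof.
move=> mf U mU /=; rewrite /dirac.
apply/measurable_EFinP.
exact: (measurableT_comp (measurable_indic mU) mf).
Qed.

Lemma is_kernel_comp d d' d'' (X : measurableType d) (Y : measurableType d')
    (Z : measurableType d'') (R : realType) (f : X -> Y)
    (k : Y -> probability Z R) : measurable_fun setT f -> is_kernel k ->
  is_kernel (k \o f).
Proof. by move=> mf kk U mU; exact: (measurableT_comp (kk U mU) mf). Qed.

Lemma is_kernel_cst d d' (X : measurableType d) (Y : measurableType d')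
    (R : realType) (P : probability Y R) : is_kernel (fun _ : X => P).
Proof. by move=> U mU; exact: measurable_cst. Qed.

Lemma probability_prod_unique d d' (X : measurableType d) (Y : measurableType d')
    (R : realType) (m1 m2 : probability (X * Y)%type R) :
  (forall A B, measurable A -> measurable B -> m1 (A `*` B) = m2 (A `*` B)) ->
  forall C, measurable C -> m1 C = m2 C.
Proof.
move=> m12 C mC.
apply: (@measure_unique _ R _ [set A `*` B | A in measurable & B in measurable]
  (fun=> setT)) => //.
- exact: measurable_prod_measurableType.
- move=> _ _ [A mA [B mB <-]] [A' mA' [B' mB' <-]].
  exists (A `&` A'); first exact: measurableI.
  by exists (B `&` B'); [exact: measurableI|rewrite setXI].
- by move=> _; exists setT => //; exists setT => //; rewrite setXTT.
- by rewrite bigcup_const.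
- by move=> _ [A mA [B mB <-]]; exact: m12.
- by move=> _; rewrite (le_lt_trans (probability_le1 m1 measurableT)) ?ltry.
Qed.

(** On the product of (W, G) and S, the law of (w, Z w) and the law [P] restricted to [G] followed
    by [k] agree on rectangles, where the hypothesis applies, hence everywhere. The gain is that
    [phi] may couple the past and [Z] arbitrarily. *)
Lemma disintegration d d' (W : measurableType d) (S : measurableType d')
    (R : realType) (P : probability W R) (G : set (set W)) (Z : W -> S)
    (k : W -> probability S R) :
  G `<=` measurable -> measurable_fun setT Z ->
  @is_kernel _ _ (g_sigma_algebraType G) S R k ->
  (forall H C, <<s G >> H -> measurable C ->
     P (H `&` Z @^-1` C) = \int[P]_(w in H) k w C)%E ->
  forall phi : g_sigma_algebraType G * S -> \bar R,
    (forall z, 0 <= phi z)%E -> measurable_fun setT phi ->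
    (\int[P]_w phi (w, Z w) = \int[P]_w \int[k w]_s phi (w, s))%E.
Proof.
move=> Gm mZ kk PZ phi phi0 mphi.
have sGm : <<s G >> `<=` (measurable : set (set W)).
  by apply: smallest_sub => //; exact: sigma_algebra_measurable.
pose WG := g_sigma_algebraType G.
have mid : measurable_fun [set: W] (id : W -> WG).
  by move=> _ B mB; rewrite setTI; exact: sGm.
have mpair : measurable_fun [set: W] (fun w => (w : WG, Z w)).
  exact: measurable_fun_pair.
have idk : is_kernel (fun w : W => \d_(w : WG) : probability WG R).
  exact: (@is_kernel_dirac _ _ W WG R id).
(* The restriction of [P] to the coarser sigma-algebra, as the image of [P] under the identity
   map. *)
pose PG : probability WG R := kernel_bind P (fun w => \d_(w : WG)).
have PGint f : (forall y, 0 <= f y)%E -> measurable_fun [set: WG] f ->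
    (\int[PG]_y f y = \int[P]_x f x)%E.
  move=> f0 mf; rewrite integral_kernel_bind//.
  apply: eq_integral => w _.
  by rewrite integral_dirac// diracT mul1e.
have pairk : is_kernel (fun w : W => \d_((w : WG, Z w)) : probability (WG * S)%type R).
  exact: is_kernel_dirac.
have pairk2 : is_kernel (fun z : WG * S => \d_z : probability (WG * S)%type R).
  exact: (@is_kernel_dirac _ _ _ _ R id).
have pairk2' w : is_kernel (fun s : S => \d_(w : WG, s) : probability (WG * S)%type R).
  apply: (@is_kernel_dirac _ _ _ (WG * S)%type R (fun s => (w, s))).
  exact: measurable_pair1.
pose M1 := kernel_bind P (fun w => \d_((w : WG, Z w)) : probability (WG * S)%type R).
pose K (w : WG) := kernel_bind (k w) (fun s => \d_(w, s) : probability (WG * S)%type R).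
have kK : is_kernel K := is_kernel_bind kk pairk2.
pose M2 := kernel_bind PG K.
have M12 : forall C, measurable C -> M1 C = M2 C.
  apply: probability_prod_unique => A B mA mB.
  have mAB : measurable (A `*` B) by exact: measurableX.
  have KE w : K w (A `*` B) = ((\1_A w)%:E * k w B)%E.
    rewrite kernel_bindE//.
    transitivity (\int[k w]_s ((\1_A w)%:E * (\1_B s)%:E))%E.
      apply: eq_integral => s _; rewrite -EFinM !indicE /= diracE in_setX/=.
      by case: (w \in A); case: (s \in B); rewrite /= ?(mul1r, mul0r).
    rewrite ge0_integralZl//; last first.
      by apply/measurable_EFinP; exact: measurable_indic.
    by rewrite integral_indic// setIT.
  rewrite kernel_bindE// [RHS]kernel_bindE//.
  rewrite PGint//; last exact: kK.
  under [RHS]eq_integral do rewrite KE.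
  transitivity (\int[P]_x (\1_(A `&` Z @^-1` B) x)%:E)%E.
    by apply: eq_integral => w _; rewrite /= diracE; congr (_%:R%:E).
  have mAZB : measurable (A `&` Z @^-1` B : set W).
    apply: measurableI; first exact: sGm.
    by rewrite -[X in measurable X]setTI; exact: mZ.
  transitivity (P (A `&` Z @^-1` B)); first by rewrite integral_indic// setIT.
  rewrite PZ// [LHS]integral_mkcond.
  apply: eq_integral => w _.
  by rewrite patchE indicE; case: (w \in A); rewrite ?mul1e ?mul0e.
transitivity (\int[M1]_z phi z)%E.
  rewrite integral_kernel_bind//; apply: eq_integral => w _.
  by rewrite integral_dirac// diracT mul1e.
transitivity (\int[M2]_z phi z)%E.
  by apply: eq_measure_integral => C mC _; exact: M12.
rewrite integral_kernel_bind// PGint//; last 2 first.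
- by move=> w; exact: integral_ge0.
- apply: (@measurable_integral_kernel _ _ WG _ _ K (fun z => phi z.2)) => //.
  exact: measurableT_comp.
apply: eq_integral => w _.
rewrite integral_kernel_bind//; apply: eq_integral => s _.
by rewrite integral_dirac// diracT mul1e.
Qed.

Section bounded_integral.
Context d (T : measurableType d) (R : realType) (P : probability T R).
Implicit Type f : T -> R.

Lemma bounded_integrable f M : measurable_fun setT f ->
  (forall t, `|f t| <= M) -> P.-integrable setT (EFin \o f).
Proof.
move=> mf fM.
apply: measurable_bounded_integrable => //.
  by rewrite (le_lt_trans (probability_le1 P measurableT)) ?ltry.
exists M; split; first exact: num_real.
by move=> x Mx t _ /=; rewrite (le_trans (fM t))// ltW.
Qed.

Lemma EFin_Rintegral_prob f M : measurable_fun setT f ->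
  (forall t, `|f t| <= M) -> (\int[P]_t f t)%:E = (\int[P]_t (f t)%:E)%E.
Proof.
move=> mf fM; rewrite /Rintegral fineK//.
by apply: integrable_fin_num => //; exact: bounded_integrable fM.
Qed.

Lemma Rintegral_prob_cst (c : R) : \int[P]_t c = c.
Proof. transitivity (c * fine (P setT)); first exact: Rintegral_cst.
by rewrite probability_setT mulr1. Qed.

Lemma le_Rintegral_prob f (g : T -> R) M : measurable_fun setT f -> measurable_fun setT g ->
  (forall t, `|f t| <= M) -> (forall t, `|g t| <= M) ->
  (forall t, f t <= g t) -> \int[P]_t f t <= \int[P]_t g t.
Proof.
move=> mf mg fM gM fg; apply: le_Rintegral => //.
- exact: bounded_integrable fM.
- exact: bounded_integrable gM.
Qed.

Lemma Rintegral_prob_ge0_le f M : measurable_fun setT f ->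
  (forall t, 0 <= f t <= M) -> 0 <= \int[P]_t f t <= M.
Proof.
move=> mf fM; apply/andP; split.
  by apply: Rintegral_ge0 => t _; case/andP: (fM t).
rewrite -[leRHS]Rintegral_prob_cst.
apply: (@le_Rintegral_prob _ _ M) => //.
- by move=> t; case/andP: (fM t) => f0 fm; rewrite ger0_norm.
- by move=> t; case/andP: (fM t) => f0 fm; rewrite ger0_norm// (le_trans f0).
- by move=> t; case/andP: (fM t).
Qed.

End bounded_integral.

Lemma bounded_cvg d (T : measurableType d) (R : realType) (P : probability T R)
    (f_ : nat -> T -> R) (f : T -> R) (M : R) :
  (forall n, measurable_fun setT (f_ n)) -> measurable_fun setT f ->
  (forall n t, `|f_ n t| <= M) ->
  (forall t, f_ n t @[n --> \oo] --> f t) ->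
  \int[P]_t f_ n t @[n --> \oo] --> \int[P]_t f t.
Proof.
move=> mf_ mf fM ff.
have fM' t : `|f t| <= M.
  have /cvg_norm nf := ff t.
  rewrite -(cvg_lim _ nf)//; apply: limr_le; first by apply: cvgP nf.
  by near=> n; exact: fM.
apply: (@cvg_trans _ (fine (\int[P]_t (f_ n t)%:E) @[n --> \oo])) => //.
apply: fine_cvg; rewrite (EFin_Rintegral_prob P mf fM').
apply: (@dominated_cvg _ _ _ _ _ measurableT (fun n t => (f_ n t)%:E) _
  (fun=> M%:E)) => //.
- by move=> n; exact/measurable_EFinP.
- by move=> t _; apply: cvg_EFin; [near=> n|exact: ff].
- apply: (@bounded_integrable _ _ _ P (fun=> M) `|M|) => //.
- by move=> n t _; rewrite lee_fin; exact: fM.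
Unshelve. all: by end_near. Qed.

(** * Borel spaces and the weak topology *)

Section separable_metric.
Context (R : realType).

Definition countable_base (S : topologicalType) (U : nat -> set S) : Prop :=
  (forall k, open (U k)) /\
  forall x A, nbhs x A -> exists2 k, U k x & U k `<=` A.

(** The distance is a bare function compatible with the given topology, so that distances on
    products and on the real line combine freely. Separation of points is stated apart. *)
Record metrizes (S : topologicalType) (d : S -> S -> R) : Prop := Metrizes {
  dxx : forall x, d x x = 0 ;
  d_sym : forall x y, d x y = d y x ;
  d_tri : forall x y z, d x z <= d x y + d y z ;
  d_nbhs : forall x (A : set S),
    nbhs x A <-> exists2 e : R, 0 < e & forall y, d x y < e -> A y }.

Lemma d_ge0 (S : topologicalType) (d : S -> S -> R) x y :
  metrizes d -> 0 <= d x y.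
Proof.
move=> md; have := d_tri md x y x; rewrite (dxx md) (d_sym md y x); lra.
Qed.

Lemma base_of_dense (S : topologicalType) (d : S -> S -> R) (f : nat -> S) :
  metrizes d -> (forall x (e : R), 0 < e -> exists n, d x (f n) < e) ->
  exists U : nat -> set S, countable_base U.
Proof.
move=> md df.
pose U k : set S := if @unpickle (nat * nat)%type k is Some p
  then [set y | d (f p.1) y < p.2.+1%:R^-1] else set0.
exists U; split.
  move=> k; rewrite /U; case: unpickle => [p|]; last exact: open0.
  rewrite openE => y yp; apply/(d_nbhs md).
  exists (p.2.+1%:R^-1 - d (f p.1) y); first by rewrite subr_gt0.
  move=> z yz; apply: le_lt_trans (d_tri md (f p.1) y z) _.
  by rewrite -ltrBrDl.
move=> x A /(d_nbhs md)[e e0 eA].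
pose n := Num.truncn (2 / e).
have n0 : (0 : R) < n.+1%:R by [].
have ne : n.+1%:R^-1 < e / 2.
  rewrite -[X in _ < X]invrK ltf_pV2 ?posrE ?invr_gt0 ?divr_gt0// invf_div.
  exact: truncnS_gt.
have [j xj] := df x n.+1%:R^-1 (ltac:(by rewrite invr_gt0)).
exists (pickle (j, n)); rewrite /U pickleK /=.
  by rewrite (d_sym md).
move=> y jy; apply: eA; have {}jy : d (f j) y < e / 2 := lt_trans jy ne.
have {}xj := lt_trans xj ne; have := d_tri md x (f j) y; lra.
Qed.

End separable_metric.

(** The distance is pulled back along the embedding into the Polish space. The balls of the base are
    centred at a dense set of the ambient space, whose points may lie outside the image; hence the
    base consists of preimages of balls rather than of balls of the pulled-back distance. *)
Lemma borel_space_metrizes (R : realType) (S : ptopologicalType) :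
  borel_space R S ->
  exists (d : S -> S -> R) (U : nat -> set S),
    [/\ metrizes d, (forall x y, d x y = 0 -> x = y) & countable_base U].
Proof.
move=> [X [f [[_ [D cD dD]] finj fopen _]]].
pose d x y := mdist (f x) (f y).
have nd x (A : set S) : nbhs x A <->
    exists2 e : R, 0 < e & forall y, d x y < e -> A y.
  split.
    rewrite nbhsE => -[V [oV Vx] VA].
    have /fopen[W oW WV] := oV.
    have : nbhs (f x) W.
      by apply: open_nbhs_nbhs; split => //; move: Vx; rewrite WV.
    rewrite -metricType_numDomainType.filter_from_mdist_nbhs => -[e e0 eW].
    by exists e => // y xy; apply: VA; rewrite WV; exact: eW.
  move=> [e e0 eA].
  apply: (@filterS _ (nbhs x) _ (f @^-1` (ball (f x) e)^°)) => [y /=|].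
    by move/interior_subset; rewrite ballEmdist /= => ?; exact: eA.
  apply: open_nbhs_nbhs; split.
    by apply/fopen; exists (ball (f x) e)^° => //; exact: open_interior.
  exact: nbhsx_ballx.
have md : metrizes d.
  split => //.
  - by move=> x; exact: mdistxx.
  - by move=> x y; exact: metric_sym.
  - by move=> x y z; exact: metric_triangle.
have /countable_injP[phi phiinj] := cD.
have [e0 De0] : D !=set0.
  have [|y [_ Dy]] := dD setT _ openT; last by exists y.
  by exists (f point).
pose g n := xget e0 [set z | D z /\ phi z = n].
have gE z : D z -> g (phi z) = z.
  move=> Dz; rewrite /g; case: xgetP => [y _ [Dy /phiinj]|].
    by apply; rewrite inE.
  by move=> /(_ z); case.
exists d; suff [U cU] : exists U : nat -> set S, countable_base U.
  exists U; split => // x y /mdist_positivity; exact: finj.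
pose U k : set S := if @unpickle (nat * nat)%type k is Some p
  then [set y | mdist (g p.1) (f y) < p.2.+1%:R^-1] else set0.
exists U; split.
  move=> k; rewrite /U; case: unpickle => [p|]; last exact: open0.
  rewrite openE => y yp; apply/(d_nbhs md).
  exists (p.2.+1%:R^-1 - mdist (g p.1) (f y)); first by rewrite subr_gt0.
  move=> z yz; apply: le_lt_trans (metric_triangle (g p.1) (f y) (f z)) _.
  by rewrite -ltrBrDl.
move=> x A /(d_nbhs md)[e e_gt0 eA].
pose n := Num.truncn (2 / e).
have n0 : (0 : R) < n.+1%:R^-1 by rewrite invr_gt0.
have ne : n.+1%:R^-1 < e / 2.
  rewrite -[X in _ < X]invrK ltf_pV2 ?posrE ?invr_gt0 ?divr_gt0// invf_div.
  exact: truncnS_gt.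
have [z [/interior_subset zb Dz]] : (ball (f x) n.+1%:R^-1)^° `&` D !=set0.
  apply: dD; last exact: open_interior.
  by exists (f x); exact: nbhsx_ballx.
rewrite ballEmdist /= in zb.
exists (pickle (phi z, n)); rewrite /U pickleK /= gE//.
  by rewrite metric_sym.
move=> y jy; apply: eA; have {}jy : mdist z (f y) < e / 2 := lt_trans jy ne.
have {}zb := lt_trans zb ne; have := metric_triangle (f x) z (f y).
by rewrite /d; lra.
Qed.

(* [inf_conv d c f] is the Pasch-Hausdorff envelope: the largest c-Lipschitz
   minorant of f, used to approximate lower semicontinuous functions from
   below by continuous ones. *)
Section inf_convolution.
Context (R : realType) (S : topologicalType) (d : S -> S -> R).
Hypothesis md : metrizes d.

Definition inf_conv (c : R) (f : S -> R) (x : S) : R :=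
  inf [set f y + c * d x y | y in [set: S]].

Variable (f : S -> R).
Hypothesis f0 : forall x, 0 <= f x.

Lemma inf_conv_lb c x : 0 <= c ->
  has_inf [set f y + c * d x y | y in [set: S]].
Proof.
move=> c0; split; first by exists (f x + c * d x x), x.
exists 0 => _ [y _ <-]; rewrite addr_ge0// mulr_ge0// d_ge0//.
Qed.

Lemma inf_conv_le c x y : 0 <= c -> inf_conv c f x <= f y + c * d x y.
Proof.
by move=> c0; apply: ge_inf; [exact: (inf_conv_lb x c0).2|exists y].
Qed.

Lemma inf_conv_le_self c x : 0 <= c -> inf_conv c f x <= f x.
Proof. by move=> /(@inf_conv_le _ x x); rewrite (dxx md) mulr0 addr0. Qed.

Lemma le_inf_conv c x b : (forall y, b <= f y + c * d x y) ->
  b <= inf_conv c f x.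
Proof.
move=> h; apply: lb_le_inf; first by exists (f x + c * d x x), x.
by move=> _ [y _ <-].
Qed.

Lemma inf_conv_ge0 c x : 0 <= c -> 0 <= inf_conv c f x.
Proof.
by move=> c0; apply: le_inf_conv => y; rewrite addr_ge0// mulr_ge0// d_ge0.
Qed.

Lemma inf_conv_lip c x y : 0 <= c ->
  inf_conv c f x <= inf_conv c f y + c * d x y.
Proof.
move=> c0; rewrite -lerBlDr; apply: le_inf_conv => z.
have := inf_conv_le x z c0; have := d_tri md x y z.
move=> /(ler_wpM2l c0); rewrite mulrDr; lra.
Qed.

Lemma inf_conv_continuous c : 0 <= c -> continuous (inf_conv c f).
Proof.
move=> c0 x; apply/cvgrPdist_lt => e e0.
apply/(d_nbhs md); exists (e / (c + 1)); first by rewrite divr_gt0// ltr_wpDl.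
move=> y xy.
have c1 : 0 < c + 1 by rewrite ltr_wpDl.
have h : c * d x y < e.
  rewrite ltr_pdivlMr// in xy.
  by have := d_ge0 x y md; lra.
have := inf_conv_lip x y c0; have := inf_conv_lip y x c0.
rewrite (d_sym md y x) => h1 h2; rewrite ltr_norml; apply/andP; split; lra.
Qed.

(** Points within [e] of [x] contribute at least [b] by assumption; the others contribute at least c
    e through the penalty, as [f] is nonnegative. *)
Lemma le_inf_conv_near c x b e : 0 <= c -> (forall y, d x y < e -> b <= f y) ->
  b <= c * e -> b <= inf_conv c f x.
Proof.
move=> c0 be bce; apply: le_inf_conv => y.
have [/be|xy] := ltP (d x y) e.
  by have := mulr_ge0 c0 (d_ge0 x y md); lra.
have := ler_wpM2l c0 xy; have := f0 y; lra.
Qed.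

End inf_convolution.

Section borel_measurability.
Context (R : realType).

Lemma open_measurable_borel (S : ptopologicalType) (O : set S) : open O ->
  measurable (O : set (borel S)).
Proof. by move=> oO; exact: sub_sigma_algebra. Qed.

Lemma closed_measurable_borel (S : ptopologicalType) (C : set S) : closed C ->
  measurable (C : set (borel S)).
Proof.
move=> cC; rewrite -(setCK C); apply: measurableC.
by apply: open_measurable_borel; exact: closed_openC.
Qed.

Lemma continuous_measurable_borel (S : ptopologicalType) (f : S -> R) :
  continuous f -> measurable_fun [set: borel S] (f : borel S -> R).
Proof.
move=> cf; apply: (measurability _ (RGenOpens.measurableE R)) => _ [_ [x [y ->]] <-].
rewrite setTI; apply: open_measurable_borel; exact: open_comp.
Qed.

End borel_measurability.

(* The carriers T1, T2 of the measurable structures are copies of the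
   topological spaces S1, S2. *)
Lemma rel_open_measurable (S1 S2 : topologicalType) d1 d2
    (T1 : measurableType d1) (T2 : measurableType d2) (i1 : T1 -> S1)
    (i2 : T2 -> S2) (U1 : nat -> set S1) (U2 : nat -> set S2)
    (D X : set (T1 * T2)) :
  countable_base U1 -> countable_base U2 ->
  (forall k, measurable (i1 @^-1` U1 k)) ->
  (forall k, measurable (i2 @^-1` U2 k)) ->
  measurable D -> X `<=` D ->
  (forall z, X z -> exists2 N : set (S1 * S2), nbhs (i1 z.1, i2 z.2) N &
     forall z', D z' -> N (i1 z'.1, i2 z'.2) -> X z') ->
  measurable X.
Proof.
move=> [oU1 bU1] [oU2 bU2] mU1 mU2 mD XD Xop.
pose V k : set (T1 * T2) := if @unpickle (nat * nat)%type k is Some p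
  then (i1 @^-1` U1 p.1) `*` (i2 @^-1` U2 p.2) else set0.
have mV k : measurable (V k).
  by rewrite /V; case: unpickle => [p|//]; exact: measurableX.
(* Keep only the basic rectangles whose trace on [D] lies in [X]; by the neighbourhood assumption
   these countably many rectangles exhaust [X]. *)
pose W k := if pselect (D `&` V k `<=` X) then V k else set0.
have mW k : measurable (W k) by rewrite /W; case: pselect => h //=; exact: mV.
suff -> : X = D `&` \bigcup_k W k.
  by apply: measurableI => //; exact: bigcupT_measurable.
apply/seteqP; split; last first.
  move=> z [Dz [k _]]; rewrite /W; case: pselect => [h /= Vz|//].
  by apply: (h z); split.
move=> z Xz; split; first exact: XD.
have [N [/= [N1 N2] [/= N1z N2z] NN] NX] := Xop z Xz.
have [k1 k1z k1N] := bU1 _ _ N1z.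
have [k2 k2z k2N] := bU2 _ _ N2z.
exists (pickle (k1, k2)) => //; rewrite /W.
case: pselect => [h|] /=; first by rewrite /V pickleK.
case; rewrite /V pickleK => z' [Dz' [/= z1 z2]].
by apply: NX => //; apply: NN; split => /=; [exact: k1N|exact: k2N].
Qed.

Lemma metrizes_real (R : realType) : @metrizes R R (fun x y : R => `|x - y|).
Proof.
split.
- by move=> x; rewrite subrr normr0.
- by move=> x y; rewrite distrC.
- by move=> x y z; exact: ler_distD.
- move=> x A; split.
    by move=> /nbhs_ballP[e e0 eA]; exists e.
  by move=> [e e0 eA]; apply/nbhs_ballP; exists e.
Qed.

Lemma realType_countable_base (R : realType) :
  exists U : nat -> set R, countable_base U.
Proof.
apply: (@base_of_dense R R (fun x y : R => `|x - y|)
  (fun n => if @unpickle rat n is Some q then ratr q else 0)).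
  exact: metrizes_real.
move=> x e e0.
have [q] := rat_in_itvoo (ltac:(lra) : x < x + e).
rewrite in_itv /= => /andP[xq qx]; exists (pickle q); rewrite pickleK.
by rewrite ltr_norml; apply/andP; split; lra.
Qed.

Section weak_convergence.
Context (R : realType) (S : ptopologicalType).
Implicit Types (F : set_system (probability (borel S) R))
  (mu : probability (borel S) R).

Definition mean mu (phi : S -> R) : R := \int[mu]_s phi s.

Let tests := {phi : S -> R | bounded_continuous phi}.
Let PT := prod_topology (fun _ : tests => R : topologicalType).
Let TI : Pweak R S -> PT := @test_integrals R S.

Lemma continuous_test_integral (phi : S -> R) : bounded_continuous phi ->
  continuous ((fun mu => mean mu phi) : Pweak R S -> R).
Proof.
move=> cphi.
have c1 : continuous TI by exact: initial_continuous.
pose i : tests := exist _ phi cphi.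
have c2 : continuous ((fun g : PT => g i) : PT -> R).
  move=> g; have /cvg_sup/(_ i) h : nbhs g --> g by exact: cvg_id.
  have := @initial_continuous _ R (fun g : PT => g i) g.
  by apply: cvg_trans; exact: cvg_app h.
by move=> nu; exact: (cvg_comp _ _ (c1 nu) (c2 (TI nu))).
Qed.

(** The weak topology is initial for the map into the product over all tests, and convergence in a
    product is coordinatewise. *)
Lemma Pweak_cvgP F mu : Filter F ->
  (F --> (mu : Pweak R S)) <->
  (forall phi : S -> R, bounded_continuous phi ->
     mean nu phi @[nu --> F] --> mean mu phi).
Proof.
move=> FF; split=> [Fmu phi cphi|h].
  have := @continuous_test_integral phi cphi mu.
  by apply: cvg_trans; exact: cvg_app Fmu.
have TImu : TI @ F --> TI mu.
  apply/cvg_sup => -[phi cphi].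
  apply/cvg_image.
    by rewrite eqEsubset; split => // t _; exists (fun=> t).
  move=> D Dphi.
  exists [set g : PT | D (g (exist _ phi cphi))].
    by have := h phi cphi; apply.
  apply/seteqP; split => [_ [g Dg <-]//|t Dt].
  by exists (fun=> t).
move=> A [B [[C oC <-] /= Cmu] CA].
apply: filterS CA _; apply: TImu.
by apply: open_nbhs_nbhs; split.
Qed.

End weak_convergence.

Section evaluation.
Context (R : realType) (S : ptopologicalType) (d : S -> S -> R).
Hypothesis md : metrizes d.
Implicit Type mu : probability (borel S) R.

Lemma bounded_continuous_inf_conv (c : R) (f : S -> R) (M : R) : 0 <= c ->
  (forall x, 0 <= f x <= M) -> bounded_continuous (inf_conv d c f).
Proof.
move=> c0 fM; have f0 x : 0 <= f x by case/andP: (fM x).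
split; first exact: inf_conv_continuous.
exists M => x; rewrite ger0_norm ?inf_conv_ge0//.
by rewrite (le_trans (inf_conv_le_self md f0 x c0))//; case/andP: (fM x).
Qed.

Lemma inf_conv_indic_cvg (V : set S) x : open V ->
  inf_conv d n%:R \1_V x @[n --> \oo] --> (\1_V x : R).
Proof.
move=> oV; have i0 y : 0 <= \1_V y :> R by [].
have [Vx|nVx] := pselect (V x); last first.
  have -> : \1_V x = 0 :> R by rewrite indicE memNset.
  rewrite [X in X @ _ --> _](_ : _ = fun=> 0); first exact: cvg_cst.
  apply/funext => n; apply/eqP; rewrite eq_le inf_conv_ge0// andbT.
  by rewrite (le_trans (inf_conv_le_self md i0 x _))// indicE memNset.
have -> : \1_V x = 1 :> R by rewrite indicE mem_set.
have [e e0 eV] : exists2 e : R, 0 < e & forall y, d x y < e -> V y.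
  by apply/(d_nbhs md); exact: open_nbhs_nbhs.
apply: cvg_near_cst; near=> n.
apply/eqP; rewrite eq_le; apply/andP; split.
  by rewrite (le_trans (inf_conv_le_self md i0 x _))// indicE mem_set.
apply: (@le_inf_conv_near _ _ _ md _ i0 _ _ _ e) => //.
  by move=> y /eV Vy; rewrite indicE mem_set.
rewrite -ler_pdivrMr// div1r; near: n; exact: nbhs_infty_ger.
Unshelve. all: by end_near. Qed.

Lemma mean_inf_conv_indic_cvg (V : set S) mu : open V ->
  mean mu (inf_conv d n%:R \1_V) @[n --> \oo] --> fine (mu V).
Proof.
move=> oV; have mV := open_measurable_borel oV.
have i0 y : 0 <= \1_V y :> R by [].
have -> : fine (mu V) = mean mu \1_V.
  by rewrite /mean /Rintegral integral_indic// setIT.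
apply: (@bounded_cvg _ _ _ mu _ _ 1).
- move=> n; apply: continuous_measurable_borel; exact: inf_conv_continuous.
- exact: measurable_indic.
- move=> n t; rewrite ger0_norm ?inf_conv_ge0//.
  by rewrite (le_trans (inf_conv_le_self md i0 t _))// indicE lern1 leq_b1.
- by move=> t; exact: inf_conv_indic_cvg.
Qed.

Lemma measurable_mean (phi : S -> R) : bounded_continuous phi ->
  measurable_fun [set: borel (Pweak R S)]
    ((fun mu => mean mu phi) : borel (Pweak R S) -> R).
Proof.
move=> cphi; apply: (@continuous_measurable_borel R (Pweak R S)).
exact: continuous_test_integral.
Qed.

(** A Dynkin-class argument: the mass of an open set is a limit of test integrals, those of the
    Lipschitz envelopes of its indicator. Consequently every map measurable for the weak topology,
    in particular every decision rule, is a kernel. *)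
Lemma measurable_eval (U : set (borel S)) : measurable U ->
  measurable_fun [set: borel (Pweak R S)]
    ((fun mu : probability (borel S) R => mu U) : borel (Pweak R S) -> \bar R).
Proof.
pose ev U : borel (Pweak R S) -> \bar R :=
  fun mu => (mu : probability (borel S) R) U.
rewrite -/(ev U); move: U; apply: (@dynkin_induction _ (borel S) open) => //.
- by move=> A B; exact: openI.
- rewrite (_ : ev setT = fun=> 1%E); first exact: measurable_cst.
  by apply/funext => mu; exact: probability_setT.
- move=> V oV.
  have mV := open_measurable_borel oV.
  rewrite (_ : ev V = EFin \o (fun mu => fine (ev V mu))); last first.
    by apply/funext => mu /=; rewrite fineK// fin_num_measure.
  apply/measurable_EFinP.
  apply: (@measurable_fun_cvg _ (borel (Pweak R S)) R setT
    (fun n mu => mean (mu : probability (borel S) R) (inf_conv d n%:R \1_V))).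
    move=> n; apply: measurable_mean.
    apply: (@bounded_continuous_inf_conv _ _ 1) => // x.
    by rewrite indicE ler0n lern1 leq_b1.
  by move=> mu _; exact: mean_inf_conv_indic_cvg.
- move=> V mV mev.
  rewrite (_ : ev (~` V) = fun mu => (1 - ev V mu)%E); last first.
    by apply/funext => mu; rewrite /ev probability_setC.
  exact: emeasurable_funB.
- move=> F mF tF mev.
  rewrite (_ : ev (\bigcup_k F k) = fun mu => (\sum_(k <oo) ev (F k) mu)%E).
    by apply: ge0_emeasurable_sum => // k mu _ _; exact: measure_ge0.
  apply/funext => mu; rewrite /ev measure_semi_bigcup//.
  exact: bigcup_measurable.
Qed.

Lemma is_kernel_borel dX (X : measurableType dX)
    (f : X -> probability (borel S) R) :
  measurable_fun [set: X] (f : X -> borel (Pweak R S)) -> is_kernel f.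
Proof. by move=> mf U mU; exact: (measurableT_comp (measurable_eval mU) mf). Qed.

Lemma probability_eq_open (mu nu : probability (borel S) R) :
  (forall V : set S, open V -> mu V = nu V) ->
  forall V : set (borel S), measurable V -> mu V = nu V.
Proof.
move=> h V mV; apply: (@measure_unique _ R (borel S) open (fun=> setT)) => //.
- by move=> A B; exact: openI.
- by move=> _; exact: openT.
- by rewrite bigcup_const.
- by move=> _; rewrite (le_lt_trans (probability_le1 mu measurableT)) ?ltry.
Qed.

(** Masses of open sets determine a law, and an open set is an increasing union of finite unions of
    base sets. So the envelopes of the indicators of finite unions suffice; that they are countably
    many is what the measurable selection relies on. *)
Lemma mean_separates (U : nat -> set S) (mu nu : probability (borel S) R) :
  countable_base U ->
  (forall (l : seq nat) n,
    mean mu (inf_conv d n%:R \1_(\bigcup_(k in [set` l]) U k)) =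
    mean nu (inf_conv d n%:R \1_(\bigcup_(k in [set` l]) U k))) ->
  forall V : set (borel S), measurable V -> mu V = nu V.
Proof.
move=> [oU bU] h; apply: probability_eq_open => V oV.
have hl (l : seq nat) : mu (\bigcup_(k in [set` l]) U k) =
    nu (\bigcup_(k in [set` l]) U k).
  set W := \bigcup_(k in _) _.
  have oW : open W by apply: bigcup_open => k _.
  have mW := open_measurable_borel oW.
  rewrite -(@fineK _ (mu W)) ?fin_num_measure//.
  rewrite -(@fineK _ (nu W)) ?fin_num_measure//; congr EFin.
  have c1 := @mean_inf_conv_indic_cvg W mu oW.
  have c2 := @mean_inf_conv_indic_cvg W nu oW.
  rewrite -(cvg_lim _ c1)// -(cvg_lim _ c2)//.
  by under eq_fun do rewrite h.
pose l n := [seq k <- iota 0 n | `[< U k `<=` V >]].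
pose W n := \bigcup_(k in [set` l n]) U k.
have WV : \bigcup_n W n = V.
  apply/seteqP; split.
    move=> x [n _ [k /=]]; rewrite mem_filter => /andP[/asboolP UV _] Ux.
    exact: UV.
  move=> x Vx; have [k Ux UV] := bU x V (open_nbhs_nbhs (conj oV Vx)).
  exists k.+1 => //; exists k => //=.
  by rewrite mem_filter mem_iota /= add0n ltnSn andbT; exact/asboolP.
have mW n : measurable (W n : set (borel S)).
  by apply: open_measurable_borel; apply: bigcup_open => k _.
have ndW : nondecreasing_seq W.
  move=> m n mn; apply/subsetPset => x [k /=].
  rewrite mem_filter mem_iota => /andP[UV km] Ux; exists k => //=.
  by rewrite mem_filter UV mem_iota /= add0n (leq_trans _ mn)//; case/andP: km.
have mV : measurable (\bigcup_n W n : set (borel S)) by exact: bigcupT_measurable.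
have c1 := @nondecreasing_cvg_mu _ _ _ mu W mW mV ndW.
have c2 := @nondecreasing_cvg_mu _ _ _ nu W mW mV ndW.
rewrite -WV -(cvg_lim _ c1)// -(cvg_lim _ c2)//; congr (limn _).
by apply/funext => n; exact: hl.
Qed.

End evaluation.

Lemma metrizes_hausdorff (R : realType) (S : topologicalType) (d : S -> S -> R) :
  metrizes d -> (forall x y, d x y = 0 -> x = y) -> hausdorff_space S.
Proof.
move=> md d0 x y xy; apply: d0; apply/eqP; rewrite eq_le d_ge0// andbT.
apply/ler_addgt0Pr => e e0; rewrite add0r.
have h (z : S) : nbhs z [set w | d z w < e / 2].
  by apply/(d_nbhs md); exists (e / 2) => //; rewrite divr_gt0.
have [z [/= xz yz]] := xy _ _ (h x) (h y).
have := d_tri md x z y; rewrite (d_sym md z y); lra.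
Qed.

Section mean_lemmas.
Context (R : realType) (S : ptopologicalType).
Implicit Types (mu : probability (borel S) R) (phi : S -> R).

Lemma le_mean mu phi (psi : S -> R) M :
  measurable_fun [set: borel S] (phi : borel S -> R) ->
  measurable_fun [set: borel S] (psi : borel S -> R) ->
  (forall s, `|phi s| <= M) -> (forall s, `|psi s| <= M) ->
  (forall s, phi s <= psi s) -> mean mu phi <= mean mu psi.
Proof. exact: (@le_Rintegral_prob _ (borel S)). Qed.

Lemma mean_affine mu phi M a b :
  measurable_fun [set: borel S] (phi : borel S -> R) ->
  (forall s, `|phi s| <= M) ->
  mean mu (fun s => a * phi s + b) = a * mean mu phi + b.
Proof.
move=> mphi phiM; have iphi := bounded_integrable mu mphi phiM.
have ib : mu.-integrable setT (EFin \o (fun=> b)).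
  by apply: (@bounded_integrable _ (borel S) R mu _ `|b|).
rewrite /mean RintegralD//; last first.
  rewrite (_ : _ \o _ = (fun s => a%:E * (phi s)%:E)%E)//.
  exact: integrableZl.
by rewrite RintegralZl// Rintegral_prob_cst.
Qed.

Lemma mean_ge0_le mu phi M :
  measurable_fun [set: borel S] (phi : borel S -> R) ->
  (forall s, 0 <= phi s <= M) -> 0 <= mean mu phi <= M.
Proof. exact: (@Rintegral_prob_ge0_le _ (borel S)). Qed.

End mean_lemmas.

(** * Weak limits *)

(* Joint continuity of (i, nu) |-> \int phi_i dnu, when phi_i converges
   continuously to psi along a filter whose relevant part is countable. *)
Section continuous_convergence.
Context (R : realType) (S : ptopologicalType) (d : S -> S -> R).
Hypothesis md : metrizes d.
Context (I : Type) (F : set_system I) {FF : ProperFilter F}.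
Variables (nu : I -> probability (borel S) R) (nu0 : probability (borel S) R).
Hypothesis nu_cvg : forall phi : S -> R, bounded_continuous phi ->
  mean (nu i) phi @[i --> F] --> mean nu0 phi.
Variables (M : R) (N : nat -> set I).
Hypothesis FN : forall m, F (N m).
Hypothesis decN : forall m n, (m <= n)%N -> N n `<=` N m.

Lemma mean_cvg_lower (phi : I -> S -> R) (psi : S -> R) :
  (forall i, measurable_fun [set: borel S] (phi i : borel S -> R)) ->
  (forall i s, 0 <= phi i s <= M) ->
  (forall s (e : R), 0 < e -> exists m, exists2 del : R, 0 < del &
     forall i, N m i -> forall s', d s s' < del -> `|phi i s' - psi s| < e) ->
  measurable_fun [set: borel S] (psi : borel S -> R) /\
  forall e : R, 0 < e ->
    \forall i \near F, mean nu0 psi - e < mean (nu i) (phi i).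
Proof.
move=> mphi phiM phipsi.
have phi0 i s : 0 <= phi i s by case/andP: (phiM i s).
pose f m s := inf [set phi i s | i in N m].
have hi m s : has_inf [set phi i s | i in N m].
  split; first by have [i Ni] := filter_ex (FN m); exists (phi i s), i.
  by exists 0 => _ [i _ <-].
have f0 m s : 0 <= f m s.
  by apply: lb_le_inf; [exact: (hi m s).1|move=> _ [i _ <-]].
have fphi m i s : N m i -> f m s <= phi i s.
  by move=> Ni; apply: ge_inf; [exact: (hi m s).2|exists i].
have fM m s : 0 <= f m s <= M.
  rewrite f0 /=; have [i Ni] := filter_ex (FN m).
  by rewrite (le_trans (fphi m i s Ni))//; case/andP: (phiM i s).
pose g m := inf_conv d m%:R (f m).
have gf m s : 0 <= g m s <= f m s.
  by rewrite inf_conv_ge0//= inf_conv_le_self.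
have cg m : bounded_continuous (g m).
  exact: (bounded_continuous_inf_conv md (ler0n _ m) (fM m)).
have mg m : measurable_fun [set: borel S] (g m : borel S -> R).
  by apply: continuous_measurable_borel; exact: (cg m).1.
have gM m s : `|g m s| <= M.
  have /andP[g0 gf'] := gf m s; rewrite ger0_norm// (le_trans gf')//.
  by case/andP: (fM m s).
have gpsi s : g m s @[m --> \oo] --> psi s.
  apply/cvgrPdist_le => e e0.
  have [m0 [del del0 h]] := phipsi s e e0.
  near=> m.
  have m0m : (m0 <= m)%N by near: m; exact: nbhs_infty_ge.
  have [i Ni] := filter_ex (FN m).
  have up : g m s <= psi s + e.
    have /andP[_ gf'] := gf m s; apply: (le_trans gf').
    apply: (le_trans (fphi m i s Ni)).
    have := h i (decN m0m Ni) s; rewrite (dxx md) => /(_ del0).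
    rewrite ltr_norml => /andP[]; lra.
  have lo : psi s - e <= g m s.
    apply: (@le_inf_conv_near _ _ _ md _ (f0 m) _ _ _ del) => //.
      move=> y sy; apply: lb_le_inf; first exact: (hi m y).1.
      move=> _ [j Nj <-]; have := h j (decN m0m Nj) y sy.
      rewrite ltr_norml => /andP[]; lra.
    rewrite -ler_pdivrMr//; near: m; exact: nbhs_infty_ger.
  rewrite ler_norml; apply/andP; split; lra.
have mpsi : measurable_fun [set: borel S] (psi : borel S -> R).
  by apply: (@measurable_fun_cvg _ (borel S) R setT g) => // s _.
split => // e e0.
have gcvg : mean nu0 (g m) @[m --> \oo] --> mean nu0 psi.
  by apply: (@bounded_cvg _ (borel S) R nu0 g psi M).
have e20 : 0 < e / 2 by rewrite divr_gt0.
have [m _ hm] := (@cvgrPdist_lt _ _ _ _ _ _ _).1 gcvg _ e20.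
have {}hm := hm m (leqnn m).
have nuc : \forall i \near F, `|mean nu0 (g m) - mean (nu i) (g m)| < e / 2.
  by have /cvgrPdist_lt := nu_cvg (cg m); exact.
apply: filterS2 (FN m) nuc => i Ni nui.
have : mean (nu i) (g m) <= mean (nu i) (phi i).
  apply: (@le_mean _ _ _ _ _ M) => //.
    by move=> s; rewrite ger0_norm//; case/andP: (phiM i s).
  move=> s; have /andP[_ gf'] := gf m s; exact: (le_trans gf' (fphi m i s Ni)).
move: hm nui; rewrite !ltr_norml => /andP[_ h1] /andP[_ h2]; lra.
Unshelve. all: by end_near. Qed.

Lemma mean_cvg_continuous (phi : I -> S -> R) (psi : S -> R) :
  (forall i, measurable_fun [set: borel S] (phi i : borel S -> R)) ->
  (forall i s, 0 <= phi i s <= M) ->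
  (forall s (e : R), 0 < e -> exists m, exists2 del : R, 0 < del &
     forall i, N m i -> forall s', d s s' < del -> `|phi i s' - psi s| < e) ->
  mean (nu i) (phi i) @[i --> F] --> mean nu0 psi.
Proof.
move=> mphi phiM phipsi.
have [mpsi lo] := mean_cvg_lower mphi phiM phipsi.
have psiM s : 0 <= psi s <= M.
  suff h (e : R) : 0 < e -> - e <= psi s <= M + e.
    apply/andP; split; [rewrite -oppr_le0|]; apply/ler_addgt0Pr => e /h/andP[]; lra.
  move=> e0; have [m [del del0 h]] := phipsi s e e0.
  have [i Ni] := filter_ex (FN m).
  have := h i Ni s; rewrite (dxx md) => /(_ del0).
  have := phiM i s => /andP[? ?]; rewrite ltr_norml => /andP[? ?].
  apply/andP; split; lra.
(* Reflection in [M] keeps the values in [0, M] and turns the lower bound into the missing upper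
   bound. *)
pose phi' i s := -1 * phi i s + M.
pose psi' s := -1 * psi s + M.
have mphi' i : measurable_fun [set: borel S] (phi' i : borel S -> R).
  by apply: measurable_funD => //; apply: measurable_funM.
have phiM' i s : 0 <= phi' i s <= M.
  by have /andP[? ?] := phiM i s; rewrite /phi'; apply/andP; split; lra.
have phipsi' s (e : R) : 0 < e -> exists m, exists2 del : R, 0 < del &
     forall i, N m i -> forall s', d s s' < del -> `|phi' i s' - psi' s| < e.
  move=> e0; have [m [del del0 h]] := phipsi s e e0.
  exists m, del => // i Ni s' ss'.
  rewrite (_ : _ - _ = - (phi i s' - psi s)); last by rewrite /phi' /psi'; lra.
  by rewrite normrN; exact: h.
have [_ up] := mean_cvg_lower mphi' phiM' phipsi'.
apply/cvgrPdist_lt => e e0.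
apply: filterS2 (lo e e0) (up e e0) => i h1.
rewrite /psi' /phi' (@mean_affine _ _ _ _ M)//; last first.
  by move=> s; rewrite ger0_norm; case/andP: (psiM s).
rewrite (@mean_affine _ _ _ _ M)//; last first.
  by move=> s; rewrite ger0_norm; case/andP: (phiM i s).
move=> h2; rewrite ltr_norml; apply/andP; split; lra.
Qed.

End continuous_convergence.

(** The sum counts the integers k < n below y, which is the ceiling of y when 0 <= y <= n. With
    [sum_step_le] this discretizes the layer-cake formula, by which means are controlled through
    masses of open level sets. *)
Lemma sum_step_ge (R : realFieldType) (y : R) n :
  y <= n%:R -> y <= \sum_(k < n) ((k%:R : R) < y)%R%:R.
Proof.
suff : Num.min y n%:R <= \sum_(k < n) ((k%:R : R) < y)%R%:R.
  by move=> + yn; rewrite min_l.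
elim: n => [|n]; first by rewrite big_ord0 ge_min lexx orbT.
rewrite big_ord_recr /=; case: (ltP n%:R y) => [ny|yn].
  move=> IH; rewrite ge_min; apply/orP; right.
  by rewrite -natr1 mulr1n lerD2r.
by rewrite mulr0n addr0 => IH; rewrite ge_min IH.
Qed.

Lemma sum_step_le (R : realFieldType) (y : R) n : 0 <= y ->
  \sum_(k < n) ((k%:R : R) < y)%R%:R <= y + 1.
Proof.
move=> y0; suff : \sum_(k < n) ((k%:R : R) < y)%R%:R <= y + 1 /\
    \sum_(k < n) ((k%:R : R) < y)%R%:R <= n%:R :> R by case.
elim: n => [|n [IH1 IH2]]; first by rewrite big_ord0; split => //; lra.
rewrite big_ord_recr /=; rewrite -natr1; have [ny|yn] := ltP n%:R y; rewrite ?mulr1n ?mulr0n.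
  by split; lra.
by rewrite addr0; split; lra.
Qed.

Lemma ultra_fmap (T U : Type) (f : T -> U) (F : set_system T) :
  UltraFilter F -> UltraFilter (f @ F).
Proof.
move=> UF; split; first exact: fmap_proper_filter.
move=> G GF sub; apply/seteqP; split => // A GA.
have [//|FnA] := in_ultra_setVsetC (f @^-1` A) UF.
by have /filter_ex[? []] : G (A `&` ~` A) by apply: filterI => //; exact: sub.
Qed.

Lemma mean_sum_indic (R : realType) (S : ptopologicalType)
    (P : probability (borel S) R) (V : nat -> set (borel S)) n :
  (forall k, measurable (V k)) ->
  mean P (fun s => \sum_(k < n) \1_(V k) s) = \sum_(k < n) fine (P (V k)).
Proof.
move=> mV; elim: n => [|n IH].
  rewrite big_ord0; under [X in mean _ X]eq_fun do rewrite big_ord0.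
  exact: Rintegral_prob_cst.
rewrite big_ord_recr /= -IH /mean.
under [LHS]eq_Rintegral do rewrite big_ord_recr /=.
rewrite RintegralD//; last 2 first.
- apply: (@bounded_integrable _ _ _ _ _ n%:R).
    by apply: measurable_sum => k; exact: measurable_indic.
  move=> t; rewrite ger0_norm ?sumr_ge0//.
  rewrite -[X in _ <= X%:R]card_ord -sum1_card natr_sum ler_sum// => k _.
  by rewrite indicE lern1 leq_b1.
- apply: (@bounded_integrable _ _ _ _ _ 1); first exact: measurable_indic.
  by move=> t; rewrite ger0_norm// indicE lern1 leq_b1.
by congr (_ + _); rewrite /Rintegral integral_indic// setIT.
Qed.

Section ultra_weak_limit.
Context (R : realType) (S : ptopologicalType) (d : S -> S -> R).
Hypothesis md : metrizes d.
Hypothesis d0 : forall x y, d x y = 0 -> x = y.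
Context (I : Type) (F : set_system I) {UF : UltraFilter F}.
Variable nu : I -> probability (borel S) R.

Let bounded_ultra_cvg (u : I -> R) (a b : R) : (forall i, a <= u i <= b) ->
  cvg (u i @[i --> F]).
Proof.
move=> uab.
have UFu : UltraFilter (u @ F) by exact: ultra_fmap.
have := @segment_compact R a b; rewrite compact_ultra => /(_ _ UFu).
have h : F (u @^-1` `[a, b]%classic).
  by apply: filterE => i; have := uab i; rewrite /= in_itv.
by move=> /(_ h) [p [_ up]]; apply/cvg_ex; exists p.
Qed.

(** Masses converge along an ultrafilter because [0, 1] is compact. The limit is finitely additive
    but possibly not countably additive, so the limit law is rebuilt from its values on open
    sets. *)
Let lam (V : set S) : R := lim (fine (nu i V) @[i --> F]).

Let nu01 i (V : set (borel S)) : measurable V -> 0 <= fine (nu i V) <= 1.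
Proof.
move=> mV; rewrite fine_ge0//= -lee_fin fineK ?fin_num_measure//.
exact: probability_le1.
Qed.

Let lamE (V : set (borel S)) : measurable V ->
  fine (nu i V) @[i --> F] --> lam V.
Proof. by move=> mV; apply: (@bounded_ultra_cvg _ 0 1) => i; exact: nu01. Qed.

Let lam_le (V W : set (borel S)) : measurable V -> measurable W -> V `<=` W ->
  lam V <= lam W.
Proof.
move=> mV mW VW; rewrite -subr_ge0.
apply: (cvgr_to_ge (cvgB (lamE mW) (lamE mV))).
apply: filterE => i; rewrite subr_ge0 fine_le ?fin_num_measure// le_measure// ?inE//.
Qed.

Let lam_ge0 (V : set (borel S)) : measurable V -> 0 <= lam V.
Proof.
move=> mV; apply: (cvgr_to_ge (lamE mV)).
by apply: filterE => i; case/andP: (nu01 i mV).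
Qed.

Let lamT : lam setT = 1.
Proof.
apply/cvg_lim => //; rewrite (_ : (fun i => _) = fun=> 1); first exact: cvg_cst.
by apply/funext => i; rewrite probability_setT.
Qed.

Let lam0 : lam set0 = 0.
Proof.
apply/cvg_lim => //; rewrite (_ : (fun i => _) = fun=> 0); first exact: cvg_cst.
by apply/funext => i; rewrite measure0.
Qed.

Let lamU (V W : set (borel S)) : measurable V -> measurable W ->
  V `&` W = set0 -> lam (V `|` W) = lam V + lam W.
Proof.
move=> mV mW VW; apply/cvg_lim => //.
rewrite (_ : (fun i => _) = fun i => fine (nu i V) + fine (nu i W)).
  by apply: cvgD; exact: lamE.
by apply/funext => i; rewrite measureU// fineD ?fin_num_measure.
Qed.

Let lam_bigU (V : nat -> set (borel S)) n : (forall k, measurable (V k)) ->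
  lam (\big[setU/set0]_(k < n) V k) <= \sum_(k < n) lam (V k).
Proof.
move=> mV; elim: n => [|n IH]; first by rewrite !big_ord0 lam0.
rewrite !big_ord_recr /=; set W := \big[setU/set0]_(k < n) V k in IH *.
have mW : measurable (W : set (borel S)) by exact: bigsetU_measurable.
have -> : W `|` V n = W `|` (V n `\` W).
  apply/seteqP; split=> x; last by case=> [|[]]; [left|right].
  by have [?|?] := pselect (W x); [left|case=> ?; [left|right]].
rewrite lamU//; last 2 first.
- exact: measurableD.
- by rewrite setIDA setIC -setIDA setDv setI0.
by rewrite lerD// lam_le//; exact: measurableD.
Qed.

Variable K : set S.
Hypothesis cK : compact K.
Hypothesis tightK : forall V, open V -> K `<=` V ->
  forall e : R, 0 < e -> \forall i \near F, 1 - e < fine (nu i V).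

Let lamK (V : set S) : open V -> K `<=` V -> lam V = 1.
Proof.
move=> oV KV; have mV := open_measurable_borel oV.
apply/eqP; rewrite eq_le; apply/andP; split.
  by rewrite -lamT lam_le.
apply/ler_addgt0Pr => e e0; rewrite -lerBlDr.
apply: (cvgr_to_ge (lamE mV)).
by apply: filterS (tightK oV KV e0) => i /ltW.
Qed.

(** Only the part of a set inside [K] is weighed: compactness of [K] then reduces countable covers
    to finite ones, for which finite additivity of [lam] is enough. *)
Let m (B : set S) : \bar R :=
  ereal_inf [set (lam V)%:E | V in [set V | open V /\ B `&` K `<=` V]].

Let m_ge0 B : (0 <= m B)%E.
Proof.
apply: le_ereal_inf_tmp => _ [V [oV _] <-]; rewrite lee_fin lam_ge0//.
exact: open_measurable_borel.
Qed.

Let m_le (B V : set S) : open V -> B `&` K `<=` V -> (m B <= (lam V)%:E)%E.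
Proof. by move=> oV BV; apply: ereal_inf_lbound; exists V. Qed.

Let m0 : m set0 = 0%E.
Proof.
apply/eqP; rewrite eq_le m_ge0 andbT.
rewrite (_ : 0%E = (lam set0)%:E); last by rewrite lam0.
by apply: m_le; [exact: open0|rewrite set0I].
Qed.

Let m_adherent (B : set S) (e : R) : 0 < e ->
  exists V, [/\ open V, B `&` K `<=` V & ((lam V)%:E <= m B + e%:E)%E].
Proof.
move=> e0.
have mBfin : m B \is a fin_num.
  rewrite ge0_fin_numE//; apply: le_lt_trans (m_le openT _) _ => //.
  exact: ltry.
have [_ [V [oV BV] <-] h] := lb_ereal_inf_adherent e0 mBfin.
by exists V; split => //; exact: ltW.
Qed.

(* Caratheodory's argument for metric outer measures: an open set A = {h > 0}
   is exhausted by {h > t_(k+1)} and the annuli {t_(j+2) < h < t_j}, j >= k,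
   whose total mass telescopes to a quantity vanishing with k. *)
Let m_open_split (A : set S) : open A -> forall B,
  (cover_ext m (B `&` A) + cover_ext m (B `\` A) <= m B)%E.
Proof.
move=> oA B; apply: le_ereal_inf_tmp => _ [V [oV BV] <-].
have i0 y : 0 <= \1_A y :> R by [].
(* In effect min(1, distance to the complement of [A]): a 1-Lipschitz function that is positive
   exactly on [A]. *)
pose h := inf_conv d 1 \1_A.
have ch : continuous h by exact: inf_conv_continuous.
have hA x : A x <-> 0 < h x.
  split=> [Ax|].
    have [e e0 eA] : exists2 e : R, 0 < e & forall y, d x y < e -> A y.
      by apply/(d_nbhs md); exact: open_nbhs_nbhs.
    apply: (@lt_le_trans _ _ (Num.min 1 e)); first by rewrite lt_min ltr01.
    apply: (@le_inf_conv_near _ _ _ md _ i0 _ _ _ e) => //.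
      by move=> y /eA Ay; rewrite indicE mem_set// ge_min lexx.
    by rewrite mul1r ge_min lexx orbT.
  move=> hx; apply: contrapT => nAx.
  have := @inf_conv_le_self _ _ _ md _ i0 1 x ler01.
  by rewrite indicE memNset// leNgt hx.
pose t j : R := j.+1%:R^-1.
have t_gt0 j : 0 < t j by rewrite invr_gt0.
have tdec j : t j.+1 < t j.
  by rewrite /t ltf_pV2 ?posrE// ltr_nat.
have oh a : open [set x | h x < a].
  by rewrite (_ : [set _ | _] = h @^-1` [set y | y < a])//; apply: open_comp.
have oh' a : open [set x | a < h x].
  by rewrite (_ : [set _ | _] = h @^-1` [set y | a < y])//; apply: open_comp.
pose W j := V `&` [set x | h x < t j].
have oW j : open (W j) by exact: openI.
have mW j : measurable (W j : set (borel S)) by exact: open_measurable_borel.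
pose b j := lam (W j).
have bdec j : b j.+1 <= b j.
  apply: lam_le => // x [Vx /= hx]; split => //=.
  exact: lt_trans hx (tdec j).
pose Ann j := V `&` ([set x | h x < t j] `&` [set x | t j.+2 < h x]).
have oAnn j : open (Ann j) by apply: openI => //; exact: openI.
have mAnn j : measurable (Ann j : set (borel S)) by exact: open_measurable_borel.
have lamAnn j : lam (Ann j) <= b j - b j.+2.
  rewrite lerBrDr -lamU//; last first.
    by apply/seteqP; split => // x [[_ [_ /= h1]] [_ /= h2]]; have := lt_trans h1 h2; rewrite ltxx.
  apply: lam_le => //; first exact: measurableU.
  move=> x [[Vx [hx _]]|[Vx /= hx]]; split => //=.
  exact: lt_trans hx (lt_trans (tdec _) (tdec _)).
(* An annulus spans two levels, so that consecutive ones overlap and no value of [h] is missed.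
   Hence the differences b j - b (j + 2), which leave two boundary terms at each end. *)
have telescope k n : \sum_(k <= j < k + n) (b j - b j.+2) =
    b k + b k.+1 - b (k + n)%N - b (k + n).+1.
  elim: n => [|n IH]; first by rewrite addn0 big_geq//; lra.
  rewrite addnS big_nat_recr ?leq_addr//= IH; lra.
have hasb : has_inf (range b).
  split; first by exists (b 0%N), 0%N.
  by exists 0 => _ [j _ <-]; exact: lam_ge0.
apply/lee_addgt0Pr => e e0.
have e30 : 0 < e / 3 by rewrite divr_gt0.
(* The errors of the estimates below add up to 2 (b k - inf b), hence to less than 2 e / 3. *)
have [_ [k _ <-] bk] := inf_adherent e30 hasb.
have bge j : inf (range b) <= b j by apply: ge_inf; [exact: hasb.2|exists j].
have h1 : (cover_ext m (B `\` A) <= (b k)%:E)%E.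
  apply: le_trans (cover_ext_le1 m0 (@subset_refl _ _)) _.
  apply: m_le => // x [[Bx nAx] Kx]; split; first by apply: BV.
  apply: le_lt_trans (t_gt0 k); rewrite leNgt; apply/negP => hx.
  by apply: nAx; apply/hA.
have h2 : (cover_ext m (B `&` A) <=
    (lam (V `&` [set x | (t k.+1 < h x)%R]))%:E + (b k + b k.+1 - 2 * inf (range b))%:E)%E.
  pose C n : set S := if n is n'.+1 then B `&` [set x | t (k + n').+2 < h x < t (k + n')%N]
    else B `&` [set x | t k.+1 < h x].
  have BAC : B `&` A `<=` \bigcup_n C n.
    move=> x [Bx /hA hx].
    have [hk|hk] := ltP (t k.+1) (h x); first by exists 0%N.
    have ex : exists n, t n < h x.
      exists (Num.truncn (h x)^-1); rewrite /t -[X in _ < X]invrK.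
      by rewrite ltf_pV2 ?posrE ?invr_gt0//; exact: truncnS_gt.
    (* For the first level with t n < h x one has h x <= t (n - 1) < t (n - 2), so [x] lies in the
       annulus of index n - 2. *)
    case: (ex_minnP ex) => n hn nmin.
    have kn : (k.+2 <= n)%N.
      rewrite ltnNge; apply/negP => nk.
      have : t k.+1 <= t n by rewrite /t lef_pV2 ?posrE// ler_nat.
      by move=> /(le_trans hk)/le_lt_trans/(_ hn); rewrite ltxx.
    exists (n - k.+2).+1 => //; split => //=.
    have -> : (k + (n - k.+2)).+2 = n by rewrite -2!addSn subnKC.
    rewrite hn /=.
    have nE : n = (k + (n - k.+2)).+2 by rewrite -2!addSn subnKC.
    have : h x <= t (k + (n - k.+2)).+1.
      rewrite leNgt; apply/negP => /nmin; rewrite [X in (X <= _)%N]nE ltnn//.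
    by move=> /le_lt_trans; apply; exact: tdec.
  apply: le_trans (cover_ext_le _ BAC) _.
  rewrite nneseries_recl//; apply: leeD.
    apply: m_le; first exact: openI.
    by move=> x [[Bx hx] Kx]; split => //; exact: BV.
  rewrite -(nneseries_addn 1)//.
  apply: lime_le; first by apply: is_cvg_nneseries => n _ _; exact: m_ge0.
  apply: nearW => n /=.
  apply: (@le_trans _ _ (\sum_(0 <= i < n) (b (k + i)%N - b (k + i).+2)%:E)%E).
    apply: lee_sum => i _; rewrite addn1 /=.
    apply: (@le_trans _ _ (lam (Ann (k + i)%N))%:E); last by rewrite lee_fin.
    apply: m_le => // x [[Bx /andP[hx1 hx2]] Kx]; split; first exact: BV.
    by split.
  rewrite sumEFin lee_fin.
  have -> : \sum_(0 <= i < n) (b (k + i)%N - b (k + i).+2) =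
      \sum_(k <= j < k + n) (b j - b j.+2).
    rewrite -[in RHS](add0n k) big_addn add0n addKn.
    by apply: eq_bigr => i _; rewrite addnC.
  rewrite telescope; have := bge (k + n)%N; have := bge (k + n).+1; lra.
have h3 : lam (V `&` [set x | t k.+1 < h x]) + b k.+1 <= lam V.
  rewrite -lamU//; last 2 first.
  - by apply: open_measurable_borel; exact: openI.
  - apply/seteqP; split => // x [[_ /= h1'] [_ /= h2']].
    by have := lt_trans h1' h2'; rewrite ltxx.
  apply: lam_le; last by move=> x [[]|[]].
  - by apply: measurableU => //; apply: open_measurable_borel; exact: openI.
  - exact: open_measurable_borel.
apply: le_trans (leeD h2 h1) _; rewrite -!EFinD lee_fin.
have := bge k.+1; have := bge k; have := bdec k; lra.
Qed.

(** For the lower bound, the traces on [K] of a countable cover are enlarged to open sets at total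
    cost [e]. Finitely many of them cover [K]; their union is an open neighbourhood of [K], so its
    limit mass is 1, and finite subadditivity of [lam] concludes. *)
Let m_total : cover_ext m setT = 1%E.
Proof.
apply/eqP; rewrite eq_le; apply/andP; split.
  apply: le_trans (cover_ext_le1 m0 (@subset_refl _ _)) _.
  by rewrite -lamT; apply: m_le; [exact: openT|].
apply: cover_ext_inf => C TC.
apply/lee_addgt0Pr => e e0.
have [V PV] : {V : nat -> set S & forall n, [/\ open (V n),
    C n `&` K `<=` V n & ((lam (V n))%:E <= m (C n) + (e / (2 ^ n.+1)%:R)%:E)%E]}.
  apply: (@choice _ _ (fun n V => [/\ open V,
    C n `&` K `<=` V & ((lam V)%:E <= m (C n) + (e / (2 ^ n.+1)%:R)%:E)%E])) => n.
  by apply: m_adherent; rewrite divr_gt0// ltr0n expn_gt0.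
have mV n : measurable (V n : set (borel S)).
  by apply: open_measurable_borel; case: (PV n).
have := cK; rewrite compact_cover => /(_ nat setT V).
case.
- by move=> n _; case: (PV n).
- move=> x Kx; have [n _ Cx] := TC x Logic.I.
  by exists n => //; case: (PV n) => _ h _; exact: h.
move=> D _ KD.
pose n := (\max_(i <- finmap.enum_fset D) i).+1.
have KW : K `<=` \big[setU/set0]_(k < n) V k.
  move=> x /KD [i /= iD Vx]; rewrite -bigcup_mkord; exists i => //=.
  by rewrite /n ltnS; apply: (@leq_bigmax_seq _ (finmap.enum_fset D) xpredT id).
have oW : open (\big[setU/set0]_(k < n) V k).
  by rewrite -bigcup_mkord; apply: bigcup_open => i _; case: (PV i).
apply: le_trans (epsilon_trick _ _ _); last 2 first.
- by move=> k; exact: m_ge0.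
- exact: ltW.
apply: (@le_trans _ _ (lam (\big[setU/set0]_(k < n) V k))%:E).
  by rewrite lamK.
apply: (@le_trans _ _ (\sum_(k < n) lam (V k))%:E).
  by rewrite lee_fin; exact: lam_bigU.
rewrite -sumEFin.
apply: (@le_trans _ _ (\sum_(k < n) (m (C k) + (e / (2 ^ k.+1)%:R)%:E))%E).
  by apply: lee_sum => k _; case: (PV k).
rewrite -(big_mkord xpredT (fun k => m (C k) + (e / (2 ^ k.+1)%:R)%:E)%E).
apply: nneseries_lim_ge => k _ _; apply: adde_ge0 => //.
by rewrite lee_fin divr_ge0// ltW.
Qed.

(** A Prokhorov-type statement along an ultrafilter. The constructed law satisfies mu V <= lam V for
    open V. Through level sets this gives mean mu phi <= lim mean (nu i) phi for continuous phi with
    values in [0, 1]; the same inequality for 1 - phi gives equality, and rescaling handles bounded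
    phi. *)
Lemma ultra_weak_limit : exists mu : probability (borel S) R,
  mu K = 1%E /\
  forall phi : S -> R, bounded_continuous phi ->
    mean (nu i) phi @[i --> F] --> mean mu phi.
Proof.
have [P PE] := cover_ext_probability m0 m_ge0 m_open_split m_total.
pose mu : probability (borel S) R := P.
have muE B : mu B = cover_ext m B by exact: (congr1 (fun g => g B) PE).
have Popen V : open V -> fine (mu V) <= lam V.
  move=> oV; rewrite -lee_fin fineK ?fin_num_measure//; last first.
    exact: open_measurable_borel.
  rewrite muE; apply: le_trans (cover_ext_le1 m0 (@subset_refl _ _)) _.
  by apply: m_le => // x [].
have mK : measurable (K : set (borel S)).
  apply: closed_measurable_borel; apply: compact_closed => //.
  exact: metrizes_hausdorff md d0.
have muK : mu K = 1%E.
  have : mu (~` K) = 0%E.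
    apply/eqP; rewrite eq_le measure_ge0 andbT muE.
    apply: le_trans (cover_ext_le1 m0 (@subset_refl _ _)) _.
    rewrite (_ : 0%E = (lam set0)%:E); last by rewrite lam0.
    apply: m_le; first exact: open0.
    by rewrite setICl.
  have -> : mu (~` K) = (1 - mu K)%E by exact: probability_setC.
  have : mu K \is a fin_num by exact: fin_num_measure.
  case: (mu K) => // r _; rewrite -EFinB => -[]/eqP.
  by rewrite subr_eq0 => /eqP <-.
exists mu; split => //.
(* The layer-cake sum with n + 1 levels recovers the mean up to 1 / (n + 1), uniformly in the law,
   so the limit along [F] can be taken level by level. *)
have step (P' : probability (borel S) R) (phi : S -> R) n :
    measurable_fun [set: borel S] (phi : borel S -> R) ->
    (forall s, 0 <= phi s <= 1) ->
    mean P' phi <= n.+1%:R^-1 * \sum_(k < n.+1) fine (P' [set s | k%:R / n.+1%:R < phi s])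
     <= mean P' phi + n.+1%:R^-1.
  move=> mphi phi01.
  have mS (k : nat) : measurable ([set s | k%:R / n.+1%:R < phi s] : set (borel S)).
    rewrite (_ : [set _ | _] = phi @^-1` `]k%:R / n.+1%:R, +oo[%classic).
      by rewrite -[X in measurable X]setTI; exact: mphi.
    by apply/seteqP; split => x /=; rewrite in_itv /= andbT.
  pose V k : set (borel S) := [set s | k%:R / n.+1%:R < phi s].
  have n0 : (0 : R) < n.+1%:R by rewrite ltr0n.
  have sumE s : \sum_(k < n.+1) (\1_(V k) s : R) =
      \sum_(k < n.+1) ((k%:R : R) < n.+1%:R * phi s)%R%:R.
    apply: eq_bigr => k _; rewrite indicE; congr (nat_of_bool _)%:R.
    by apply/idP/idP; rewrite inE /V /= ltr_pdivrMr// mulrC.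
  rewrite -(@mean_sum_indic _ _ P' V)//.
  have bs s : `|\sum_(k < n.+1) \1_(V k) s| <= n.+1%:R :> R.
    rewrite ger0_norm ?sumr_ge0//.
    rewrite -[X in _ <= X%:R]card_ord -sum1_card natr_sum ler_sum// => k _.
    by rewrite indicE lern1 leq_b1.
  have ms : measurable_fun [set: borel S] (fun s : borel S => \sum_(k < n.+1) \1_(V k) s : R).
    by apply: measurable_sum => k; exact: (measurable_indic (mS k)).
  have E1 := @mean_affine _ _ P' (fun s => \sum_(k < n.+1) \1_(V k) s) n.+1%:R n.+1%:R^-1 0 ms bs.
  rewrite -[X in _ <= X <= _]addr0 -E1.
  have -> : mean P' phi + n.+1%:R^-1 = mean P' (fun s => 1 * phi s + n.+1%:R^-1).
    rewrite (@mean_affine _ _ _ _ 1)// ?mul1r// => s.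
    by rewrite ger0_norm; case/andP: (phi01 s).
  have lo s : n.+1%:R^-1 * \sum_(k < n.+1) \1_(V k) s + 0 <= 2 :> R /\
      phi s <= n.+1%:R^-1 * \sum_(k < n.+1) \1_(V k) s + 0 <= 1 * phi s + n.+1%:R^-1.
    have /andP[p0 p1] := phi01 s.
    have y0 : 0 <= n.+1%:R * phi s by rewrite mulr_ge0// ltW.
    have l1 := @sum_step_le R (n.+1%:R * phi s) n.+1 y0.
    have l2 := @sum_step_ge R (n.+1%:R * phi s) n.+1.
    have {}l2 := l2 (ltac:(by rewrite ler_piMr// ltW)).
    rewrite -sumE in l1 l2; rewrite addr0 mul1r.
    have u : n.+1%:R^-1 * \sum_(k < n.+1) \1_(V k) s <= phi s + n.+1%:R^-1.
      rewrite mulrC ler_pdivrMr// mulrDl mulVf ?gt_eqF// mulrC//.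
    split; last by rewrite u andbT mulrC ler_pdivlMr// mulrC.
    by apply: (le_trans u); rewrite -[leRHS]/(1 + 1) lerD// invf_le1// ler1n.
  have ms' : measurable_fun [set: borel S]
      (fun s : borel S => n.+1%:R^-1 * \sum_(k < n.+1) \1_(V k) s + 0 : R).
    by apply: measurable_funD => //; exact: measurable_funM.
  apply/andP; split.
  - apply: (@le_mean _ _ _ _ _ 2) => //.
    + by move=> s; have /andP[? ?] := phi01 s; rewrite ger0_norm//; lra.
    + move=> s; rewrite ger0_norm; first by case: (lo s).
      by rewrite addr0 mulr_ge0 ?sumr_ge0// invr_ge0.
    + by move=> s; case: (lo s) => _ /andP[].
  - apply: (@le_mean _ _ _ _ _ 2) => //.
    + by apply: measurable_funD => //; exact: measurable_funM.
    + move=> s; rewrite ger0_norm; first by case: (lo s).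
      by rewrite addr0 mulr_ge0 ?sumr_ge0// invr_ge0.
    + move=> s; have /andP[? ?] := phi01 s.
      rewrite mul1r ger0_norm ?addr_ge0// ?invr_ge0//.
      by rewrite -[leRHS]/(1 + 1) lerD// invf_le1// ler1n.
    + by move=> s; case: (lo s) => _ /andP[].
have lim01 (phi : S -> R) : measurable_fun [set: borel S] (phi : borel S -> R) ->
    (forall s, 0 <= phi s <= 1) ->
    mean (nu i) phi @[i --> F] --> lim (mean (nu i) phi @[i --> F]).
  move=> mphi phi01; apply: (@bounded_ultra_cvg _ 0 1) => i.
  exact: mean_ge0_le.
have csum (V : nat -> set S) m' : (forall k, open (V k)) ->
    \sum_(k < m') fine (nu i (V k)) @[i --> F] --> \sum_(k < m') lam (V k).
  move=> oV; elim: m' => [|m' IH].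
    rewrite big_ord0; under eq_fun do rewrite big_ord0.
    exact: cvg_cst.
  rewrite big_ord_recr /=; under eq_fun do rewrite big_ord_recr /=.
  by apply: cvgD => //; apply: lamE; exact: open_measurable_borel.
have up (phi : S -> R) : continuous phi -> (forall s, 0 <= phi s <= 1) ->
    mean mu phi <= lim (mean (nu i) phi @[i --> F]).
  move=> cphi phi01; have mphi := continuous_measurable_borel cphi.
  apply/ler_addgt0Pr => e e0.
  pose n := Num.truncn e^-1.
  have ne : n.+1%:R^-1 < e.
    rewrite -[X in _ < X]invrK ltf_pV2 ?posrE ?invr_gt0//.
    exact: truncnS_gt.
  have oV k : open [set s | k%:R / n.+1%:R < phi s].
    rewrite (_ : [set _ | _] = phi @^-1` [set y | k%:R / n.+1%:R < y])//.
    exact: open_comp.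
  have /andP[h1 _] := step mu phi n mphi phi01; apply: (le_trans h1).
  apply: (@le_trans _ _ (n.+1%:R^-1 * \sum_(k < n.+1)
     lam [set s | k%:R / n.+1%:R < phi s])).
    rewrite ler_wpM2l ?invr_ge0// ler_sum// => k _; exact: Popen.
  have c1 : n.+1%:R^-1 * (\sum_(k < n.+1)
        fine (nu i [set s | k%:R / n.+1%:R < phi s])) @[i --> F] -->
      n.+1%:R^-1 * \sum_(k < n.+1) lam [set s | k%:R / n.+1%:R < phi s].
    by apply: cvgMl_tmp; exact: (csum (fun k => [set s | k%:R / n.+1%:R < phi s]) n.+1 oV).
  have c2 : mean (nu i) phi + n.+1%:R^-1 @[i --> F] -->
      lim (mean (nu i) phi @[i --> F]) + n.+1%:R^-1.
    by apply: cvgD; [exact: lim01|exact: cvg_cst].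
  apply: (@le_trans _ _ (lim (mean (nu i) phi @[i --> F]) + n.+1%:R^-1)); last first.
    by rewrite lerD2l ltW.
  rewrite -subr_ge0; apply: (cvgr_to_ge (cvgB c2 c1)).
  apply: filterE => i; rewrite subr_ge0.
  by have /andP[] := step (nu i) phi n mphi phi01.
have key (phi : S -> R) : continuous phi -> (forall s, 0 <= phi s <= 1) ->
    mean (nu i) phi @[i --> F] --> mean mu phi.
  move=> cphi phi01; have mphi := continuous_measurable_borel cphi.
  have b1 s : `|phi s| <= 1 by rewrite ger0_norm; case/andP: (phi01 s).
  have c1 := lim01 phi mphi phi01.
  suff -> : mean mu phi = lim (mean (nu i) phi @[i --> F]) by [].
  apply/eqP; rewrite eq_le up//=.
  pose psi s := -1 * phi s + 1.
  have cpsi : continuous psi.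
    by move=> s; apply: cvgD; [apply: cvgMl_tmp; exact: cphi|exact: cvg_cst].
  have psi01 s : 0 <= psi s <= 1.
    by have /andP[? ?] := phi01 s; rewrite /psi; apply/andP; split; lra.
  have := up psi cpsi psi01.
  rewrite (@mean_affine _ _ _ _ 1)//.
  suff -> : lim (mean (nu i) psi @[i --> F]) =
    -1 * lim (mean (nu i) phi @[i --> F]) + 1 by lra.
  apply/cvg_lim => //.
  under eq_fun do rewrite (@mean_affine _ _ _ _ 1)//.
  by apply: cvgD; [exact: cvgMl_tmp|exact: cvg_cst].
move=> phi [cphi [M phiM]].
pose M' := `|M| + 1.
have M'0 : 0 < M' by rewrite ltr_wpDl.
have phiM' s : - M' <= phi s <= M'.
  have := phiM s; rewrite ler_norml => /andP[? ?].
  by have := ler_norm M; rewrite /M'; move=> ?; apply/andP; split; lra.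
pose psi s := (2 * M')^-1 * phi s + 2^-1.
have cpsi : continuous psi.
  by move=> s; apply: cvgD; [apply: cvgMl_tmp; exact: cphi|exact: cvg_cst].
have phiE : phi = fun s => (2 * M') * psi s + - M'.
  apply/funext => s; rewrite /psi mulrDr mulrA divff ?mul1r; last first.
    by rewrite gt_eqF// mulr_gt0.
  by rewrite mulrAC divff// mul1r addrK.
have psi01 s : 0 <= psi s <= 1.
  have h : 0 < 2 * M' by rewrite mulr_gt0.
  have := phiM' s; rewrite phiE => /andP[h1 h2].
  apply/andP; split; first by rewrite -(pmulr_rge0 _ h); lra.
  by rewrite -(ler_pM2l h) mulr1; lra.
have mpsi := continuous_measurable_borel cpsi.
have b1 s : `|psi s| <= 1 by rewrite ger0_norm; case/andP: (psi01 s).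
rewrite phiE; under eq_fun do rewrite (@mean_affine _ _ _ _ 1)//.
rewrite (@mean_affine _ _ _ _ 1)//.
by apply: cvgD; [apply: cvgMl_tmp; exact: key|exact: cvg_cst].
Qed.

End ultra_weak_limit.

(** * Static zero-sum games *)

Lemma mix_probability d (T : measurableType d) (R : realType) (n : nat)
    (w : nat -> R) (m : nat -> probability T R) :
  (forall k, 0 <= w k) -> \sum_(k < n) w k = 1 ->
  exists P : probability T R,
    (forall U, measurable U -> P U = \sum_(k < n) (w k)%:E * m k U)%E /\
    (forall (f : T -> R) M, measurable_fun setT f -> (forall t, 0 <= f t <= M) ->
       \int[P]_t f t = \sum_(k < n) w k * \int[m k]_t f t).
Proof.
move=> w0 w1.
pose wn k : {nonneg R} := NngNum (w0 k).
pose mw k : {measure set T -> \bar R} := mscale (wn k) (m k).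
pose P0 : {measure set T -> \bar R} := msum mw n.
have P0E U : P0 U = (\sum_(k < n) (w k)%:E * m k U)%E by [].
have P01 : P0 setT = 1%E.
  rewrite P0E; under eq_bigr do rewrite probability_setT mule1.
  by rewrite sumEFin w1.
have [P PE] := @probability_ex _ T R P0 (measure0 P0) (measure_ge0 P0)
  (@measure_semi_sigma_additive _ _ _ P0) P01.
exists P; split => [U _|f M mf fM].
  exact: (congr1 (fun g : set T -> \bar R => g U) PE).
have f0 t : setT t -> (0 <= (f t)%:E)%E by rewrite lee_fin; case/andP: (fM t).
have mEf : measurable_fun setT (EFin \o f) by exact/measurable_EFinP.
rewrite /Rintegral.
have -> : (\int[P]_t (f t)%:E = \int[P0]_t (f t)%:E)%E.
  apply: eq_measure_integral => U mU _.
  exact: (congr1 (fun g : set T -> \bar R => g U) PE).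
rewrite (ge0_integral_measure_sum _ _ f0)//.
transitivity (fine (\sum_(k < n) (w k * \int[m k]_t f t)%:E)%E).
  congr fine; apply: eq_bigr => k _; rewrite ge0_integral_mscale//= EFinM.
  congr (_ * _)%E; rewrite (@EFin_Rintegral_prob _ _ _ _ _ M)// => t.
  by case/andP: (fM t) => ? ?; rewrite ger0_norm.
by rewrite sumEFin.
Qed.

Lemma metrizes_prod (R : realType) (S T : topologicalType) (d : S -> S -> R)
    (e : T -> T -> R) : metrizes d -> metrizes e ->
  @metrizes R (S * T)%type (fun p q => d p.1 q.1 + e p.2 q.2).
Proof.
move=> md me; split.
- by move=> x; rewrite (dxx md) (dxx me) addr0.
- by move=> x y; rewrite (d_sym md) (d_sym me).
- move=> x y z; have := d_tri md x.1 y.1 z.1; have := d_tri me x.2 y.2 z.2; lra.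
- move=> x C; split.
    move=> [[C1 C2] [/= /(d_nbhs md)[e1 e10 h1] /(d_nbhs me)[e2 e20 h2]] sub].
    exists (Num.min e1 e2); first by rewrite lt_min e10.
    move=> y; rewrite lt_min => /andP[y1 y2]; apply: sub; split => /=.
      by apply: h1; have := d_ge0 x.2 y.2 me; lra.
    by apply: h2; have := d_ge0 x.1 y.1 md; lra.
  move=> [r r0 h].
  exists ([set y | d x.1 y < r / 2], [set y | e x.2 y < r / 2]).
    split; [apply/(d_nbhs md)|apply/(d_nbhs me)];
      by exists (r / 2) => //; rewrite divr_gt0.
  by move=> [y1 y2] [/= ? ?]; apply: h => /=; lra.
Qed.

Section carried.
Context (R : realType) (S : ptopologicalType).

Definition carried (K : set S) : set (probability (borel S) R) :=
  [set mu | mu K = 1%E].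

Lemma carried_dirac (K : set S) s : K s ->
  carried K (\d_(s : borel S) : probability (borel S) R).
Proof. by move=> Ks; rewrite /carried /= diracE mem_set. Qed.

Variables (K : set S).
Hypothesis mK : measurable (K : set (borel S)).

Lemma mean_le_carried (mu : probability (borel S) R) phi M c :
  carried K mu -> measurable_fun [set: borel S] (phi : borel S -> R) ->
  (forall s, `|phi s| <= M) -> (forall s, K s -> phi s <= c) -> mean mu phi <= c.
Proof.
move=> muK mphi phiM phic.
have nK : mu (~` K) = 0%E.
  have -> : mu (~` K) = (1 - mu K)%E by exact: probability_setC.
  by rewrite muK subee.
have mn : measurable (~` K : set (borel S)) by exact: measurableC.
pose psi s := Num.min (phi s) c.
have mpsi : measurable_fun [set: borel S] (psi : borel S -> R).
  by apply: measurable_minr.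
have psiM s : `|psi s| <= M + `|c|.
  have := phiM s; rewrite /psi /Num.min; case: ifP => _ h.
    by rewrite (le_trans h)// lerDl.
  by rewrite lerDr (le_trans _ h).
have -> : mean mu phi = mean mu psi.
  rewrite /mean /Rintegral; congr fine; apply: ae_eq_integral => //.
  - exact/measurable_EFinP.
  - exact/measurable_EFinP.
  - exists (~` K); split => // s /= h Ks; apply: h => _.
    by rewrite /psi min_l// phic.
rewrite -[leRHS](Rintegral_prob_cst mu).
apply: (@le_mean _ _ mu psi (fun=> c) (M + `|c|)) => //.
- by move=> s; rewrite lerDr (le_trans _ (phiM s)).
- by move=> s; rewrite /psi ge_min lexx orbT.
Qed.

Lemma mean_ge_carried (mu : probability (borel S) R) (phi : S -> R) M c :
  carried K mu -> measurable_fun [set: borel S] (phi : borel S -> R) ->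
  (forall s, `|phi s| <= M) -> (forall s, K s -> c <= phi s) -> c <= mean mu phi.
Proof.
move=> muK mphi phiM phic.
have := @mean_le_carried mu (fun s => -1 * phi s + 0) M (- c) muK.
rewrite (@mean_affine _ _ _ _ M)// addr0 mulN1r lerN2; apply.
- by apply: measurable_funD => //; exact: measurable_funM.
- by move=> s; rewrite addr0 mulN1r normrN.
- by move=> s Ks; rewrite addr0 mulN1r lerN2 phic.
Qed.

End carried.

Section compact_carried.
Context (R : realType) (S : ptopologicalType) (d : S -> S -> R).
Hypothesis md : metrizes d.
Hypothesis d0 : forall x y, d x y = 0 -> x = y.

Lemma compact_measurable_borel (K : set S) : compact K ->
  measurable (K : set (borel S)).
Proof.
move=> cK; apply: closed_measurable_borel; apply: compact_closed => //.
exact: metrizes_hausdorff md d0.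
Qed.

(** The ultrafilter limit is applied to the identity family: laws carried by [K] give mass 1 to
    every neighbourhood of [K]. *)
Lemma compact_carried (K : set S) : compact K ->
  @compact (Pweak R S) (@carried R S K).
Proof.
move=> cK; rewrite compact_ultra => F UF FK.
have tight V : open V -> K `<=` V -> forall e : R, 0 < e ->
    \forall mu \near F, 1 - e < fine ((mu : probability (borel S) R) V).
  move=> oV KV e e0; apply: filterS FK => mu muK.
  have mV := open_measurable_borel oV.
  have : (1 <= (mu : probability (borel S) R) V)%E.
    by rewrite -muK le_measure// inE//; exact: compact_measurable_borel.
  rewrite -(@fineK _ ((mu : probability (borel S) R) V)) ?fin_num_measure//.
  by rewrite lee_fin => ?; lra.
have [mu [muK h]] := @ultra_weak_limit R S d md d0 _ F UF id K cK tight.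
by exists mu; split => //; apply/Pweak_cvgP.
Qed.

End compact_carried.

Lemma mean_sum (R : realType) (S : ptopologicalType) (I : Type)
    (nu : probability (borel S) R) (i_ : nat -> I) (f : I -> S -> R) (M : R)
    (w : nat -> R) n :
  (forall i, measurable_fun [set: borel S] (f i : borel S -> R)) ->
  (forall i s, `|f i s| <= M) ->
  mean nu (fun s => \sum_(k < n) w k * f (i_ k) s) =
  \sum_(k < n) w k * mean nu (f (i_ k)).
Proof.
move=> mf fM; elim: n => [|n IH].
  rewrite big_ord0; under [X in mean _ X]eq_fun do rewrite big_ord0.
  exact: Rintegral_prob_cst.
rewrite big_ord_recr /= -IH /mean.
under [LHS]eq_Rintegral do rewrite big_ord_recr /=.
have i1 k : nu.-integrable setT (EFin \o (fun s => w k * f (i_ k) s)).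
  apply: (@bounded_integrable _ (borel S) R nu _ (`|w k| * M)).
    exact: measurable_funM.
  by move=> s; rewrite normrM ler_wpM2l.
rewrite RintegralD//; last first.
  apply: (@bounded_integrable _ (borel S) R nu _ (\sum_(k < n) `|w k| * M)).
    by apply: measurable_sum => k; exact: measurable_funM.
  move=> s; apply: (le_trans (ler_norm_sum _ _ _)); apply: ler_sum => k _.
  by rewrite normrM ler_wpM2l.
by rewrite RintegralZl//; exact: (bounded_integrable nu (mf _) (fM _)).
Qed.

(* Ville's argument: at a minimizer nu* of sum_i (g_i(nu) - c)^+ ^ 2 the
   first-order condition makes the weights (g_i(nu* ) - c)^+ a mixed strategy
   guaranteeing more than c. *)
Section static_alternative.
Context (R : realType) (A B : ptopologicalType) (dB : B -> B -> R).
Hypothesis mdB : metrizes dB.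
Hypothesis dB0 : forall x y, dB x y = 0 -> x = y.
Variables (g : A -> B -> R) (M : R).
Hypothesis gM : forall a b, 0 <= g a b <= M.
Hypothesis cgB : forall a, continuous (g a).
Hypothesis cgA : forall b, continuous (g^~ b).
Variables (KA : set A) (KB : set B).
Hypothesis mKA : measurable (KA : set (borel A)).
Hypothesis cKB : compact KB.
Hypothesis KB0 : KB !=set0.

Lemma bounded_continuous_payoff a : bounded_continuous (g a).
Proof.
split => //; exists M => b.
by case/andP: (gM a b) => ? ?; rewrite ger0_norm.
Qed.

Lemma finite_static_alternative (l : seq A) (c : R) :
  (forall a, a \in l -> KA a) ->
  (forall nu : probability (borel B) R, carried KB nu ->
     exists2 a, a \in l & c < mean nu (g a)) ->
  exists2 mu : probability (borel A) R, carried KA mu &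
    forall nu : probability (borel B) R, carried KB nu ->
      c < mean nu (fun b => mean mu (g^~ b)).
Proof.
move=> lKA h.
pose z (nu : probability (borel B) R) a := Num.max (mean nu (g a) - c) 0.
pose Phi (nu : Pweak R B) := \sum_(a <- l) z nu a * z nu a.
have cz a : continuous ((fun nu => z nu a) : Pweak R B -> R).
  move=> nu; apply: (@cvg_comp _ _ _ (fun nu : Pweak R B => mean nu (g a))
      (fun x => Num.max (x - c) 0) _ (nbhs (mean nu (g a)))).
    apply: continuous_test_integral; exact: bounded_continuous_payoff.
  apply: (@continuous_max _ _ (fun x : R => x - c) (fun=> 0)).
    by apply: cvgB; [exact: cvg_id|exact: cvg_cst].
  exact: cvg_cst.
have cPhi : continuous Phi.
  move=> nu.
  apply: (@cvg_big _ A +%R 0 xpredT _ _ (nbhs (nu : Pweak R B)) l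
    (fun a nu => z nu a * z nu a) (fun a => z nu a * z nu a)).
    exact: add_continuous.
  by move=> a _; apply: cvgM; exact: cz.
have [b0 Kb0] := KB0.
have cK : @compact (Pweak R B) (@carried R B KB) by exact: (compact_carried mdB dB0 cKB).
have K0 : @carried R B KB !=set0.
  by exists (\d_(b0 : borel B) : probability (borel B) R); exact: carried_dirac.
have [nus nusK0 Phimin] :=
  @compact_EVT_min (Pweak R B) R Phi _ K0 cK (continuous_subspaceT cPhi).
have nusK : carried KB nus := set_mem nusK0.
have mg a : measurable_fun [set: borel B] (g a : borel B -> R).
  exact: continuous_measurable_borel.
have z0 nu a : 0 <= z nu a by rewrite le_max lexx orbT.
pose Z := \sum_(a <- l) z nus a.
have [a1 a1l za1] : exists2 a, a \in l & 0 < z nus a.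
  have [a al ca] := h nus nusK; exists a => //.
  by rewrite lt_max subr_gt0 ca.
have sum_gt0 (f : A -> R) : (forall a, 0 <= f a) -> 0 < f a1 ->
    0 < \sum_(a <- l) f a.
  move=> f0 fa1; rewrite (big_rem a1)//= ltr_pwDl//.
  by apply: sumr_ge0.
have Z0 : 0 < Z by exact: sum_gt0.
have first_order nu : carried KB nu ->
    0 <= \sum_(a <- l) z nus a * (mean nu (g a) - mean nus (g a)).
  move=> nuK; pose D a := mean nu (g a) - mean nus (g a).
  pose DD := \sum_(a <- l) D a * D a.
  have DD0 : 0 <= DD by apply: sumr_ge0 => a _; rewrite -expr2 sqr_ge0.
  (* Compare [Phi] at the minimizer with [Phi] at the mixture (1 - t) nus + t nu. After division by
     t there remain the first-order term and t DD, which vanishes with t. *)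
  have qineq t : 0 < t <= 1 -> 0 <= 2 * \sum_(a <- l) z nus a * D a + t * DD.
    move=> /andP[t0 t1].
    pose w k := if k is 0%N then 1 - t else t.
    pose m k : probability (borel B) R := if k is 0%N then nus else nu.
    have w0 k : 0 <= w k by case: k => [|k] /=; lra.
    have w1 : \sum_(k < 2) w k = 1 by rewrite !big_ord_recr big_ord0 /=; lra.
    have [P [PE PI]] := mix_probability m w0 w1.
    have PK : carried KB P.
      have mKB := compact_measurable_borel mdB dB0 cKB.
      rewrite /carried /= (PE _ mKB).
      rewrite !big_ord_recr big_ord0 /= /m /= nusK nuK !mule1 add0e -EFinD.
      by rewrite subrK.
    have meanP a : mean P (g a) = mean nus (g a) + t * D a.
      rewrite /mean (PI _ M)// !big_ord_recr big_ord0 /= /D /mean; lra.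
    have := Phimin P (mem_set PK).
    have : Phi P <= \sum_(a <- l) (z nus a + t * D a) * (z nus a + t * D a).
      apply: ler_sum => a _.
      (* The inequality (x + y)^+ <= |x^+ + y| replaces the positive part at the mixture by an
         affine expression in t before squaring. *)
      have zP : z P a <= `|z nus a + t * D a|.
        rewrite /z ge_max normr_ge0 andbT meanP.
        apply: le_trans (ler_norm _).
        rewrite addrAC lerD2r le_max lexx//.
      rewrite -[leRHS]ger0_norm -?expr2 ?sqr_ge0// normrX.
      by rewrite expr2 ler_pM.
    move=> h1 h2; have := le_trans h2 h1.
    have -> : \sum_(a <- l) (z nus a + t * D a) * (z nus a + t * D a) =
       Phi nus + t * (2 * \sum_(a <- l) z nus a * D a + t * DD).
      rewrite /Phi /DD !mulr_sumr -!big_split /= mulr_sumr -big_split /=.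
      by apply: eq_bigr => a _; ring.
    by rewrite lerDl pmulr_rge0.
  apply/ler_addgt0Pr => e e0.
  pose t := Num.min 1 (e / (DD + 1)).
  have t0 : 0 < t <= 1.
    by rewrite lt_min ltr01 divr_gt0 ?ltr_wpDl// ge_min lexx.
  have tD : t * DD <= e.
    apply: (@le_trans _ _ (e / (DD + 1) * DD)).
      by rewrite ler_wpM2r// ge_min lexx orbT.
    rewrite mulrAC ler_pdivrMr ?ltr_wpDl//.
    by apply: ler_wpM2l; [exact: ltW|rewrite lerDl].
  have := qineq t t0; rewrite -/D; lra.
pose a_ k := nth a1 l k.
pose w k := if (k < size l)%N then z nus (a_ k) / Z else 0.
have w0 k : 0 <= w k by rewrite /w; case: ifP => // _; rewrite divr_ge0// ltW.
have sumw (f : A -> R) : \sum_(k < size l) w k * f (a_ k) =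
    Z^-1 * \sum_(a <- l) z nus a * f a.
  rewrite (big_nth a1) big_mkord mulr_sumr; apply: eq_bigr => k _.
  by rewrite /w ltn_ord mulrA; congr (_ * _); rewrite mulrC.
have w1 : \sum_(k < size l) w k = 1.
  under eq_bigr do rewrite -[w _]mulr1; rewrite (sumw (fun=> 1)).
  by under eq_bigr do rewrite mulr1; rewrite mulVf// gt_eqF.
pose m k : probability (borel A) R := \d_(a_ k : borel A).
have [mu [muE muI]] := mix_probability m w0 w1.
exists mu.
  rewrite /carried /= muE//; transitivity (\sum_(k < size l) (w k)%:E)%E.
    apply: eq_bigr => k _; rewrite /m /= diracE mem_set ?mule1//.
    by apply: lKA; exact: mem_nth.
  by rewrite sumEFin w1.
move=> nu nuK.
have meanmu b : mean mu (g^~ b) = \sum_(k < size l) w k * g (a_ k) b.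
  rewrite /mean (muI _ M)//; last exact: continuous_measurable_borel.
  apply: eq_bigr => k _; congr (_ * _).
  rewrite /Rintegral integral_dirac// ?diracT ?mul1e//.
  by apply/measurable_EFinP; exact: continuous_measurable_borel.
under [X in mean _ X]eq_fun do rewrite meanmu.
rewrite (@mean_sum R B A nu a_ g M)//; last first.
  by move=> a b; case/andP: (gM a b) => ? ?; rewrite ger0_norm.
rewrite (sumw (fun a => mean nu (g a))) mulrC ltr_pdivlMr// mulrC.
(* The first-order condition makes [nus] the worst reply to the weights, and against it the weighted
   excess over [c] is the sum of the squares of the [z nus a], which is positive. *)
apply: (@lt_le_trans _ _ (\sum_(a <- l) z nus a * mean nus (g a))); last first.
  rewrite -subr_ge0 -sumrB (le_trans (first_order nu nuK))// le_eqVlt.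
  by apply/orP; left; apply/eqP; apply: eq_bigr => a _; rewrite mulrBr.
rewrite -subr_gt0 /Z mulr_suml -sumrB.
have zE a : z nus a * mean nus (g a) - z nus a * c = z nus a * z nus a.
  by rewrite -mulrBr /z; case: leP => h1; rewrite ?mul0r.
under eq_bigr do rewrite zE.
by apply: sum_gt0 => [a|]; [rewrite -expr2 sqr_ge0|rewrite mulr_gt0].
Qed.

(** If no reply caps all pure actions at [c], the open sets of replies beaten by one pure action
    cover the compact set of replies; finitely many pure actions suffice, and the finite case
    applies. *)
Lemma static_alternative (c : R) :
  (exists2 nu : probability (borel B) R, carried KB nu &
     forall a, KA a -> mean nu (g a) <= c) \/
  (exists2 mu : probability (borel A) R, carried KA mu &
     forall nu : probability (borel B) R, carried KB nu ->
       c < mean nu (fun b => mean mu (g^~ b))).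
Proof.
have [|nh] := pselect (exists2 nu : probability (borel B) R, carried KB nu &
     forall a, KA a -> mean nu (g a) <= c); first by left.
right.
have cK : @compact (Pweak R B) (@carried R B KB) by exact: (compact_carried mdB dB0 cKB).
have ch a : continuous ((fun nu => mean nu (g a)) : Pweak R B -> R).
  apply: continuous_test_integral; exact: bounded_continuous_payoff.
move: cK; rewrite compact_cover.
move=> /(_ A KA (fun a => [set nu : Pweak R B | c < mean nu (g a)])).
case.
- move=> a _; rewrite (_ : [set _ | _] =
     (fun nu : Pweak R B => mean nu (g a)) @^-1` [set y | c < y])//.
  exact: open_comp.
- move=> nu nuK; apply: contrapT => nc; apply: nh; exists nu => // a KAa.
  by rewrite leNgt; apply/negP => ca; apply: nc; exists a.
move=> D DK cov; apply: (@finite_static_alternative (finmap.enum_fset D)).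
  by move=> a aD; apply/set_mem; exact: DK.
move=> nu /cov[a /= aD ca]; exists a => //.
Qed.

End static_alternative.

Lemma mean_fubini (R : realType) (A B : ptopologicalType)
    (mu : probability (borel A) R) (nu : probability (borel B) R)
    (g : A -> B -> R) (M : R) :
  (forall a b, 0 <= g a b <= M) ->
  measurable_fun [set: borel A * borel B]
    ((fun z => g z.1 z.2) : borel A * borel B -> R) ->
  (forall a, measurable_fun [set: borel B] (g a : borel B -> R)) ->
  (forall b, measurable_fun [set: borel A] (g^~ b : borel A -> R)) ->
  mean nu (fun b => mean mu (g^~ b)) = mean mu (fun a => mean nu (g a)).
Proof.
move=> gM mg mgB mgA.
have nB a b : `|g a b| <= M by case/andP: (gM a b) => ? ?; rewrite ger0_norm.
have mE : measurable_fun [set: borel A * borel B]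
    ((fun z => (g z.1 z.2)%:E) : borel A * borel B -> \bar R).
  exact/measurable_EFinP.
have g0 (z : borel A * borel B) : (0 <= (g z.1 z.2)%:E)%E.
  by rewrite lee_fin; case/andP: (gM z.1 z.2).
rewrite /mean /Rintegral; congr fine.
transitivity (\int[nu]_b \int[mu]_a (g a b)%:E)%E.
  by apply: eq_integral => b _; rewrite -(@EFin_Rintegral_prob _ _ _ _ _ M).
transitivity (\int[mu]_a \int[nu]_b (g a b)%:E)%E; last first.
  by apply: eq_integral => a _; rewrite -(@EFin_Rintegral_prob _ _ _ _ _ M).
rewrite -(@fubini_tonelli2 _ _ (borel A) (borel B) R mu nu _ mE g0).
by rewrite (@fubini_tonelli1 _ _ (borel A) (borel B) R mu nu _ mE g0).
Qed.

Section static_saddle.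
Context (R : realType) (A B : ptopologicalType) (dA : A -> A -> R)
  (dB : B -> B -> R).
Hypotheses (mdA : metrizes dA) (mdB : metrizes dB).
Hypothesis dA0 : forall x y, dA x y = 0 -> x = y.
Hypothesis dB0 : forall x y, dB x y = 0 -> x = y.
Variables (g : A -> B -> R) (M : R).
Hypothesis gM : forall a b, 0 <= g a b <= M.
Hypothesis mg : measurable_fun [set: borel A * borel B]
  ((fun z => g z.1 z.2) : borel A * borel B -> R).
Hypothesis cgB : forall a, continuous (g a).
Hypothesis cgA : forall b, continuous (g^~ b).
Hypothesis cmA : forall mu : probability (borel A) R,
  continuous (fun b => mean mu (g^~ b)).
Hypothesis cmB : forall nu : probability (borel B) R,
  continuous (fun a => mean nu (g a)).
Variables (KA : set A) (KB : set B).
Hypotheses (cKA : compact KA) (cKB : compact KB).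
Hypotheses (KA0 : KA !=set0) (KB0 : KB !=set0).

Let fub mu nu : mean nu (fun b => mean mu (g^~ b)) = mean mu (fun a => mean nu (g a)).
Proof.
by apply: (mean_fubini mu nu gM mg) => ?; exact: continuous_measurable_borel.
Qed.

Let mA b : measurable_fun [set: borel A] (g^~ b : borel A -> R).
Proof. exact: continuous_measurable_borel. Qed.

Let mB a : measurable_fun [set: borel B] (g a : borel B -> R).
Proof. exact: continuous_measurable_borel. Qed.

Let mA01 (mu : probability (borel A) R) b : 0 <= mean mu (g^~ b) <= M.
Proof. by apply: mean_ge0_le => // a; exact: gM. Qed.

Let mB01 (nu : probability (borel B) R) a : 0 <= mean nu (g a) <= M.
Proof. by apply: mean_ge0_le. Qed.

Let mKA := compact_measurable_borel mdA dA0 cKA.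
Let mKB := compact_measurable_borel mdB dB0 cKB.

Lemma saddle_le (v v' : R) (mu : probability (borel A) R)
    (nu : probability (borel B) R) : carried KA mu -> carried KB nu ->
  (forall b, KB b -> v <= mean mu (g^~ b)) ->
  (forall a, KA a -> mean nu (g a) <= v') -> v <= v'.
Proof.
move=> muK nuK h1 h2; apply: (@le_trans _ _ (mean nu (fun b => mean mu (g^~ b)))).
  apply: (mean_ge_carried mKB nuK (M := M)) => //.
    by apply: continuous_measurable_borel.
  by move=> b; case/andP: (mA01 mu b) => ? ?; rewrite ger0_norm.
rewrite fub; apply: (mean_le_carried mKA muK (M := M)) => //.
  by apply: continuous_measurable_borel.
by move=> a; case/andP: (mB01 nu a) => ? ?; rewrite ger0_norm.
Qed.

(** [v] is the supremum of the levels that player 1 can guarantee. At [v] the alternative must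
    produce a cap, since a strategy strictly better than [v] against every reply would, by
    compactness of [KB], guarantee more than [v]. That the supremum is attained follows from the
    alternative with the players exchanged. *)
Lemma static_saddle : exists v, exists mu : probability (borel A) R,
  exists nu : probability (borel B) R,
  [/\ carried KA mu, carried KB nu,
      (forall b, KB b -> v <= mean mu (g^~ b)) &
      (forall a, KA a -> mean nu (g a) <= v)].
Proof.
have [a0 Ka0] := KA0; have [b0 Kb0] := KB0.
pose dirA : probability (borel A) R := \d_(a0 : borel A).
pose dirB : probability (borel B) R := \d_(b0 : borel B).
have dirAK : carried KA dirA by exact: carried_dirac.
have dirBK : carried KB dirB by exact: carried_dirac.
pose L := [set c | exists2 mu : probability (borel A) R, carried KA mu &
  forall b, KB b -> c <= mean mu (g^~ b)].
have L0 : L 0 by exists dirA => // b _; case/andP: (mA01 dirA b).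
have Lsup : has_sup L.
  split; first by exists 0.
  exists M => c [mu muK h]; apply: (le_trans (h b0 Kb0)).
  by case/andP: (mA01 mu b0).
pose v := sup L; exists v.
have [nu nuK hnu] : exists2 nu : probability (borel B) R, carried KB nu &
    forall a, KA a -> mean nu (g a) <= v.
  have [//|[mu muK hmu]] := static_alternative mdB dB0 gM cgB cgA mKA cKB KB0 v.
  (* The minimum over pure replies is attained, and the Dirac law at a minimizer is a mixed reply,
     so the strict inequality survives the minimization. *)
  have [b /set_mem KBb bmin] := @compact_EVT_min B R (fun b => mean mu (g^~ b))
    KB KB0 cKB (continuous_subspaceT (cmA (mu:=mu))).
  have : v < mean mu (g^~ b).
    have := hmu (\d_(b : borel B) : probability (borel B) R) (carried_dirac R KBb).
    rewrite {1}/mean /Rintegral integral_dirac// ?diracT ?mul1e//.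
    apply/measurable_EFinP; exact: continuous_measurable_borel.
  rewrite ltNge; move/negP; case; apply: (@ub_le_sup _ L); first exact: Lsup.2.
  by exists mu => // b' KBb'; apply: bmin; rewrite inE.
pose g' b a := -1 * g a b + M.
have g'M b a : 0 <= g' b a <= M.
  by have /andP[? ?] := gM a b; rewrite /g'; apply/andP; split; lra.
have cg' b : continuous (g' b).
  by move=> a; apply: cvgD; [apply: cvgMl_tmp; exact: cgA|exact: cvg_cst].
have cg'' a : continuous (g'^~ a).
  by move=> b; apply: cvgD; [apply: cvgMl_tmp; exact: cgB|exact: cvg_cst].
have E1 (mu : probability (borel A) R) b : mean mu (g' b) = -1 * mean mu (g^~ b) + M.
  rewrite /g' (@mean_affine _ _ mu (g^~ b) M)// => a.
  by case/andP: (gM a b) => ? ?; rewrite ger0_norm.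
have E2 (n : probability (borel B) R) a : mean n (g'^~ a) = -1 * mean n (g a) + M.
  rewrite /g' (@mean_affine _ _ n (g a) M)// => b.
  by case/andP: (gM a b) => ? ?; rewrite ger0_norm.
have [mu muK hmu] : exists2 mu : probability (borel A) R, carried KA mu &
    forall b, KB b -> v <= mean mu (g^~ b).
  have [[mu muK h]|[nu' nuK' hnu']] :=
      static_alternative mdA dA0 g'M cg' cg'' mKB cKA KA0 (M - v).
    by exists mu => // b /h; rewrite E1; lra.
  have [a /set_mem KAa amax] := @compact_EVT_max A R (fun a => mean nu' (g a))
    KA KA0 cKA (continuous_subspaceT (cmB (nu:=nu'))).
  have av : mean nu' (g a) < v.
    have := hnu' (\d_(a : borel A) : probability (borel A) R) (carried_dirac R KAa).
    under [X in _ < mean _ X -> _]eq_fun do rewrite E2.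
    rewrite {1}/mean /Rintegral integral_dirac// ?diracT ?mul1e/=; first lra.
    apply/measurable_EFinP; apply: measurable_funD => //.
    by apply: measurable_funM => //; exact: continuous_measurable_borel.
  (* By definition of the supremum, player 1 can guarantee some level [c] above the one to which
     [nu'] holds her; this contradicts weak duality. *)
  have [c [mu muK hmu] cv] := sup_gt Lsup.1 av.
  suff : c <= mean nu' (g a) by rewrite leNgt cv.
  apply: (@saddle_le c (mean nu' (g a)) mu nu') => // a' Ka'.
  by apply: amax; rewrite inE.
by exists mu, nu.
Qed.

End static_saddle.

(** * Games depending on a parameter *)

Lemma continuous_pair (X Y Z : topologicalType) (f : X -> Y) (g : X -> Z) :
  continuous f -> continuous g -> continuous (fun x => (f x, g x)).
Proof. by move=> cf cg x; exact: cvg_pair (cf x) (cg x). Qed.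

(** Integrand and law vary together. A distance on the parameter space supplies the countable
    decreasing neighbourhoods {p | dP p0 p < 1 / (m + 1)} that continuous convergence asks for. *)
Lemma joint_mean_cvg (R : realType) (S : ptopologicalType) (P : topologicalType)
    (dS : S -> S -> R) (dP : P -> P -> R) (f : P -> S -> R) (M : R)
    (I : Type) (F : set_system I) (p : I -> P) (p0 : P)
    (mu : I -> probability (borel S) R) (mu0 : probability (borel S) R) :
  metrizes dS -> metrizes dP -> ProperFilter F ->
  continuous (fun z : P * S => f z.1 z.2) ->
  (forall q s, 0 <= f q s <= M) ->
  p @ F --> p0 ->
  (forall phi : S -> R, bounded_continuous phi ->
     mean (mu i) phi @[i --> F] --> mean mu0 phi) ->
  mean (mu i) (f (p i)) @[i --> F] --> mean mu0 (f p0).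
Proof.
move=> md mdP FF cf fM pp0 mumu0.
pose N m := [set i | dP p0 (p i) < m.+1%:R^-1].
apply: (@mean_cvg_continuous R S dS md I F FF mu mu0 mumu0 M N).
- move=> m; apply: (pp0 (fun q => dP p0 q < m.+1%:R^-1)).
  by apply/(d_nbhs mdP); exists m.+1%:R^-1.
- move=> m n mn i /= h; apply: (lt_le_trans h).
  by rewrite lef_pV2 ?posrE// ler_nat.
- move=> i; apply: continuous_measurable_borel => s.
  have h := cf (p i, s); apply: (@cvg_comp _ _ _ (fun s => (p i, s)) _ _ _ _ _ h).
  by apply: cvg_pair; [exact: cvg_cst|exact: cvg_id].
- by move=> i s; exact: fM.
- move=> s e e0; have /cvgrPdist_lt/(_ e e0) h := cf (p0, s).
  have [del del0 hd] := (d_nbhs (metrizes_prod mdP md) _ _).1 h.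
  have del2 : 0 < del / 2 by rewrite divr_gt0.
  have [m md2] : exists m, m.+1%:R^-1 < del / 2.
    have [m _ hm] := near_infty_natSinv_lt (PosNum del2).
    by exists m; exact: (hm m (leqnn m)).
  exists m, (del / 2) => // i Ni s' ss'.
  rewrite distrC; apply: (hd (p i, s')) => /=.
  by rewrite [ltRHS](splitr del) ltrD// (lt_trans Ni).
Qed.

(** Ultrafilters decide convergence: if the preimage of some [W] is not in [F], the trace of [F] on
    its complement is proper and extends to an ultrafilter along which [f] stays outside [W]. *)
Lemma cvg_ultra (T U : Type) (F : set_system T) (f : T -> U) (G : set_system U) :
  ProperFilter F ->
  (forall H, UltraFilter H -> F `<=` H -> G `<=` f @ H) -> G `<=` f @ F.
Proof.
move=> FF h W GW; apply: contrapT => nFW.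
pose K := within (~` (f @^-1` W)) F.
have KF : ProperFilter K.
  apply: Build_ProperFilter_ex => Z KZ; apply: contrapT => nZ; apply: nFW.
  have {}KZ : F [set t | (~` (f @^-1` W)) t -> Z t] by exact: KZ.
  suff : F (f @^-1` W) by [].
  apply: filterS KZ => t Zt; apply: contrapT => nW; apply: nZ.
  by exists t; exact: Zt.
have [H [UH KH]] := ultraFilterLemma KF.
have FH : F `<=` H.
  by move=> Z FZ; apply: KH; rewrite /K /within /=; apply: filterS FZ.
have HW : H (f @^-1` W) := h H UH FH W GW.
have HnW : H (~` (f @^-1` W)).
  apply: KH; suff : F [set t | (~` (f @^-1` W)) t -> (~` (f @^-1` W)) t] by [].
  rewrite (_ : mkset _ = setT); first exact: filterT.
  by apply/seteqP; split => // t _ /=.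
by have [t []] := filter_ex (filterI HW HnW).
Qed.

Section guarantee.
Context (R : realType) (A B : ptopologicalType) (T : topologicalType).
Variables (dA : A -> A -> R) (dB : B -> B -> R) (dT : T -> T -> R).
Hypotheses (mdA : metrizes dA) (mdB : metrizes dB) (mdT : metrizes dT).
Hypothesis dA0 : forall x y, dA x y = 0 -> x = y.
Variables (KA : T -> set A) (KB : T -> set B).
Hypothesis cKA : forall t, compact (KA t).
Hypothesis uscA : forall t V, open V -> KA t `<=` V ->
  \forall s \near t, KA s `<=` V.
Hypothesis lscB : forall t b V, KB t b -> nbhs b V ->
  \forall s \near t, KB s `&` V !=set0.
Variables (f : T -> A -> B -> R) (M : R).
Hypothesis fM : forall t a b, 0 <= f t a b <= M.
Hypothesis cf : continuous (fun z : T * A * B => f z.1.1 z.1.2 z.2).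

Definition guarantees (t : T) (v : R) : set (probability (borel A) R) :=
  [set mu | carried (KA t) mu /\
            forall b, KB t b -> v <= mean mu (fun a => f t a b)].

(** Upper semicontinuity of [KA] pushes the mass of [mu t] towards the compact set [KA t0], which
    yields a weak limit. Lower semicontinuity of [KB] provides, for each reply [b0] at [t0],
    admissible replies at nearby [t] that tend to [b0]; the guarantee against them passes to the
    limit. *)
Lemma guarantee_closed (U : set_system T) (t0 : T)
    (mu : T -> probability (borel A) R) (v : T -> R) (l : R) :
  UltraFilter U -> U --> t0 -> v t @[t --> U] --> l ->
  (\forall t \near U, guarantees t (v t) (mu t)) ->
  exists2 mu0 : probability (borel A) R, guarantees t0 l mu0 &
    mu @ U --> (mu0 : Pweak R A).
Proof.
move=> UU Ut0 vl gU.
have tight V : open V -> KA t0 `<=` V -> forall e : R, 0 < e ->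
    \forall t \near U, 1 - e < fine (mu t V).
  move=> oV KV e e0.
  have h : U [set s | KA s `<=` V] by apply: Ut0; exact: uscA.
  apply: (filterS _ (filterI h gU)) => t /= [KtV [mK _]].
  have mV := open_measurable_borel oV.
  have : (1 <= mu t V)%E.
    by rewrite -mK le_measure// inE//; exact: (compact_measurable_borel mdA).
  rewrite -(@fineK _ (mu t V)) ?fin_num_measure//.
  by rewrite lee_fin => ?; lra.
have [mu0 [mu0K cvgmu]] :=
  @ultra_weak_limit R A dA mdA dA0 T U UU mu (KA t0) (@cKA t0) tight.
exists mu0; last by apply/Pweak_cvgP.
split=> // b0 Kb0.
(* Pairs (t, b) with b admissible at t, while t follows [U] and b tends to [b0]. Lower
   semicontinuity is what makes this filter proper. *)
pose G := within [set p : T * B | KB p.1 p.2] (filter_prod U (nbhs b0)).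
have GF : ProperFilter G.
  apply: Build_ProperFilter_ex => Z [[Q1 Q2] /= [UQ1 bQ2] sub].
  have h : U [set s | KB s `&` Q2 !=set0] by apply: Ut0; exact: (lscB Kb0 bQ2).
  have [t [/= Q1t [b [Ktb Q2b]]]] := filter_ex (filterI UQ1 h).
  by exists (t, b); exact: (sub (t, b)).
have G1 : (fst : T * B -> T) @ G --> U.
  by apply: cvg_trans (cvg_fst (G := nbhs b0)); apply: cvg_app; exact: cvg_within.
have G2 : (snd : T * B -> B) @ G --> b0.
  apply: cvg_trans (cvg_snd (F := U) (G := nbhs b0)).
  by apply: cvg_app; exact: cvg_within.
have cfP : continuous (fun z : (T * B) * A => f z.1.1 z.2 z.1.2).
  move=> [[t b] a]; have h := @cf (t, a, b).
  have c1 : continuous (fun z : (T * B) * A => (z.1.1, z.2, z.1.2)).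
    apply: continuous_pair.
      by apply: continuous_pair => z; [exact: (cvg_comp _ _ cvg_fst cvg_fst)|exact: cvg_snd].
    by move=> z; exact: (cvg_comp _ _ cvg_fst cvg_snd).
  exact: (cvg_comp _ _ (c1 (t, b, a)) h).
have lim := @joint_mean_cvg R A (T * B)%type dA _
  (fun p a => f p.1 a p.2) M (T * B)%type G id (t0, b0) (fun p => mu p.1) mu0
  mdA (metrizes_prod mdT mdB) GF cfP.
have {lim} /= lim := lim (fun p a => fM p.1 a p.2).
have {lim} /lim lim : id @ G --> (t0, b0).
  rewrite (_ : id = fun p : T * B => (p.1, p.2)); last by apply/funext => -[].
  by apply: cvg_pair => //; exact: cvg_trans Ut0.
have {lim} lim : mean (mu p.1) (fun a => f p.1 a p.2) @[p --> G] -->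
    mean mu0 (fun a => f t0 a b0).
  apply: lim => phi bphi; exact: (cvg_comp _ (fun t => mean (mu t) phi) G1 (cvgmu phi bphi)).
have vG : v p.1 @[p --> G] --> l by exact: (cvg_comp _ _ G1 vl).
apply: (ler_cvg_to vG lim).
have : G ((fst : T * B -> T) @^-1` [set t | guarantees t (v t) (mu t)]) by exact: G1.
have : G [set p | KB p.1 p.2] by rewrite /G /within/=; apply: filterE.
by apply: filterS2 => p Kp [_ ]; exact.
Qed.

End guarantee.

(** * Measurable selection from compact sets of strategies *)

Section selection.
Context d (X : measurableType d) (P : ptopologicalType) (R : realType).
Variables (h : nat -> P -> R) (S : X -> set P).
Hypothesis ch : forall n, continuous (h n).
Hypothesis sep : forall x y, (forall n, h n x = h n y) ->
  forall C, closed C -> C x -> C y.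
Hypothesis cS : forall x, compact (S x).
Hypothesis S0 : forall x, S x !=set0.
Hypothesis mS : forall C, closed C -> measurable [set x | S x `&` C !=set0].

(* Minimizing h 0, h 1, ... lexicographically over S x leaves a nonempty set of
   points that no closed set can tell apart. *)
Let Sel := fix Sel (n : nat) (x : X) : set P :=
  if n is k.+1 then
    Sel k x `&` [set y | forall z, Sel k x z -> h k y <= h k z]
  else S x.

Let closed_minimizers n x :
  closed [set y | forall z, Sel n x z -> h n y <= h n z].
Proof.
rewrite (_ : mkset _ = \bigcap_(z in Sel n x) (h n @^-1` [set r | r <= h n z])).
  by apply: closed_bigI => z _; apply: closed_comp => //; exact: closed_le.
by apply/seteqP; split.
Qed.

Let Sel_closed n x : exists2 K, closed K & Sel n x = S x `&` K.
Proof.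
elim: n => [|n [K cK /= E]]; first by exists setT; rewrite ?setIT//; exact: closedT.
exists (K `&` [set y | forall z, Sel n x z -> h n y <= h n z]).
  exact: closedI.
by rewrite setIA -E.
Qed.

Let Sel_compact n x C : closed C -> compact (Sel n x `&` C).
Proof.
move=> cC; have [K cK ->] := Sel_closed n x.
by rewrite -setIA; apply: compact_closedI => //; exact: closedI.
Qed.

Let Sel_decr n m x : (n <= m)%N -> Sel m x `<=` Sel n x.
Proof.
elim: m => [|m IH]; first by rewrite leqn0 => /eqP->.
rewrite leq_eqVlt => /orP[/eqP->//|]; rewrite ltnS => /IH.
by apply: subset_trans => y [].
Qed.

Let Sel_neq0 n x : Sel n x !=set0.
Proof.
elim: n => [|n IH] //.
have cSel : compact (Sel n x) by have := @Sel_compact n x setT closedT; rewrite setIT.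
have [y /set_mem Sy ymin] :=
  @compact_EVT_min P R (h n) (Sel n x) IH cSel (continuous_subspaceT (@ch n)).
by exists y; split => // z Sz; apply: ymin; rewrite inE.
Qed.

(** Nested compactness: points chosen in the successive intersections have a cluster point in [S x],
    and it belongs to every one of them because they are closed relative to [S x]. *)
Let Sel_inter x C : closed C -> (forall n, Sel n x `&` C !=set0) ->
  exists y, C y /\ forall n, Sel n x y.
Proof.
move=> cC ne; pose y n := projT1 (cid (ne n)).
have yP n : (Sel n x `&` C) (y n) by exact: (projT2 (cid (ne n))).
have [|p [Sp clp]] := @cS x (y @ \oo).
  by exists 0%N => // n _; exact: (Sel_decr (leq0n n) (yP n).1).
have inK K : closed K -> (\forall n \near \oo, K (y n)) -> K p.
  move=> cK near; apply: cK => N Np.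
  by have [z [Kz Nz]] := clp K N near Np; exists z.
exists p; split; first by apply: inK => //; apply: nearW => n; exact: (yP n).2.
move=> n; have [K cK E] := Sel_closed n x; rewrite E; split => //.
apply: inK => //; exists n => // m /= nm.
by have := Sel_decr nm (yP m).1; rewrite E => -[].
Qed.

(** [Sel n.+1 x] meets [C] exactly when [h n] gets as low on the part of [Sel n x] inside [C] as on
    all of [Sel n x]. Testing this at rational levels expresses it through countably many hitting
    sets of [Sel n]. *)
Let measurable_Sel n C : closed C -> measurable [set x | Sel n x `&` C !=set0].
Proof.
elim: n C => [|n IH] C cC; first exact: mS.
have cq (q : rat) : closed (h n @^-1` [set r | r <= ratr q]).
  by apply: closed_comp => //; exact: closed_le.
pose Z q := ~` [set x | Sel n x `&` (h n @^-1` [set r | r <= ratr q]) !=set0] `|`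
   [set x | Sel n x `&` (C `&` (h n @^-1` [set r | r <= ratr q])) !=set0].
rewrite (_ : mkset _ = ~` \bigcup_q (~` Z q)).
  apply: measurableC; apply: bigcupT_measurable_rat => q; apply: measurableC.
  apply: measurableU; first by apply: measurableC; exact: IH.
  by apply: IH; exact: closedI.
rewrite setC_bigcup; apply/seteqP; split => x /=.
  move=> [y [[Sy ymin] Cy]] q _; rewrite setCK.
  have [[z [Sz hz]]|] := pselect (Sel n x `&` (h n @^-1` [set r | r <= ratr q]) !=set0).
    right; exists y; split => //; split => //=.
    exact: le_trans (ymin z Sz) hz.
  by left.
move=> ZA; have Zq q : Z q x by have := ZA q I; rewrite setCK.
have [y0 [Sy0 y0min]] := Sel_neq0 n.+1 x.
have hq q : h n y0 <= ratr q ->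
    Sel n x `&` (C `&` (h n @^-1` [set r | r <= ratr q])) !=set0.
  by move=> hq; case: (Zq q) => //; case; exists y0.
have ne : Sel n x `&` C !=set0.
  have [q] := @rat_in_itvoo R (h n y0) (h n y0 + 1) ltac:(by rewrite ltrDl).
  rewrite in_itv /= => /andP[/ltW /hq[y [Sy [Cy _]]] _].
  by exists y.
have [y /set_mem [Sy Cy] ymin] := @compact_EVT_min P R (h n) (Sel n x `&` C) ne
  (Sel_compact (n := n) (x := x) cC) (continuous_subspaceT (@ch n)).
exists y; split => //; split => // z Sz.
apply: le_trans (y0min z Sz).
rewrite leNgt; apply/negP => lt.
have [q] := rat_in_itvoo lt; rewrite in_itv /= => /andP[/ltW/hq[y' [Sy' [Cy' hy']]] qy].
have : h n y <= h n y' by apply: ymin; rewrite inE.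
by rewrite leNgt (le_lt_trans hy' qy).
Qed.

(** Points that survive all the minimizations share every [h n], so a closed set contains all of
    them or none. Hence the preimage of a closed set is the intersection of the hitting sets,
    whichever surviving points are chosen. *)
Lemma measurable_selection : exists s : X -> borel P,
  measurable_fun setT s /\ forall x, S x (s x).
Proof.
have ex x : exists y, forall n, Sel n x y.
  have [y [_ Sy]] := @Sel_inter x setT closedT (fun n => eq_ind_r (fun Z => Z !=set0)
     (Sel_neq0 n x) (setIT _)).
  by exists y.
pose s x := projT1 (cid (ex x)).
have sP x n : Sel n x (s x) by exact: (projT2 (cid (ex x))).
exists s; split; last by move=> x; exact: (sP x 0%N).
have mC C : closed C -> measurable (s @^-1` C).
  move=> cC; rewrite (_ : s @^-1` C = \bigcap_n [set x | Sel n x `&` C !=set0]).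
    by apply: bigcapT_measurable => n; exact: measurable_Sel.
  apply/seteqP; split => x /=; first by move=> Cx n _; exists (s x).
  move=> ne; have [y [Cy yS]] := @Sel_inter x C cC (fun n => ne n I).
  apply: sep cC Cy => n; apply/eqP; rewrite eq_le.
  by apply/andP; split; [exact: ((yS n.+1).2 _ (sP x n))|exact: ((sP x n.+1).2 _ (yS n))].
apply: (@measurability _ _ X (borel P) setT s (@open P)) => //.
move=> _ [V oV <-]; rewrite setTI -[V]setCK.
by apply: measurableC; apply: mC; exact: open_closedC.
Qed.

End selection.

(** Laws that agree on measurable sets may differ, as functions, on other sets; this is why points
    are separated only up to membership in closed sets. *)
Lemma Pweak_separating (R : realType) (S : ptopologicalType) (d : S -> S -> R)
    (U : nat -> set S) : metrizes d -> countable_base U ->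
  exists h : nat -> Pweak R S -> R, (forall n, continuous (h n)) /\
    forall mu nu, (forall n, h n mu = h n nu) ->
      forall C : set (Pweak R S), closed C -> C mu -> C nu.
Proof.
move=> md cbU.
pose phi n : S -> R := if @unpickle (seq nat * nat)%type n is Some p
  then inf_conv d p.2%:R \1_(\bigcup_(k in [set` p.1]) U k) else fun=> 0.
have bphi n : bounded_continuous (phi n).
  rewrite /phi; case: unpickle => [[l k]|] /=; last first.
    by split; [move=> x; exact: cvg_cst|exists 0 => s; rewrite normr0].
  apply: (@bounded_continuous_inf_conv _ _ _ md _ _ 1) => // x.
  by rewrite indicE ler0n lern1 leq_b1.
exists (fun n mu => mean mu (phi n)); split.
  by move=> n; exact: continuous_test_integral.
move=> mu nu eqh C cC Cmu.
have eqmn : forall V : set (borel S), measurable V ->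
    (mu : probability (borel S) R) V = (nu : probability (borel S) R) V.
  apply: (mean_separates md cbU) => l n.
  by have := eqh (pickle (l, n)); rewrite /phi pickleK.
have munu : nbhs (mu : Pweak R S) --> (nu : Pweak R S).
  apply/Pweak_cvgP => psi bpsi.
  have -> : mean nu psi = mean mu psi.
    rewrite /mean /Rintegral; congr fine.
    by apply: eq_measure_integral => V mV _; exact: (esym (eqmn V mV)).
  exact: continuous_test_integral.
apply: cC => N /munu Nmu; exists mu; split => //.
exact: nbhs_singleton Nmu.
Qed.

Section compact_guarantees.
Context (R : realType) (A B : ptopologicalType) (T : topologicalType).
Variables (dA : A -> A -> R) (dB : B -> B -> R) (dT : T -> T -> R).
Hypotheses (mdA : metrizes dA) (mdB : metrizes dB) (mdT : metrizes dT).
Hypothesis dA0 : forall x y, dA x y = 0 -> x = y.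
Variables (KA : T -> set A) (KB : T -> set B).
Hypothesis cKA : forall t, compact (KA t).
Hypothesis uscA : forall t V, open V -> KA t `<=` V ->
  \forall s \near t, KA s `<=` V.
Hypothesis lscB : forall t b V, KB t b -> nbhs b V ->
  \forall s \near t, KB s `&` V !=set0.
Variables (f : T -> A -> B -> R) (M : R).
Hypothesis fM : forall t a b, 0 <= f t a b <= M.
Hypothesis cf : continuous (fun z : T * A * B => f z.1.1 z.1.2 z.2).

Let G := guarantees KA KB f.

Lemma compact_guarantees t v : @compact (Pweak R A) (G t v).
Proof.
rewrite (_ : G t v = carried (KA t) `&` \bigcap_(b in KB t)
   ((fun mu => mean mu (fun a => f t a b)) @^-1` [set r : R | v <= r])).
  apply: compact_closedI; first exact: (compact_carried mdA).
  apply: closed_bigI => b _; apply: closed_comp => [mu _|]; last exact: closed_ge.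
  apply: continuous_test_integral; split.
    move=> a; have h := @cf (t, a, b).
    have c1 : continuous (fun a : A => (t, a, b)).
      by do 2 (apply: continuous_pair => ? //; last exact: cvg_cst); move=> ?; exact: cvg_cst.
    exact: (cvg_comp _ _ (c1 a) h).
  by exists M => a; case/andP: (fM t a b) => ? ?; rewrite ger0_norm.
by apply/seteqP; split.
Qed.

(** A point of the closure is approached by an ultrafilter living on the hitting set. Strategies
    chosen there have a weak limit, which is again a guarantee and lies in the closed set [C]. *)
Lemma closed_guarantees_hit (v : T -> R) (C : set (Pweak R A)) :
  continuous v -> closed C -> closed [set t | G t (v t) `&` C !=set0].
Proof.
move=> cv cC t0 clt.
pose Z := [set t | G t (v t) `&` C !=set0].
have WF : ProperFilter (within Z (nbhs t0)).
  apply: Build_ProperFilter_ex => Y YZ.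
  by have [t [Zt Yt]] := clt _ YZ; exists t; exact: Yt.
have [U [UU WU]] := ultraFilterLemma WF.
have Ut0 : U --> t0 by move=> N Nt; apply: WU; exact: (filterS _ Nt).
have UZ : U Z.
  apply: WU; suff : nbhs t0 [set t | Z t -> Z t] by [].
  by rewrite (_ : mkset _ = setT); [exact: filterT|apply/seteqP; split => // t _ /=].
pose mu t := if pselect (Z t) is left h then projT1 (cid h) else point.
have muP t : Z t -> (G t (v t) `&` C) (mu t).
  by rewrite /mu; case: pselect => // h _; exact: (projT2 (cid h)).
have vU : v t @[t --> U] --> v t0 by apply: cvg_trans (cv t0); exact: cvg_app.
have [mu0 Gmu0 lim] := @guarantee_closed R A B T dA dB dT mdA mdB mdT dA0 KA KB
  cKA uscA lscB f M fM cf U t0 mu v (v t0) UU Ut0 vU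
  (filterS (fun t Zt => (muP t Zt).1) UZ).
exists mu0; split => //.
apply: (@closed_cvg _ (Pweak R A) U _ mu C cC _ mu0 lim).
by apply: filterS UZ => t /muP[].
Qed.

(** The map [i] links a measurable space to the topological parameter space: later [E * R] carries
    its product topology on one side and the product sigma-algebra of [borel E] and the reals on the
    other. *)
Lemma measurable_guarantees_selector (UA : nat -> set A) d (X : measurableType d)
    (i : X -> T) (v : T -> R) :
  countable_base UA ->
  (forall C : set T, closed C -> measurable (i @^-1` C)) ->
  continuous v -> (forall t, G t (v t) !=set0) ->
  exists s : X -> probability (borel A) R,
    measurable_fun setT (s : X -> borel (Pweak R A)) /\
    forall x, G (i x) (v (i x)) (s x).
Proof.
move=> cbU mi cv ne.
have [h [ch sep]] := Pweak_separating mdA cbU.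
apply: (@measurable_selection _ X (Pweak R A) R h (fun x => G (i x) (v (i x)))) => //.
- by move=> x; exact: compact_guarantees.
- move=> C cC; exact: (mi _ (closed_guarantees_hit cv cC)).
Qed.

End compact_guarantees.

Section game_value.
Context (R : realType) (A B : ptopologicalType) (T : topologicalType).
Variables (dA : A -> A -> R) (dB : B -> B -> R) (dT : T -> T -> R).
Hypotheses (mdA : metrizes dA) (mdB : metrizes dB) (mdT : metrizes dT).
Hypothesis dA0 : forall x y, dA x y = 0 -> x = y.
Hypothesis dB0 : forall x y, dB x y = 0 -> x = y.
Variables (KA : T -> set A) (KB : T -> set B).
Hypothesis cKA : forall t, compact (KA t).
Hypothesis cKB : forall t, compact (KB t).
Hypothesis KA0 : forall t, KA t !=set0.
Hypothesis KB0 : forall t, KB t !=set0.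
Hypothesis uscA : forall t V, open V -> KA t `<=` V ->
  \forall s \near t, KA s `<=` V.
Hypothesis uscB : forall t V, open V -> KB t `<=` V ->
  \forall s \near t, KB s `<=` V.
Hypothesis lscA : forall t a V, KA t a -> nbhs a V ->
  \forall s \near t, KA s `&` V !=set0.
Hypothesis lscB : forall t b V, KB t b -> nbhs b V ->
  \forall s \near t, KB s `&` V !=set0.
Variables (f : T -> A -> B -> R) (M : R).
Hypothesis fM : forall t a b, 0 <= f t a b <= M.
Hypothesis cf : continuous (fun z : T * A * B => f z.1.1 z.1.2 z.2).
Hypothesis mf : forall t, measurable_fun [set: borel A * borel B]
  ((fun z => f t z.1 z.2) : borel A * borel B -> R).

Definition caps (t : T) (v : R) : set (probability (borel B) R) :=
  [set nu | carried (KB t) nu /\ forall a, KA t a -> mean nu (f t a) <= v].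

(** The reflected payoff exchanges the players and keeps the range [0, M], so caps become guarantees
    and each result on guarantees serves both players. *)
Let f' t b a := -1 * f t a b + M.

Let fA t b : continuous (f t ^~ b).
Proof.
move=> a; have h := @cf (t, a, b).
have c1 : continuous (fun a : A => (t, a, b)).
  by do 2 (apply: continuous_pair => ? //; last exact: cvg_cst); move=> ?; exact: cvg_cst.
exact: (cvg_comp _ _ (c1 a) h).
Qed.

Let fB t a : continuous (f t a).
Proof.
move=> b; have h := @cf (t, a, b).
have c1 : continuous (fun b : B => (t, a, b)).
  by apply: continuous_pair => ?; [exact: cvg_cst|exact: cvg_id].
exact: (cvg_comp _ _ (c1 b) h).
Qed.

Let f'M t b a : 0 <= f' t b a <= M.
Proof. by have /andP[? ?] := fM t a b; rewrite /f'; apply/andP; split; lra. Qed.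

Let cf' : continuous (fun z : T * B * A => f' z.1.1 z.1.2 z.2).
Proof.
move=> [[t b] a]; rewrite /f'; apply: cvgD; last exact: cvg_cst.
apply: cvgMl_tmp; have h := @cf (t, a, b).
have c1 : continuous (fun z : T * B * A => (z.1.1, z.2, z.1.2)).
  apply: continuous_pair.
    by apply: continuous_pair => z; [exact: (cvg_comp _ _ cvg_fst cvg_fst)|exact: cvg_snd].
  by move=> z; exact: (cvg_comp _ _ cvg_fst cvg_snd).
exact: (cvg_comp _ _ (c1 (t, b, a)) h).
Qed.

Lemma capsE t v : caps t v = guarantees KB KA f' t (M - v).
Proof.
apply/seteqP; split => nu [nuK h]; split => // a /h;
rewrite /f' (@mean_affine _ _ nu (f t a) M); try lra.
- exact: continuous_measurable_borel.
- by move=> b; case/andP: (fM t a b) => ? ?; rewrite ger0_norm.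
- exact: continuous_measurable_borel.
- by move=> b; case/andP: (fM t a b) => ? ?; rewrite ger0_norm.
Qed.

Let meanA_continuous (mu : probability (borel A) R) t :
  continuous (fun b => mean mu (f t ^~ b)).
Proof.
move=> b; apply: (@joint_mean_cvg R A (T * B)%type dA _ (fun p a => f p.1 a p.2)
  M B (nbhs b) (fun b => (t, b)) (t, b) (fun=> mu) mu mdA (metrizes_prod mdT mdB)).
- move=> [[u b'] a]; have h := @cf (u, a, b').
  have c1 : continuous (fun z : (T * B) * A => (z.1.1, z.2, z.1.2)).
    apply: continuous_pair.
      by apply: continuous_pair => z; [exact: (cvg_comp _ _ cvg_fst cvg_fst)|exact: cvg_snd].
    by move=> z; exact: (cvg_comp _ _ cvg_fst cvg_snd).
  exact: (cvg_comp _ _ (c1 (u, b', a)) h).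
- by move=> q a; exact: fM.
- by apply: cvg_pair; [exact: cvg_cst|exact: cvg_id].
- by move=> phi _; exact: cvg_cst.
Qed.

Let meanB_continuous (nu : probability (borel B) R) t :
  continuous (fun a => mean nu (f t a)).
Proof.
move=> a; apply: (@joint_mean_cvg R B (T * A)%type dB _ (fun p b => f p.1 p.2 b)
  M A (nbhs a) (fun a => (t, a)) (t, a) (fun=> nu) nu mdB (metrizes_prod mdT mdA)).
- move=> [[u a'] b]; exact: (@cf (u, a', b)).
- by move=> q b; exact: fM.
- by apply: cvg_pair; [exact: cvg_cst|exact: cvg_id].
- by move=> phi _; exact: cvg_cst.
Qed.

Lemma guarantees_le_caps t v v' mu nu :
  guarantees KA KB f t v mu -> caps t v' nu -> v <= v'.
Proof.
move=> [muK h1] [nuK h2].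
exact: (saddle_le mdA mdB dA0 dB0 (fM t) (@mf t) (@fB t) (@fA t)
  (fun mu => @meanA_continuous mu t) (fun nu => @meanB_continuous nu t)
  (@cKA t) (@cKB t) muK nuK h1 h2).
Qed.

Lemma game_value_ex t : exists v,
  guarantees KA KB f t v !=set0 /\ caps t v !=set0.
Proof.
have [v [mu [nu [muK nuK h1 h2]]]] := static_saddle mdA mdB dA0 dB0 (fM t) (@mf t)
  (@fB t) (@fA t) (fun mu => @meanA_continuous mu t)
  (fun nu => @meanB_continuous nu t) (@cKA t) (@cKB t) (KA0 t) (KB0 t).
by exists v; split; [exists mu|exists nu].
Qed.

Definition game_value t : R := projT1 (cid (game_value_ex t)).

Lemma game_valueP t : guarantees KA KB f t (game_value t) !=set0 /\
  caps t (game_value t) !=set0.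
Proof. exact: (projT2 (cid (game_value_ex t))). Qed.

Lemma game_value_bounds t : 0 <= game_value t <= M.
Proof.
have [[mu [muK h1]] [nu [nuK h2]]] := game_valueP t.
have [a Ka] := KA0 t; have [b Kb] := KB0 t.
have mA : measurable_fun [set: borel A] (f t ^~ b : borel A -> R).
  exact: continuous_measurable_borel.
have mB : measurable_fun [set: borel B] (f t a : borel B -> R).
  exact: continuous_measurable_borel.
have /andP[_ h] := mean_ge0_le mu mA (fun a => fM t a b).
have /andP[h' _] := mean_ge0_le nu mB (fM t a).
by rewrite (le_trans h' (h2 a Ka)) (le_trans (h1 b Kb) h).
Qed.

(** Along an ultrafilter tending to [t0] the values converge to some l in [0, M]. Limits of optimal
    strategies both guarantee l and cap at l in the game at [t0], and weak duality identifies l with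
    the value there. *)
Lemma game_value_continuous : continuous game_value.
Proof.
move=> t0; apply: cvg_ultra => U UU Ut0 W Wv.
have UFv : UltraFilter (game_value @ U) by exact: ultra_fmap.
have := @segment_compact R 0 M; rewrite compact_ultra => /(_ _ UFv) [].
  suff : U (game_value @^-1` `[0, M]%classic) by [].
  by apply: filterE => t /=; rewrite in_itv /= game_value_bounds.
move=> l [_ vl].
pose mu t := projT1 (cid (game_valueP t).1).
pose nu t := projT1 (cid (game_valueP t).2).
have [mu0 Gmu0 _] := @guarantee_closed R A B T dA dB dT mdA mdB mdT dA0 KA KB
  cKA uscA lscB f M fM cf U t0 mu game_value l UU Ut0 vl
  (@filterE _ U _ _ (fun t => projT2 (cid (game_valueP t).1))).
have nuP t : guarantees KB KA f' t (M - game_value t) (nu t).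
  by rewrite -capsE; exact: (projT2 (cid (game_valueP t).2)).
have vl' : (M - game_value t) @[t --> U] --> M - l.
  by apply: cvgB => //; exact: cvg_cst.
have [nu0 Gnu0 _] := @guarantee_closed R B A T dB dA dT mdB mdA mdT dB0 KB KA
  cKB uscB lscA f' M f'M cf' U t0 nu (fun t => M - game_value t) (M - l) UU Ut0 vl'
  (@filterE _ U _ _ nuP).
have [[mu1 Gmu1] [nu1 Gnu1]] := game_valueP t0.
rewrite -capsE in Gnu0.
have lE : l = game_value t0.
  apply/eqP; rewrite eq_le (guarantees_le_caps Gmu0 Gnu1).
  exact: (guarantees_le_caps Gmu1 Gnu0).
by apply: vl; rewrite lE.
Qed.

Lemma measurable_saddle_selectors (UA : nat -> set A) (UB : nat -> set B)
    d (X : measurableType d) (i : X -> T) :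
  countable_base UA -> countable_base UB ->
  (forall C : set T, closed C -> measurable (i @^-1` C)) ->
  (exists s : X -> probability (borel A) R,
    measurable_fun setT (s : X -> borel (Pweak R A)) /\
    forall x, guarantees KA KB f (i x) (game_value (i x)) (s x)) /\
  (exists s : X -> probability (borel B) R,
    measurable_fun setT (s : X -> borel (Pweak R B)) /\
    forall x, caps (i x) (game_value (i x)) (s x)).
Proof.
move=> cbA cbB mi; split.
  apply: (measurable_guarantees_selector mdA mdB mdT dA0 cKA uscA lscB fM cf cbA mi).
    exact: game_value_continuous.
  by move=> t; exact: (game_valueP t).1.
have [||s [ms sP]] := measurable_guarantees_selector mdB mdA mdT dB0 cKB uscB lscA f'M
  cf' cbB mi (v := fun t => M - game_value t).
- by move=> t; apply: cvgB; [exact: cvg_cst|exact: game_value_continuous].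
- by move=> t; rewrite -capsE; exact: (game_valueP t).2.
by exists s; split => // x; rewrite capsE.
Qed.

End game_value.

(** * The Ionescu Tulcea theorem *)

Lemma eq_in_set (T U : Type) (A : set T) (B : set U) x y :
  A x = B y -> (x \in A) = (y \in B).
Proof. by move=> h; apply/idP/idP => /set_mem; [rewrite h|rewrite -h] => /mem_set. Qed.

Section ionescu_tulcea.
Context (R : realType) (E A B : ptopologicalType).
Let SS := (borel E * borel A * borel B)%type.
Let W := traj E A B.

Definition upd (w : W) (n : nat) (s : SS) : W :=
  fun k => if k == n then s else w k.

(** The coordinates from n on are replaced by the default [point]. The map is measurable for the
    sigma-algebra of the first n coordinates, so whatever depends on these alone factors through
    it. *)
Definition trunc (n : nat) (w : W) : W := fun k => if (k < n)%N then w k else point.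

Definition determined (n : nat) (H : set W) : Prop :=
  forall w w', (forall k, (k < n)%N -> w k = w' k) -> H w -> H w'.

Lemma measurable_coord k : measurable_fun [set: W] (fun w : W => w k : SS).
Proof.
move=> _ C mC; rewrite setTI; apply: sub_sigma_algebra.
by exists k => //; exists C.
Qed.

Lemma measurable_traj d (X : measurableType d) (f : X -> W) :
  (forall k, measurable_fun setT (fun x => f x k : SS)) -> measurable_fun setT f.
Proof.
move=> mf; apply: (@measurability _ _ X W setT f (@cylinders E A B setT)) => //.
move=> _ [_ [k _ [C mC <-]] <-].
exact: mf.
Qed.

Lemma measurable_upd n : measurable_fun setT (fun z : W * SS => upd z.1 n z.2).
Proof.
apply: measurable_traj => k; rewrite /upd; case: eqP => _; first exact: measurable_snd.
exact: (measurableT_comp (measurable_coord k) measurable_fst).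
Qed.

Lemma measurable_upd2 n w : measurable_fun setT (upd w n).
Proof.
exact: (measurableT_comp (measurable_upd n) (measurable_pair1 w)).
Qed.

Lemma measurable_trunc n :
  measurable_fun setT
    (trunc n : g_sigma_algebraType (@cylinders E A B [set k | (k < n)%N]) -> W).
Proof.
apply: measurable_traj => k; rewrite /trunc; case: (ltnP k n) => kn; last exact: measurable_cst.
move=> _ C mC; rewrite setTI; apply: sub_sigma_algebra.
by exists k => //; exists C.
Qed.

Lemma cylinders_sub I :
  <<s @cylinders E A B I >> `<=` (measurable : set (set W)).
Proof.
apply: smallest_sub; first exact: sigma_algebra_measurable.
move=> _ [k _ [C mC <-]]; apply: sub_sigma_algebra.
by exists k => //; exists C.
Qed.

Lemma measurable_truncW n : measurable_fun setT (trunc n : W -> W).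
Proof.
move=> mT C mC; rewrite setTI; apply: (@cylinders_sub [set k | (k < n)%N]).
by have := @measurable_trunc n measurableT C mC; rewrite setTI.
Qed.

Lemma determinedW n m H : (n <= m)%N -> determined n H -> determined m H.
Proof. by move=> nm dH w w' ww'; apply: dH => k kn; rewrite ww'// (leq_trans kn). Qed.

Lemma determinedI n H H' : determined n H -> determined n H' -> determined n (H `&` H').
Proof. by move=> h h' w w' ww' [Hw H'w]; split; [exact: h Hw|exact: h' H'w]. Qed.

Lemma determinedC n H : determined n H -> determined n (~` H).
Proof. by move=> h w w' ww' nHw Hw'; apply/nHw/(h w') => // k kn; rewrite ww'. Qed.

Lemma determined_history n H : <<s @cylinders E A B [set k | (k < n)%N] >> H ->
  determined n H.
Proof.
move: H; apply: smallest_sub => /=.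
  split.
  - by [].
  - by move=> H dH; rewrite setTD; exact: determinedC.
  - by move=> F dF w w' ww' [k _ Fk]; exists k => //; exact: dF Fk.
move=> _ [k kn [C mC <-]] w w' ww' /=; by rewrite ww'.
Qed.

(** The conditional law of coordinate n given the past, written as a function of the whole
    trajectory that reads only its first n coordinates. *)
Variable kap : nat -> W -> probability SS R.
Hypothesis kk : forall n, is_kernel (kap n).
Hypothesis kdet : forall n w w', (forall k, (k < n)%N -> w k = w' k) ->
  kap n w = kap n w'.

(* Law of the trajectory starting from w, with the coordinates
   n, ..., n + m - 1 resampled. *)
Fixpoint resample (m n : nat) (w : W) : probability W R :=
  if m is m'.+1 then kernel_bind (kap n w) (fun s => resample m' n.+1 (upd w n s))
  else \d_w.

Lemma is_kernel_resample m n : is_kernel (resample m n).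
Proof.
elim: m n => [|m IH] n /=; first exact: (@is_kernel_dirac _ _ W W R id).
apply: (is_kernel_bind (kk n)
  (k := fun z : W * SS => resample m n.+1 (upd z.1 n z.2))).
exact: (is_kernel_comp (@measurable_upd n) (IH n.+1)).
Qed.

Let is_kernel_resample2 m n w : is_kernel (fun s => resample m n.+1 (upd w n s)).
Proof. exact: (is_kernel_comp (@measurable_upd2 n w) (@is_kernel_resample m n.+1)). Qed.

Lemma resampleS m n w C : measurable C ->
  resample m.+1 n w C = (\int[kap n w]_s resample m n.+1 (upd w n s) C)%E.
Proof. by move=> mC; rewrite /= kernel_bindE. Qed.

Lemma determined_upd n N w s C : (N <= n)%N -> determined N C ->
  C (upd w n s) = C w.
Proof.
move=> Nn dC; have h k : (k < N)%N -> upd w n s k = w k.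
  by move=> kN; rewrite /upd ltn_eqF// (leq_trans kN).
apply/propext; split; apply: dC => // k kN; by rewrite h.
Qed.

(** Coordinates from [N] on do not affect [C], so resampling one more of them integrates a
    constant. *)
Lemma resample_stable m n N w C : measurable C -> determined N C ->
  (N <= n + m)%N -> resample m.+1 n w C = resample m n w C.
Proof.
move=> mC dC; elim: m n w => [|m IH] n w h.
  rewrite resampleS//= addn0 in h *.
  transitivity (\int[kap n w]_s \d_w C)%E; last first.
    transitivity (\d_w C * kap n w setT)%E; first exact: integral_cst.
    by rewrite [X in (_ * X)%E](_ : _ = 1%E) ?mule1//; exact: probability_setT.
  apply: eq_integral => s _; rewrite !diracE; congr ((nat_of_bool _)%:R%:E).
  by apply: eq_in_set; exact: determined_upd h dC.
rewrite resampleS// [RHS]resampleS//; apply: eq_integral => s _.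
by rewrite IH// addSnnS.
Qed.

Lemma resample_le m m' n N w C : measurable C -> determined N C ->
  (N <= n + m)%N -> (m <= m')%N -> resample m' n w C = resample m n w C.
Proof.
move=> mC dC h /subnK <-; elim: (m' - m)%N => [|j IH] //.
by rewrite addSn (resample_stable (N := N))// (leq_trans h)// leq_add2l leq_addl.
Qed.

(** [resample] peels off the first step by definition. Peeling off the last one is what exhibits
    [kap] as a conditional law. *)
Lemma resample_last m n w C : measurable C ->
  resample m.+1 n w C = (\int[resample m n w]_w' resample 1 (n + m) w' C)%E.
Proof.
move=> mC; elim: m n w => [|m IH] n w.
  rewrite [in RHS]/resample -/resample integral_dirac// ?diracT ?mul1e ?addn0//.
  exact: (@is_kernel_resample 1 n C mC).
rewrite resampleS// [RHS]integral_kernel_bind//; last exact: is_kernel_resample.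
by apply: eq_integral => s _; rewrite IH addSnnS.
Qed.

(* The sequence is eventually constant when C depends on finitely many
   coordinates (lemma tail_probaE). *)
Definition tail_proba (n : nat) (w : W) (C : set W) : \bar R :=
  limn (fun m => resample m n w C).

Definition finite_dim (C : set W) : Prop :=
  measurable C /\ exists N, determined N C.

Lemma tail_probaE m n N w C : measurable C -> determined N C ->
  (N <= n + m)%N -> tail_proba n w C = resample m n w C.
Proof.
move=> mC dC h; apply: lim_near_cst => //; exists m => // m' /= mm'.
exact: (resample_le (N := N)).
Qed.

Lemma finite_dimI C D : finite_dim C -> finite_dim D -> finite_dim (C `&` D).
Proof.
move=> [mC [N dC]] [mD [N' dD]]; split; first exact: measurableI.
exists (maxn N N'); apply: determinedI; first exact: (determinedW (leq_maxl _ _)).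
exact: (determinedW (leq_maxr _ _)).
Qed.

Lemma finite_dimC C : finite_dim C -> finite_dim (~` C).
Proof. by move=> [mC [N dC]]; split; [exact: measurableC|exists N; exact: determinedC]. Qed.

Lemma tail_probaU n w C D : finite_dim C -> finite_dim D ->
  tail_proba n w C = (tail_proba n w (C `&` D) + tail_proba n w (C `\` D))%E.
Proof.
move=> [mC [N dC]] [mD [N' dD]]; pose m := maxn N N'.
have dC' := determinedW (leq_maxl N N') dC.
have dD' := determinedW (leq_maxr N N') dD.
have h : (m <= n + m)%N by rewrite leq_addl.
rewrite !(tail_probaE _ _ _ h)//; first last.
- exact: determinedI.
- exact: measurableI.
- by rewrite setDE; apply: determinedI => //; exact: determinedC.
- exact: measurableD.
by rewrite addeC; exact: (measureDI (resample m n w)).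
Qed.

Lemma tail_proba_step n w C : finite_dim C ->
  tail_proba n w C = (\int[kap n w]_s tail_proba n.+1 (upd w n s) C)%E.
Proof.
move=> [mC [N dC]].
rewrite (@tail_probaE N.+1 n N)//; last by rewrite addnS leqW// leq_addl.
rewrite resampleS//; apply: eq_integral => s _.
by rewrite (@tail_probaE N n.+1 N)// leq_addl.
Qed.

Lemma tail_proba_det n w C : measurable C -> determined n C ->
  tail_proba n w C = \d_w C.
Proof. by move=> mC dC; rewrite (@tail_probaE 0 n n)// addn0. Qed.

Lemma tail_proba01 n w C : finite_dim C -> (0 <= tail_proba n w C <= 1)%E.
Proof.
move=> [mC [N dC]]; rewrite (@tail_probaE N n N)//; last by rewrite leq_addl.
by rewrite measure_ge0 probability_le1.
Qed.

Lemma le_tail_proba n w C D : finite_dim C -> finite_dim D -> C `<=` D ->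
  (tail_proba n w C <= tail_proba n w D)%E.
Proof.
move=> fC fD CD; rewrite (@tail_probaU _ _ D C)// (setIidr CD) leeDl//.
have := @tail_proba01 n w (D `\` C); rewrite setDE => /(_ (finite_dimI fD (finite_dimC fC))).
by case/andP.
Qed.

Lemma measurable_tail_proba n C : finite_dim C ->
  measurable_fun [set: W] (fun w => tail_proba n w C).
Proof.
move=> [mC [N dC]].
rewrite (_ : (fun w => _) = (fun w => resample N n w C)).
  exact: is_kernel_resample.
by apply/funext => w; rewrite (@tail_probaE N n N)// leq_addl.
Qed.

Let tail_proba_fine n w C : finite_dim C ->
  tail_proba n w C = (fine (tail_proba n w C))%:E.
Proof.
move=> fC; have /andP[h0 h1] := tail_proba01 n w fC.
by rewrite fineK// ge0_fin_numE// (le_lt_trans h1)// ltry.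
Qed.

Let tail_proba_fine01 n w C : finite_dim C -> 0 <= fine (tail_proba n w C) <= 1.
Proof. by move=> fC; rewrite -!lee_fin -tail_proba_fine// tail_proba01. Qed.

(** If every s had a k with tail probability below e', the functions max(h k, e') would tend
    pointwise to e', and so would their integrals under [kap n w]; but these integrals are at least
    e > e'. *)
Lemma tail_proba_descend n w (C : nat -> set W) (e e' : R) :
  (forall k, finite_dim (C k)) -> (forall i j, (i <= j)%N -> C j `<=` C i) ->
  0 <= e' < e -> (forall k, (e%:E <= tail_proba n w (C k))%E) ->
  exists s, forall k, (e'%:E <= tail_proba n.+1 (upd w n s) (C k))%E.
Proof.
move=> fC dC /andP[e'0 ee'] he; apply: contrapT => no.
pose h k s := fine (tail_proba n.+1 (upd w n s) (C k)).
pose g k s := Num.max (h k s) e'.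
have mh k : measurable_fun [set: SS] (h k).
  apply/measurable_EFinP.
  rewrite (_ : _ \o _ = fun s => tail_proba n.+1 (upd w n s) (C k)); last first.
    by apply/funext => s; rewrite /= /h -tail_proba_fine.
  exact: (measurableT_comp (measurable_tail_proba _ (fC k)) (@measurable_upd2 n w)).
have mg k : measurable_fun [set: SS] (g k) by exact: measurable_maxr.
have h01 k s : 0 <= h k s <= 1 by exact: tail_proba_fine01.
have gM k s : `|g k s| <= 1 + e'.
  have /andP[h0 h1] := h01 k s.
  rewrite /g /Num.max; case: ifP => _; first by rewrite ger0_norm// lerDr.
  by rewrite ger0_norm// (le_trans h1)// lerDl.
have : \int[kap n w]_s g k s @[k --> \oo] --> \int[kap n w]_s e'.
  apply: (@bounded_cvg _ SS R (kap n w) g (fun=> e') (1 + e')) => // s.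
  have [k hk] : exists k, (tail_proba n.+1 (upd w n s) (C k) < e'%:E)%E.
    apply: contrapT => nk; apply: no; exists s => k.
    by rewrite leNgt; apply/negP => hk; apply: nk; exists k.
  apply: cvg_near_cst; exists k => // j /= kj; rewrite /g max_r// /h -lee_fin.
  rewrite -tail_proba_fine//; apply: le_trans (ltW hk).
  by apply: le_tail_proba => //; exact: dC.
rewrite Rintegral_prob_cst => lim.
have : e <= e'.
  apply: (ler_cvg_to (cvg_cst e) lim); apply: nearW => k.
  have : e <= \int[kap n w]_s h k s.
    rewrite -lee_fin (@EFin_Rintegral_prob _ SS R (kap n w) (h k) 1)//; last first.
      by move=> s; have /andP[h0 h1] := h01 k s; rewrite ger0_norm.
    apply: (le_trans (he k)); rewrite tail_proba_step//.
    by under eq_integral do rewrite tail_proba_fine//.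
  move=> /le_trans; apply; apply: (@le_Rintegral_prob _ SS R (kap n w) _ _ (1 + e')) => //.
    move=> s; have /andP[h0 h1] := h01 k s.
    by rewrite ger0_norm// (le_trans h1)// lerDl.
  by move=> s; rewrite /g le_max lexx.
by rewrite leNgt ee'.
Qed.

(** Coordinates are chosen one by one so that every [C k] keeps tail probability above e / 2. Once
    all the coordinates on which [C k] depends are fixed, this probability is an indicator; being
    positive it equals 1, so the trajectory constructed lies in [C k]. *)
Lemma tail_proba_continuity w (C : nat -> set W) (e : R) : 0 < e ->
  (forall k, finite_dim (C k)) -> (forall i j, (i <= j)%N -> C j `<=` C i) ->
  (forall k, (e%:E <= tail_proba 0 w (C k))%E) -> \bigcap_k C k !=set0.
Proof.
move=> e0 fC dC he.
(* Strictly decreasing from e towards e / 2: each descent costs some slack, and the bound has to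
   stay positive forever. *)
pose eps n : R := e / 2 + e / 2 * 2^-1 ^+ n.
have eps0 n : 0 < eps n by rewrite addr_gt0// ?mulr_gt0 ?divr_gt0// exprn_gt0.
have epsS n : 0 <= eps n.+1 < eps n.
  rewrite ltW//= ltrD2l ltr_pM2l ?divr_gt0// exprS gtr_pMl ?exprn_gt0//.
  by rewrite invf_lt1// ltr1n.
pose pick n w := get [set s | forall k, ((eps n.+1)%:E <=
  tail_proba n.+1 (upd w n s) (C k))%E].
pose ws := fix ws n := if n is n'.+1 then upd (ws n') n' (pick n' (ws n')) else w.
have wsP n k : ((eps n)%:E <= tail_proba n (ws n) (C k))%E.
  elim: n k => [|n IH] k; first by rewrite /eps expr0 mulr1 -splitr.
  have [s sP] := tail_proba_descend fC dC (epsS n) IH.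
  exact: (getPex (ex_intro (fun s => forall k, ((eps n.+1)%:E <=
    tail_proba n.+1 (upd (ws n) n s) (C k))%E) s sP) k).
pose winf : W := fun k => ws k.+1 k.
have wsE n k : (k < n)%N -> ws n k = winf k.
  elim: n => // n IH; rewrite ltnS leq_eqVlt => /orP[/eqP->//|kn].
  by rewrite -IH//= /upd ltn_eqF.
exists winf => k _; have [mC [N dN]] := fC k.
apply: (dN (ws N)); first exact: wsE.
have := wsP N k; rewrite tail_proba_det// diracE lee_fin.
case: (boolP (ws N \in C k)) => [/set_mem//|_].
by rewrite leNgt eps0.
Qed.

Lemma trajectory_law (w0 : W) : exists P : probability W R,
  forall C N, measurable C -> determined N C -> P C = resample N 0 w0 C.
Proof.
(* The weight +oo outside the finite-dimensional sets makes every cover by other sets harmless. *)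
pose m (C : set W) : \bar R := if pselect (finite_dim C) then tail_proba 0 w0 C else +oo%E.
have mE C : finite_dim C -> m C = tail_proba 0 w0 C by rewrite /m; case: pselect.
have mN C : ~ finite_dim C -> m C = +oo%E by rewrite /m; case: pselect.
have m_ge0 C : (0 <= m C)%E.
  by rewrite /m; case: pselect => // fC; case/andP: (tail_proba01 0 w0 fC).
have f0 : finite_dim set0 by split => //; exists 0%N.
have fT : finite_dim setT by split => //; exists 0%N.
have m0 : m set0 = 0%E.
  by rewrite mE// tail_proba_det.
have mT : m setT = 1%E.
  by rewrite mE// tail_proba_det// diracE in_setT.
have mI C D : finite_dim C -> finite_dim D -> m D = (m (D `&` C) + m (D `\` C))%E.
  move=> fC fD; rewrite !mE ?setDE; first by rewrite -setDE; exact: tail_probaU.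
  - exact: finite_dimI fD (finite_dimC fC).
  - exact: finite_dimI.
  - by [].
have split C : finite_dim C -> forall D,
    (cover_ext m (D `&` C) + cover_ext m (D `\` C) <= m D)%E.
  move=> fC D; have [fD|nfD] := pselect (finite_dim D); last first.
    by rewrite (mN D)// leey.
  by rewrite (mI C D)//; apply: leeD; exact: cover_ext_le1.
have extT : cover_ext m setT = 1%E.
  apply/eqP; rewrite eq_le; apply/andP; split.
    by rewrite -mT; exact: cover_ext_le1.
  apply: cover_ext_inf => F FT.
  have [[k nfk]|allf] := pselect (exists k, ~ finite_dim (F k)).
    apply: (@le_trans _ _ (m (F k))); first by rewrite mN// leey.
    apply: le_trans (nneseries_lim_ge k.+1 _) => //.
    by rewrite big_nat_recr//= leeDr// sume_ge0.
  have fF k : finite_dim (F k) by apply: contrapT => h; apply: allf; exists k.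
  (* What the first n sets of the cover leave out. These sets decrease to the empty set, so
     [tail_proba_continuity] forces their weights below any positive e. *)
  pose D n := \bigcap_(k in [set k | (k < n)%N]) ~` F k.
  have D0 : D 0%N = setT by rewrite /D; apply/seteqP; split.
  have DS n : D n.+1 = D n `\` F n.
    apply/seteqP; split => x /=.
      move=> h; split; last exact: (h n (ltnSn n)).
      by move=> k kn; exact: (h k (leqW kn)).
    move=> [h nF] k /=; rewrite ltnS leq_eqVlt => /orP[/eqP->//|]; exact: h.
  have fD n : finite_dim (D n).
    elim: n => [|n IH]; first by rewrite D0.
    by rewrite DS setDE; apply: finite_dimI => //; exact: finite_dimC.
  have dD i j : (i <= j)%N -> D j `<=` D i.
    by move=> ij x Dx k /= ki; apply: Dx; rewrite /= (leq_trans ki).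
  have sumD n : (1 <= \sum_(0 <= k < n) m (F k) + m (D n))%E.
    elim: n => [|n IH]; first by rewrite big_nil add0e D0 mT.
    apply: (le_trans IH); rewrite big_nat_recr//= -addeA leeD2l//.
    rewrite (mI (F n) (D n))// DS leeD// !mE//; last exact: finite_dimI.
    exact: le_tail_proba (finite_dimI (fD n) (fF n)) (fF n) (@subIsetr _ _ _).
  apply/lee_addgt0Pr => e e0.
  have [k hk] : exists k, (m (D k) < e%:E)%E.
    apply: contrapT => nk; have [|x Dx] := @tail_proba_continuity w0 D e e0 fD dD.
      move=> k; rewrite -mE// leNgt; apply/negP => hk; apply: nk; by exists k.
    have [k _ Fk] := FT x I.
    exact: (Dx k.+1 I k (ltnSn k)).
  apply: (le_trans (sumD k)); apply: leeD; last exact: ltW.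
  exact: nneseries_lim_ge.
have cyl C : @cylinders E A B setT C -> finite_dim C.
  move=> cC; split; first exact: sub_sigma_algebra.
  by move: cC => [k _ [D mD <-]]; exists k.+1 => w w' ww' /=; rewrite ww'.
have [P PE] := @cover_ext_probability R W m m0 m_ge0 (@cylinders E A B setT)
  (fun C cC => split C (cyl C cC)) extT.
exists P => C N mC dC.
have fC : finite_dim C by split => //; exists N.
have -> : resample N 0 w0 C = m C by rewrite mE// (@tail_probaE N 0 N)// leq_addl.
(* The extension is at most [m] on finite-dimensional sets. The same bound on the complement, both
   total masses being 1, gives equality. *)
have le D : finite_dim D -> (P D <= m D)%E by move=> fD; rewrite PE; exact: cover_ext_le1.
apply/eqP; rewrite eq_le le//=.
have PC : P (~` C) = (1 - P C)%E by exact: probability_setC.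
have mC' : m (~` C) = (1 - m C)%E.
  have := mI C setT fC fT; rewrite mT setTI setTD => ->.
  rewrite addeAC subee ?add0e// mE//.
  have /andP[h0 h1] := tail_proba01 0 w0 fC.
  by rewrite ge0_fin_numE// (le_lt_trans h1)// ltry.
have := le _ (finite_dimC fC); rewrite PC mC'.
have /andP[h0 h1] := tail_proba01 0 w0 fC.
have fm : m C \is a fin_num by rewrite mE// ge0_fin_numE// (le_lt_trans h1)// ltry.
have fP : P C \is a fin_num by exact: fin_num_measure.
by rewrite -(fineK fm) -(fineK fP) -!EFinB !lee_fin => ?; lra.
Qed.

(** [f] factors through [trunc n], and the preimages of measurable sets under [trunc n] are
    determined by the first n coordinates, where the two laws agree. *)
Lemma integral_trajectory (P : probability W R) (w0 : W) n (f : W -> \bar R) :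
  (forall C N, measurable C -> determined N C -> P C = resample N 0 w0 C) ->
  measurable_fun setT f -> (forall w, 0 <= f w)%E ->
  (forall w w', (forall k, (k < n)%N -> w k = w' k) -> f w = f w') ->
  (\int[P]_w f w = \int[resample n 0 w0]_w f w)%E.
Proof.
move=> PE mf f0 df.
have kt : is_kernel (fun w : W => \d_(trunc n w) : probability W R).
  exact: (@is_kernel_dirac _ _ W W R (trunc n) (@measurable_truncW n)).
have fE (Z : probability W R) : (\int[Z]_w f w =
    \int[kernel_bind Z (fun w => \d_(trunc n w) : probability W R)]_w f w)%E.
  rewrite integral_kernel_bind//; apply: eq_integral => w _.
  rewrite integral_dirac// diracT mul1e; apply: df => k kn.
  by rewrite /trunc kn.
rewrite fE [RHS]fE; apply: eq_measure_integral => C mC _.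
have kE (Z : probability W R) :
    kernel_bind Z (fun w => \d_(trunc n w) : probability W R) C = Z (trunc n @^-1` C).
  rewrite kernel_bindE//.
  transitivity (\int[Z]_w (\1_(trunc n @^-1` C) w)%:E)%E.
    by apply: eq_integral => w _; rewrite /= diracE indicE.
  rewrite integral_indic// ?setIT//.
  by rewrite -[X in measurable X]setTI; exact: measurable_truncW.
transitivity (P (trunc n @^-1` C)); first exact: kE.
transitivity (resample n 0 w0 (trunc n @^-1` C)); last exact: esym (kE _).
apply: PE.
  by rewrite -[X in measurable X]setTI; exact: measurable_truncW.
move=> w w' ww' /=; congr (C _); apply/funext => k; rewrite /trunc.
by case: ltnP => // kn; exact: ww'.
Qed.

Theorem trajectory_law_step (w0 : W) : exists P : probability W R,
  forall n H C, measurable H -> determined n H -> measurable C ->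
    (P (H `&` [set w | C (w n)]) = \int[P]_(w in H) kap n w C)%E.
Proof.
have [P PE] := trajectory_law w0; exists P => n H C mH dH mC.
have mHC : measurable (H `&` [set w | C (w n)] : set W).
  apply: measurableI => //; rewrite -[X in measurable X]setTI.
  exact: (@measurable_coord n measurableT C mC).
have dHC : determined n.+1 (H `&` [set w | C (w n)] : set W).
  apply: determinedI; first exact: determinedW dH.
  by move=> w w' ww' /=; rewrite ww'.
rewrite (PE _ n.+1)// resample_last// add0n.
rewrite [RHS]integral_mkcond (@integral_trajectory P w0 n)//; first last.
- move=> w w' ww'; rewrite !patchE (kdet ww').
  suff -> : (w \in H) = (w' \in H) by [].
  apply: eq_in_set; apply/propext; split; apply: dH => // k kn; by rewrite ww'.
- by move=> w; rewrite patchE; case: ifP => // _; exact: measure_ge0.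
- by apply/(measurable_restrictT _ mH); apply: measurable_funTS; exact: kk.
apply: eq_integral => w _; rewrite resampleS// patchE.
transitivity (\int[kap n w]_s ((\1_H w)%:E * (\1_C s)%:E))%E.
  apply: eq_integral => s _; rewrite /= diracE -EFinM !indicE.
  have -> : (upd w n s \in H `&` [set w | C (w n)]) = (w \in H) && (s \in C).
    rewrite in_setI; congr (_ && _); apply: eq_in_set.
      exact: determined_upd (leqnn n) dH.
    by rewrite /= (_ : upd w n s n = s)// /upd eqxx.
  by case: (w \in H); case: (s \in C); rewrite /= ?mulr0 ?mul0r ?mulr1.
rewrite ge0_integralZl//; last first.
  by apply/measurable_EFinP; exact: measurable_indic.
rewrite integral_indic// setIT indicE.
by case: (w \in H); rewrite ?mul1e ?mul0e.
Qed.

End ionescu_tulcea.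

(** * The law of the game *)

Section law_of_the_game.
Context (R : realType) (E A B : ptopologicalType) (G : game R E A B).
Let SS := (borel E * borel A * borel B)%type.
Let W := traj E A B.

Lemma transition_probability_ex (z : SS) :
  exists P : probability (borel E) R, (P : set (borel E) -> \bar R) = Q G z.
Proof.
apply: probability_ex; first exact: measure0.
- by move=> U; exact: measure_ge0.
- exact: measure_semi_sigma_additive.
- exact: prob_kernel.
Qed.

(** The transition law packed as a [probability], the form in which [kernel_bind] takes it. *)
Definition Qp (z : SS) : probability (borel E) R :=
  projT1 (cid (transition_probability_ex z)).

Lemma QpE z : (Qp z : set (borel E) -> \bar R) = Q G z.
Proof. exact: (projT2 (cid (transition_probability_ex z))). Qed.

Lemma is_kernel_Qp : is_kernel Qp.
Proof.
move=> U mU; rewrite (_ : (fun z => _) = fun z => Q G z U).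
  exact: measurable_kernel.
by apply/funext => z; rewrite QpE.
Qed.

Lemma integral_Qp z (f : borel E -> \bar R) :
  (\int[Qp z]_x f x = \int[Q G z]_x f x)%E.
Proof. by rewrite -QpE. Qed.

Variables (f : nat -> E -> probability (borel A) R)
  (g : nat -> E -> probability (borel B) R).
Hypothesis kf : forall n, @is_kernel _ _ (borel E) (borel A) R (f n).
Hypothesis kg : forall n, @is_kernel _ _ (borel E) (borel B) R (g n).

Let dir3 (x : borel E) (a : borel A) (b : borel B) : probability SS R := \d_(x, a, b).

Definition play (n : nat) (x : borel E) : probability SS R :=
  kernel_bind (f n x) (fun a => kernel_bind (g n x) (dir3 x a)).

Let is_kernel_dir3 (x : borel E) a : is_kernel (dir3 x a).
Proof. exact: (@is_kernel_dirac _ _ _ SS R _ (measurable_pair1 (x, a))). Qed.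

Let is_kernel_play2 n : @is_kernel _ _ (borel E * borel A)%type SS R
  (fun z => kernel_bind (g n z.1) (dir3 z.1 z.2)).
Proof.
apply: (@is_kernel_bind _ _ _ (borel E * borel A)%type (borel B) SS R
  (fun z => g n z.1) (fun y => \d_(y.1.1, y.1.2, y.2))).
  exact: is_kernel_comp measurable_fst (kg n).
apply: (@is_kernel_dirac _ _ (borel E * borel A * borel B)%type SS R
  (fun y => (y.1.1, y.1.2, y.2))).
do 2 (apply: measurable_fun_pair => //); try exact: measurableT_comp.
Qed.

Let is_kernel_play2x n (x : borel E) :
  is_kernel (fun a => kernel_bind (g n x) (dir3 x a)).
Proof.
by move=> U mU; exact: (measurableT_comp (@is_kernel_play2 n U mU) (measurable_pair1 x)).
Qed.

Lemma is_kernel_play n : is_kernel (play n).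
Proof.
exact: (is_kernel_bind (kf n) (k := fun z : borel E * borel A =>
  kernel_bind (g n z.1) (dir3 z.1 z.2))).
Qed.

Lemma integral_play n x (h : SS -> \bar R) : (forall s, 0 <= h s)%E ->
  measurable_fun setT h ->
  (\int[play n x]_s h s = \int[f n x]_a \int[g n x]_b h (x, a, b))%E.
Proof.
move=> h0 mh; rewrite integral_kernel_bind//.
apply: eq_integral => a _; rewrite integral_kernel_bind//.
by apply: eq_integral => b _; rewrite integral_dirac// diracT mul1e.
Qed.

Lemma integral_play_rect n x (c : \bar R) (U : set (borel A)) (V : set (borel B)) :
  (0 <= c)%E -> measurable U -> measurable V ->
  (\int[f n x]_a \int[g n x]_b (c * (\1_U a)%:E * (\1_V b)%:E) =
   c * (f n x U * g n x V))%E.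
Proof.
move=> c0 mU mV.
have mIU : measurable_fun [set: borel A] (fun a => (\1_U a)%:E : \bar R).
  by apply/measurable_EFinP; exact: measurable_indic.
have mIV : measurable_fun [set: borel B] (fun b => (\1_V b)%:E : \bar R).
  by apply/measurable_EFinP; exact: measurable_indic.
transitivity (\int[f n x]_a ((c * g n x V) * (\1_U a)%:E))%E.
  apply: eq_integral => a _; rewrite ge0_integralZl//; last by rewrite mule_ge0.
  by rewrite integral_indic// setIT muleAC.
by rewrite ge0_integralZl ?mule_ge0// integral_indic// setIT -muleA (muleC (g n x V)).
Qed.

Lemma integral_play_mul n x (psi : borel E -> \bar R) (U : set (borel A))
    (V : set (borel B)) : (forall y, 0 <= psi y)%E -> measurable_fun setT psi ->
  measurable U -> measurable V ->
  (\int[play n x]_s (psi s.1.1 * (\1_U s.1.2)%:E * (\1_V s.2)%:E) =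
   psi x * (f n x U * g n x V))%E.
Proof.
move=> psi0 mpsi mU mV; rewrite -integral_play_rect// integral_play//.
  by move=> s; rewrite !mule_ge0// lee_fin.
have m1 : measurable_fun [set: SS] (fun s : SS => s.1.1) by exact: measurableT_comp.
have m2 : measurable_fun [set: SS] (fun s : SS => s.1.2) by exact: measurableT_comp.
apply: emeasurable_funM; first apply: emeasurable_funM.
- exact: (measurableT_comp mpsi m1).
- apply/measurable_EFinP; exact: (measurableT_comp (measurable_indic mU) m2).
- apply/measurable_EFinP; exact: (measurableT_comp (measurable_indic mV) measurable_snd).
Qed.

(** A coordinate of the trajectory is a whole triple of state and actions, so a step first draws the
    state: from the initial Dirac mass at time 0, from the preceding triple later. *)
Definition next_state (x : E) (n : nat) (w : W) : probability (borel E) R :=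
  if n is n'.+1 then Qp (w n') else \d_(x : borel E).

Lemma is_kernel_next_state x n : is_kernel (next_state x n).
Proof.
case: n => [|n]; first exact: is_kernel_cst.
exact: is_kernel_comp (@measurable_coord E A B n) is_kernel_Qp.
Qed.

Definition transition (x : E) (n : nat) (w : W) : probability SS R :=
  kernel_bind (next_state x n w) (play n).

Lemma is_kernel_transition x n : is_kernel (transition x n).
Proof.
apply: (is_kernel_bind (@is_kernel_next_state x n) (k := fun z => play n z.2)).
exact: is_kernel_comp measurable_snd (@is_kernel_play n).
Qed.

Lemma transition_det x n (w w' : W) : (forall k, (k < n)%N -> w k = w' k) ->
  transition x n w = transition x n w'.
Proof.
case: n => [|n] h; rewrite /transition //; congr kernel_bind.
by rewrite /= h.
Qed.

Lemma measurable_X n : measurable_fun [set: W] (X_ n : W -> borel E).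
Proof.
exact: (measurableT_comp measurable_fst
  (measurableT_comp measurable_fst (@measurable_coord E A B n))).
Qed.

Lemma history_before_actionP n (H : set W) : history_before_action n H ->
  measurable H /\
  forall w w', (forall k, (k < n)%N -> w k = w' k) -> X_ n w = X_ n w' -> H w -> H w'.
Proof.
move: H; apply: smallest_sub => /=.
  split.
  - by split.
  - move=> H [mH dH]; rewrite setTD; split; first exact: measurableC.
    by move=> w w' ww' xx' nHw Hw'; apply/nHw/(dH w') => // k kn; rewrite ww'.
  - move=> F dF; split; first by apply: bigcup_measurable => k _; exact: (dF k).1.
    by move=> w w' ww' xx' [k _ Fk]; exists k => //; exact: (dF k).2 Fk.
move=> H [[k kn [C mC <-]]|[C mC <-]]; split.
- rewrite -[X in measurable X]setTI; exact: (@measurable_coord E A B k measurableT C mC).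
- by move=> w w' ww' _ /=; rewrite ww'.
- rewrite -[X in measurable X]setTI; exact: (@measurable_X n measurableT C mC).
- by move=> w w' _ /= ->.
Qed.

Lemma history_determined n (H : set W) : history n H ->
  measurable H /\ determined n.+1 H.
Proof.
move=> hH; split; last exact: determined_history.
exact: cylinders_sub hH.
Qed.

(** The action clause conditions on X_n, which sits in the same coordinate as A_n and B_n. So
    coordinate n is disintegrated over the first n coordinates, and the event H is kept as a
    function of these and of X_n. *)
Lemma law_exists (x : E) : exists P, is_law G f g x P.
Proof.
have [P PE] := trajectory_law_step (@is_kernel_transition x) (@transition_det x) (point : W).
have mrect (C : set (borel E)) : measurable C ->
    measurable ([set s : SS | C s.1.1]).
  move=> mC; rewrite -[X in measurable X]setTI.
  by apply: (measurableT_comp measurable_fst measurable_fst).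
have transX n w (C : set (borel E)) : measurable C ->
    transition x n w [set s | C s.1.1] = next_state x n w C.
  move=> mC; rewrite kernel_bindE//; [|exact: is_kernel_play|exact: mrect].
  transitivity (\int[next_state x n w]_x' (\1_C x')%:E)%E; last first.
    by rewrite integral_indic// setIT.
  apply: eq_integral => x' _.
  have := @integral_play_mul n x' (fun y => (\1_C y)%:E) setT setT.
  rewrite [f n x' setT]probability_setT [g n x' setT]probability_setT !mule1 => <-//.
    transitivity (\int[play n x']_s (\1_[set s : SS | C s.1.1] s)%:E)%E.
      by rewrite integral_indic// ?setIT//; exact: mrect.
    by apply: eq_integral => s _; rewrite !indicE !in_setT !mule1.
  by apply/measurable_EFinP; exact: measurable_indic.
exists P; split.
- move=> C mC; have := PE 0%N setT _ measurableT _ (mrect C mC).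
  rewrite setTI => ->//.
  under eq_integral do rewrite transX//.
  transitivity (\d_(x : borel E) C * P setT)%E; first exact: integral_cst.
  by rewrite [X in (_ * X)%E](_ : _ = 1%E) ?mule1//; exact: probability_setT.
- move=> n H U V /history_before_actionP[mH dH] mU mV.
  pose Gn := @cylinders E A B [set k | (k < n)%N]; pose WG := g_sigma_algebraType Gn.
  (* Rebuilds from the first n coordinates and a state a trajectory with default actions; membership
     in [H] cannot tell it from the original one. *)
  pose glue (w : WG) (y : borel E) : W := upd (trunc n w) n (y, point, point).
  have mglue : measurable_fun setT (fun z : WG * borel E => glue z.1 z.2).
    have mp : measurable_fun setT
        (fun z : WG * borel E => (trunc n z.1, (z.2, point, point) : SS)).
      apply: measurable_fun_pair.
        exact: (measurableT_comp (@measurable_trunc E A B n) measurable_fst).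
      by do 2 (apply: measurable_fun_pair => //).
    exact: (measurableT_comp (@measurable_upd E A B n) mp).
  have HE w : H w = H (glue w (X_ n w)).
    have h1 k : (k < n)%N -> w k = glue w (X_ n w) k.
      by move=> kn; rewrite /glue /upd /trunc ltn_eqF// kn.
    have h2 : X_ n w = X_ n (glue w (X_ n w)) by rewrite {2}/X_ /glue /upd eqxx.
    by apply/propext; split; apply: dH => // k kn; rewrite -h1.
  have mHg : measurable_fun setT (fun z : WG * borel E => (\1_H (glue z.1 z.2))%:E : \bar R).
    by apply/measurable_EFinP; exact: (measurableT_comp (measurable_indic mH) mglue).
  have subG : Gn `<=` (measurable : set (set W)).
    by move=> C cC; apply: (@cylinders_sub E A B [set k | (k < n)%N]); exact: sub_sigma_algebra.
  have kG : @is_kernel _ _ WG SS R (transition x n).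
    rewrite (_ : transition x n = transition x n \o trunc n).
      exact: is_kernel_comp (@measurable_trunc E A B n) (@is_kernel_transition x n).
    apply/funext => w /=; apply: transition_det => k kn; by rewrite /trunc kn.
  have PZ C D : <<s Gn >> C -> measurable D ->
      (P (C `&` (fun w : W => w n) @^-1` D) = \int[P]_(w in C) transition x n w D)%E.
    by move=> cC mD; apply: PE => //; [exact: cylinders_sub cC|exact: determined_history].
  have dis := @disintegration _ _ W SS R P Gn (fun w => w n) (transition x n)
    subG (@measurable_coord E A B n) kG PZ.
  pose phi c (z : WG * SS) : \bar R :=
    ((\1_H (glue z.1 z.2.1.1))%:E * c z.2)%E.
  have s1 : measurable_fun [set: SS] (fun s : SS => s.1.1 : borel E) by exact: measurableT_comp.
  have s2 : measurable_fun [set: SS] (fun s : SS => s.1.2 : borel A) by exact: measurableT_comp.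
  have mphi c : measurable_fun setT c -> measurable_fun setT (phi c).
    move=> mc; apply: emeasurable_funM; last exact: (measurableT_comp mc).
    have mp : measurable_fun setT (fun z : WG * SS => (z.1, z.2.1.1 : borel E)).
      by apply: measurable_fun_pair => //; exact: (measurableT_comp s1 measurable_snd).
    exact: (measurableT_comp mHg mp).
  pose c1 (s : SS) : \bar R := ((\1_U s.1.2)%:E * (\1_V s.2)%:E)%E.
  pose c2 (s : SS) : \bar R := (f n s.1.1 U * g n s.1.1 V)%E.
  have mc1 : measurable_fun setT c1.
    apply: emeasurable_funM; apply/measurable_EFinP.
      exact: (measurableT_comp (measurable_indic mU) s2).
    exact: (measurableT_comp (measurable_indic mV) measurable_snd).
  have mc2' : measurable_fun [set: borel E] (fun y => f n y U * g n y V)%E.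
    by apply: emeasurable_funM; [exact: kf|exact: kg].
  have mc2 : measurable_fun setT c2 by exact: (measurableT_comp mc2' s1).
  have phi0 c z : (forall s, 0 <= c s)%E -> (0 <= phi c z)%E.
    by move=> c0; rewrite mule_ge0// lee_fin.
  have c10 s : (0 <= c1 s)%E by rewrite mule_ge0// lee_fin.
  have c20 s : (0 <= c2 s)%E by rewrite mule_ge0.
  (* Under one transition, the indicators of the two actions may be replaced by their conditional
     probabilities given the state. *)
  have eqphi w : (\int[transition x n w]_s phi c1 (w, s) =
                  \int[transition x n w]_s phi c2 (w, s))%E.
    rewrite !integral_kernel_bind//; first last.
    - by apply: (measurableT_comp (mphi c1 mc1)); exact: measurable_pair1.
    - by move=> s; exact: phi0.
    - exact: is_kernel_play.
    - by apply: (measurableT_comp (mphi c2 mc2)); exact: measurable_pair1.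
    - by move=> s; exact: phi0.
    - exact: is_kernel_play.
    apply: eq_integral => y _.
    have mH1 : measurable_fun [set: borel E] (fun y => (\1_H (glue w y))%:E : \bar R).
      exact: (measurableT_comp mHg (measurable_pair1 (w : WG))).
    under eq_integral do rewrite /phi /c1 /= muleA.
    rewrite (@integral_play_mul n y (fun y => (\1_H (glue w y))%:E))//.
    have := @integral_play_mul n y (fun y => (\1_H (glue w y))%:E * (f n y U * g n y V))%E
      setT setT.
    rewrite [f n y setT]probability_setT [g n y setT]probability_setT !mule1 => <-//.
    - by apply: eq_integral => s _; rewrite !indicE !in_setT !mule1.
    - by move=> ?; rewrite !mule_ge0.
    - exact: emeasurable_funM.
  transitivity (\int[P]_w phi c1 (w, w n))%E.
    have mHUV : measurable (H `&` (A_ n @^-1` U `&` B_ n @^-1` V) : set W).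
      apply: measurableI => //; apply: measurableI; rewrite -[X in measurable X]setTI.
        exact: (measurableT_comp s2 (@measurable_coord E A B n)).
      exact: (measurableT_comp measurable_snd (@measurable_coord E A B n)).
    rewrite -[X in P X]setIT -integral_indic//.
    apply: eq_integral => w _; rewrite /phi /c1 /= -!EFinM !indicE !in_setI mulrA.
    congr (_%:E); rewrite -(eq_in_set (HE w)).
    have -> : (w \in A_ n @^-1` U) = ((w n).1.2 \in U) by exact: eq_in_set.
    have -> : (w \in B_ n @^-1` V) = ((w n).2 \in V) by exact: eq_in_set.
    by case: (_ \in H); case: (_ \in U); case: (_ \in V); rewrite /= ?(mul0r, mulr0, mulr1).
  rewrite dis//; [|by move=> z; exact: phi0|exact: mphi].
  under eq_integral do rewrite eqphi.
  rewrite -dis//; [|by move=> z; exact: phi0|exact: mphi].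
  rewrite [RHS]integral_mkcond; apply: eq_integral => w _.
  rewrite patchE /phi /c2 /= indicE -(eq_in_set (HE w)).
  by case: (_ \in H); rewrite ?mul1e ?mul0e.
- move=> n H C /history_determined[mH dH] mC.
  rewrite (PE n.+1 H [set s : SS | C s.1.1])//; last exact: mrect.
  apply: eq_integral => w _; rewrite transX//= /X_ /A_ /B_.
  by case: (w n) => [[? ?] ?]; rewrite QpE.
Qed.

End law_of_the_game.

(** A Dynkin-class argument. It is needed because the action clause of [is_law] speaks of rectangles
    only, whereas payoffs depend on both actions jointly. *)
Lemma disintegration_rect d d1 d2 (W : measurableType d) (S1 : measurableType d1)
    (S2 : measurableType d2) (R : realType) (P : probability W R) (H : set W)
    (Z : W -> S1 * S2) (k : W -> probability (S1 * S2)%type R) :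
  measurable H -> measurable_fun setT Z -> is_kernel k ->
  (forall U V, measurable U -> measurable V ->
     P (H `&` Z @^-1` (U `*` V)) = \int[P]_(w in H) k w (U `*` V))%E ->
  forall C, measurable C -> (P (H `&` Z @^-1` C) = \int[P]_(w in H) k w C)%E.
Proof.
move=> mH mZ kk rect C mC.
have mZC D : measurable D -> measurable (Z @^-1` D).
  by move=> mD; rewrite -[X in measurable X]setTI; exact: mZ.
pose Pr D := (P (H `&` Z @^-1` D) = \int[P]_(w in H) k w D)%E.
rewrite -/(Pr C); move: mC; rewrite measurable_prod_measurableType.
have PT : Pr setT by have := rect setT setT measurableT measurableT; rewrite setXTT.
apply: (@dynkin_induction _ (S1 * S2)%type [set A `*` B | A in measurable & B in measurable]).
- exact: measurable_prod_measurableType.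
- move=> _ _ [U mU [V mV <-]] [U' mU' [V' mV' <-]].
  exists (U `&` U'); first exact: measurableI.
  by exists (V `&` V'); [exact: measurableI|rewrite setXI].
- exact: PT.
- by move=> _ [U mU [V mV <-]]; exact: rect.
- move=> D mD PD; rewrite /Pr.
  have finH : P (H `&` Z @^-1` D) \is a fin_num.
    by rewrite fin_num_measure//; apply: measurableI => //; exact: mZC.
  rewrite -[LHS](addeK _ finH) -[RHS](addeK _ finH); congr (_ - _)%E.
  rewrite [in RHS]PD -ge0_integralD//; last 2 first.
  + by apply: measurable_funTS; apply: kk; exact: measurableC.
  + by apply: measurable_funTS; exact: kk.
  transitivity (P (H `&` Z @^-1` setT)).
    rewrite preimage_setT setIT [RHS](measureDI P mH (mZC _ mD)).
    by rewrite setDE preimage_setC.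
  rewrite PT; apply: eq_integral => w _.
  by rewrite (measureDI (k w) measurableT mD) setTD setTI.
- move=> F mF tF PF; rewrite /Pr.
  rewrite preimage_bigcup setI_bigcupr measure_semi_bigcup//; last 3 first.
  + by move=> i; apply: measurableI => //; exact: mZC.
  + by move=> i j _ _ [w [[_ wi] [_ wj]]]; apply: tF => //; exists (Z w).
  + by apply: bigcup_measurable => i _; apply: measurableI => //; exact: mZC.
  rewrite (eq_eseriesr (fun i _ => PF i)) -integral_nneseries//.
    apply: eq_integral => w _; rewrite measure_semi_bigcup//.
    exact: bigcup_measurable.
  by move=> n; apply: measurable_funTS; exact: kk.
Qed.

Section one_step.
Context (R : realType) (E A B : ptopologicalType) (G : game R E A B).
Let SS := (borel E * borel A * borel B)%type.
Let W := traj E A B.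
Variables (f : nat -> E -> probability (borel A) R)
  (g : nat -> E -> probability (borel B) R).
Hypothesis kf : forall n, @is_kernel _ _ (borel E) (borel A) R (f n).
Hypothesis kg : forall n, @is_kernel _ _ (borel E) (borel B) R (g n).
Variables (x : E) (P : probability W R).
Hypothesis lawP : is_law G f g x P.

Definition pair_law n (y : borel E) : probability (borel A * borel B)%type R :=
  kernel_bind (f n y) (fun a : borel A => kernel_bind (g n y)
    (fun b : borel B => \d_(a, b) : probability (borel A * borel B)%type R)).

Let past n : set (set W) := @cylinders E A B [set k | (k < n)%N].

(** Integrates out the state at time n + 1 given the triples up to time n. The weight [c] depends on
    the first n triples only, so that [law_actions] can integrate out the actions of time n
    afterwards. *)
Lemma law_next_state n (c : W -> \bar R) (rho : SS -> \bar R) (v : borel E -> \bar R) :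
  (forall w, 0 <= c w)%E -> measurable_fun setT (c : g_sigma_algebraType (past n) -> \bar R) ->
  (forall s, 0 <= rho s)%E -> measurable_fun setT rho ->
  (forall y, 0 <= v y)%E -> measurable_fun setT v ->
  (\int[P]_w (c w * rho (w n) * v (X_ n.+1 w)) =
   \int[P]_w (c w * (rho (w n) * \int[Qp G (w n)]_y v y)))%E.
Proof.
move=> c0 mc rho0 mrho v0 mv.
pose Gn := @cylinders E A B [set k | (k <= n)%N]; pose WG := g_sigma_algebraType Gn.
have subG : Gn `<=` (measurable : set (set W)).
  by move=> C cC; apply: (@cylinders_sub E A B [set k | (k <= n)%N]); exact: sub_sigma_algebra.
have mn : measurable_fun setT (fun w : WG => w n : SS).
  move=> _ C mC; rewrite setTI; apply: sub_sigma_algebra.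
  by exists n => //=; exists C.
have mcW : measurable_fun setT (c : WG -> \bar R).
  move=> _ C mC; have := mc measurableT C mC; rewrite !setTI.
  apply: (@sub_sigma_algebra2 _ setT Gn (past n)) => D [k kn kD].
  by exists k => //=; exact: ltnW.
have kG : @is_kernel _ _ WG (borel E) R (fun w : WG => Qp G (w n)).
  exact: is_kernel_comp mn (@is_kernel_Qp R E A B G).
have [_ _ law3] := lawP.
have PZ C D : <<s Gn >> C -> measurable D ->
    (P (C `&` (X_ n.+1 : W -> borel E) @^-1` D) = \int[P]_(w in C) Qp G (w n) D)%E.
  move=> hC mD; rewrite law3//; apply: eq_integral => w _.
  by rewrite QpE /X_ /A_ /B_; case: (w n) => [[? ?] ?].
have := @disintegration _ _ W (borel E) R P Gn (X_ n.+1) (fun w => Qp G (w n))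
  subG (@measurable_X E A B n.+1) kG PZ (fun z => c z.1 * rho (z.1 n) * v z.2)%E.
move=> -> /=.
- apply: eq_integral => w _; rewrite muleA ge0_integralZl//.
  by rewrite mule_ge0.
- by move=> z; rewrite !mule_ge0.
- apply: emeasurable_funM; last exact: (measurableT_comp mv measurable_snd).
  apply: emeasurable_funM; first exact: (measurableT_comp mcW measurable_fst).
  exact: (measurableT_comp mrho (measurableT_comp mn measurable_fst)).
Qed.

Lemma law_actions n (c : W -> \bar R) (rho : SS -> \bar R) :
  (forall w, 0 <= c w)%E -> measurable_fun setT (c : g_sigma_algebraType (past n) -> \bar R) ->
  (forall s, 0 <= rho s)%E -> measurable_fun setT rho ->
  (\int[P]_w (c w * rho (w n)) =
   \int[P]_w (c w * \int[f n (X_ n w)]_a \int[g n (X_ n w)]_b rho (X_ n w, a, b)))%E.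
Proof.
move=> c0 mc rho0 mrho.
pose Gn : set (set W) := @cylinders E A B [set k | (k < n)%N] `|`
  [set X_ n @^-1` C | C in @measurable _ (borel E)].
pose WG := g_sigma_algebraType Gn.
have mX : measurable_fun setT (X_ n : WG -> borel E).
  by move=> _ C mC; rewrite setTI; apply: sub_sigma_algebra; right; exists C.
have subG : Gn `<=` (measurable : set (set W)).
  move=> C GC; apply: (@history_before_actionP E A B n C _).1.
  exact: sub_sigma_algebra.
have mcW : measurable_fun setT (c : WG -> \bar R).
  move=> _ C mC; have := mc measurableT C mC; rewrite !setTI.
  by apply: (@sub_sigma_algebra2 _ setT Gn (past n)) => D cD; left.
have kd1 (a : borel A) : is_kernel
    (fun b : borel B => \d_(a, b) : probability (borel A * borel B)%type R).
  exact: (@is_kernel_dirac _ _ _ _ R _ (measurable_pair1 a)).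
have kd : is_kernel (fun z : borel E * borel A => kernel_bind (g n z.1)
    (fun b : borel B => \d_(z.2, b) : probability (borel A * borel B)%type R)).
  apply: (@is_kernel_bind _ _ _ (borel E * borel A)%type (borel B) _ R
    (fun z => g n z.1) (fun y => \d_(y.1.2, y.2))).
    exact: is_kernel_comp measurable_fst (kg n).
  apply: (@is_kernel_dirac _ _ (borel E * borel A * borel B)%type _ R
    (fun y => (y.1.2, y.2))).
  by apply: measurable_fun_pair => //; exact: measurableT_comp.
have kdy (y : borel E) : is_kernel (fun a : borel A => kernel_bind (g n y)
    (fun b : borel B => \d_(a, b) : probability (borel A * borel B)%type R)).
  by move=> U mU; exact: (measurableT_comp (kd U mU) (measurable_pair1 y)).
have kpl : is_kernel (pair_law n).
  exact: (is_kernel_bind (kf n) kd).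
have kG : @is_kernel _ _ WG _ R (fun w : WG => pair_law n (X_ n w)).
  exact: is_kernel_comp mX kpl.
have plE y (h : borel A * borel B -> \bar R) : (forall s, 0 <= h s)%E ->
    measurable_fun setT h ->
    (\int[pair_law n y]_s h s = \int[f n y]_a \int[g n y]_b h (a, b))%E.
  move=> h0 mh; rewrite integral_kernel_bind//.
  apply: eq_integral => a _; rewrite integral_kernel_bind//.
  by apply: eq_integral => b _; rewrite integral_dirac// diracT mul1e.
have plR y U V : measurable U -> measurable V ->
    pair_law n y (U `*` V) = (f n y U * g n y V)%E.
  move=> mU mV.
  transitivity (\int[pair_law n y]_s (\1_(U `*` V) s)%:E)%E.
    by rewrite integral_indic ?setIT//; exact: measurableX.
  rewrite plE//; last first.
    by apply/measurable_EFinP; apply: measurable_indic; exact: measurableX.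
  have := integral_play_rect f g n y lee01 mU mV; rewrite mul1e => <-.
  apply: eq_integral => a _; apply: eq_integral => b _.
  by rewrite mul1e -EFinM !indicE in_setX/=; case: (a \in U); case: (b \in V); rewrite ?(mul0r, mul1r).
have [_ law2 _] := lawP.
have mZ : measurable_fun [set: W] (fun w : W => (A_ n w : borel A, B_ n w : borel B)).
  apply: measurable_fun_pair.
    exact: (measurableT_comp measurable_snd (measurableT_comp measurable_fst (@measurable_coord E A B n))).
  exact: (measurableT_comp measurable_snd (@measurable_coord E A B n)).
have PZ C D : <<s Gn >> C -> measurable D ->
    (P (C `&` (fun w : W => (A_ n w : borel A, B_ n w : borel B)) @^-1` D) =
     \int[P]_(w in C) pair_law n (X_ n w) D)%E.
  move=> hC; apply: (disintegration_rect (history_before_actionP hC).1 mZ).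
    exact: is_kernel_comp (@measurable_X E A B n) kpl.
  move=> U V mU mV; under eq_integral do rewrite plR//.
  exact: law2.
have dis := @disintegration _ _ W _ R P Gn (fun w : W => (A_ n w : borel A, B_ n w : borel B))
  (fun w => pair_law n (X_ n w)) subG mZ kG PZ.
have ms : measurable_fun setT (fun z : WG * (borel A * borel B) =>
    (X_ n z.1 : borel E, z.2.1, z.2.2)).
  apply: measurable_fun_pair; last exact: (measurableT_comp measurable_snd measurable_snd).
  apply: measurable_fun_pair; last exact: (measurableT_comp measurable_fst measurable_snd).
  exact: (measurableT_comp mX measurable_fst).
transitivity (\int[P]_w (fun z : WG * (borel A * borel B) =>
    c z.1 * rho (X_ n z.1, z.2.1, z.2.2)) (w, (A_ n w, B_ n w)))%E.
  by apply: eq_integral => w _; rewrite /= /X_ /A_ /B_; case: (w n) => [[? ?] ?].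
rewrite (dis (fun z => c z.1 * rho (X_ n z.1, z.2.1, z.2.2))%E); first last.
- apply: emeasurable_funM; first exact: (measurableT_comp mcW measurable_fst).
  exact: (measurableT_comp mrho ms).
- by move=> z; rewrite mule_ge0.
have mrw y : measurable_fun setT (fun s : borel A * borel B => rho (y, s.1, s.2)).
  apply: (measurableT_comp mrho).
  by do 2 (apply: measurable_fun_pair => //).
apply: eq_integral => w _ /=; rewrite ge0_integralZl//.
by rewrite (plE _ (fun s => rho (X_ n w, s.1, s.2))).
Qed.

End one_step.

(** * Verification: comparing a family of value functions with the expected total payoff *)

Section verification.
Context (R : realType) (E A B : ptopologicalType) (G : game R E A B).
Let SS := (borel E * borel A * borel B)%type.
Let W := traj E A B.
Variables (f : nat -> E -> probability (borel A) R)
  (g : nat -> E -> probability (borel B) R).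
Hypothesis kf : forall n, @is_kernel _ _ (borel E) (borel A) R (f n).
Hypothesis kg : forall n, @is_kernel _ _ (borel E) (borel B) R (g n).
Variables (x : E) (P : probability W R).
Hypothesis lawP : is_law G f g x P.
Variables (beta gamma : R).
Hypothesis beta01 : 0 < beta < 1.
Hypothesis gamma0 : 0 < gamma.
Let c := rbar G / (1 - beta).

Definition partial_reward (n : nat) (w : W) : R :=
  \sum_(0 <= k < n) beta ^+ k * r G (w k).

Let r0 z : 0 <= r G z. Proof. by have /andP[] := r_bounded G z. Qed.
Let rb z : r G z <= rbar G. Proof. by have /andP[] := r_bounded G z. Qed.
Let b0 : 0 < beta. Proof. by case/andP: beta01. Qed.
Let b1 : 0 < 1 - beta. Proof. by rewrite subr_gt0; case/andP: beta01. Qed.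
Let c0 : 0 <= c.
Proof. by rewrite divr_ge0 ?(ltW b1)// (le_trans (r0 point))// rb. Qed.

(** c (beta^n - beta^(n + j)) is the sum of beta^k rbar over n <= k < n + j. *)
Lemma partial_reward_tail n j w :
  partial_reward n w <= partial_reward (n + j) w <=
    partial_reward n w + c * (beta ^+ n - beta ^+ (n + j)).
Proof.
elim: j => [|j /andP[IH1 IH2]]; first by rewrite addn0 subrr mulr0 addr0 lexx.
rewrite addnS /partial_reward big_nat_recr//= -/(partial_reward (n + j) w).
have bj : 0 < beta ^+ (n + j) by rewrite exprn_gt0.
have h1 : 0 <= beta ^+ (n + j) * r G (w (n + j)%N) by rewrite mulr_ge0// ltW.
have h2 : beta ^+ (n + j) * r G (w (n + j)%N) <= beta ^+ (n + j) * rbar G.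
  by rewrite ler_pM2l.
have -> : c * (beta ^+ n - beta ^+ (n + j).+1) =
    c * (beta ^+ n - beta ^+ (n + j)) + beta ^+ (n + j) * rbar G.
  by rewrite exprS /c; field; rewrite lt0r_neq0.
by apply/andP; split; [rewrite (le_trans IH1)// lerDl|rewrite addrA lerD].
Qed.

Lemma total_rewardE w :
  total_reward G beta w = limn (fun n => partial_reward n w).
Proof.
rewrite /total_reward; congr (lim (_ @ \oo)); apply/funext => n.
rewrite /series /= /partial_reward; apply: eq_bigr => k _; congr (_ * r G _).
by rewrite /X_ /A_ /B_; case: (w k) => [[? ?] ?].
Qed.

Lemma total_reward_bounds n w :
  partial_reward n w <= total_reward G beta w <= partial_reward n w + c * beta ^+ n.
Proof.
have tail m : (n <= m)%N -> partial_reward n w <= partial_reward m w <=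
    partial_reward n w + c * beta ^+ n.
  move=> /subnKC <-; have /andP[-> h] /= := partial_reward_tail n (m - n) w.
  by rewrite (le_trans h)// lerD2l ler_wpM2l// gerBl exprn_ge0// ltW.
have cv : cvgn (fun n => partial_reward n w).
  apply: nondecreasing_is_cvgn.
    move=> i j /subnKC <-; by have /andP[] := partial_reward_tail i (j - i) w.
  exists c => _ [m _ <-]; have /andP[_ h] := partial_reward_tail 0 m w.
  rewrite add0n expr0 [partial_reward 0 w]/partial_reward big_geq// add0r in h.
  apply: (le_trans h).
  by rewrite ler_piMr// gerBl exprn_ge0// ltW.
rewrite total_rewardE; apply/andP; split.
  by apply: limr_ge => //; exists n => // m /= /tail /andP[].
by apply: limr_le => //; exists n => // m /= /tail /andP[].
Qed.

Let past n : set (set W) := @cylinders E A B [set k | (k < n)%N].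

Lemma measurable_partial_reward n m : (m <= n)%N ->
  measurable_fun setT (partial_reward m : g_sigma_algebraType (past n) -> R).
Proof.
move=> mn; rewrite /partial_reward; elim: m mn => [|m IH] mn.
  by under eq_fun do rewrite big_geq//; exact: measurable_cst.
under eq_fun do rewrite big_nat_recr//=.
apply: measurable_funD; first by apply: IH; exact: ltnW.
apply: measurable_funM; first exact: measurable_cst.
have mc : measurable_fun setT (fun w : g_sigma_algebraType (past n) => w m : SS).
  move=> _ C mC; rewrite setTI; apply: sub_sigma_algebra.
  by exists m => //; exists C.
exact: (measurableT_comp (r_measurable G) mc).
Qed.

Lemma measurable_partial_rewardW n : measurable_fun [set: W] (partial_reward n).
Proof.
move=> mT C mC; have := @measurable_partial_reward n n (leqnn n) measurableT C mC.
rewrite !setTI; exact: (@cylinders_sub E A B [set k | (k < n)%N]).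
Qed.

Lemma measurable_total_reward : measurable_fun [set: W] (total_reward G beta).
Proof.
apply: (@measurable_fun_cvg _ W R setT partial_reward).
  exact: measurable_partial_rewardW.
move=> w _; apply/cvgrPdist_le => e e0.
have : c * beta ^+ n @[n --> \oo] --> c * 0.
  by apply: cvgMl_tmp; apply: cvg_expr; rewrite gtr0_norm//; case/andP: beta01.
rewrite mulr0 => /cvgrPdist_le/(_ e e0) [N _ h].
exists N => // n /= Nn; have /andP[h1 h2] := total_reward_bounds n w.
have := h n Nn; rewrite /= sub0r normrN ger0_norm; last first.
  by rewrite mulr_ge0// exprn_ge0// ltW.
by move=> hb; rewrite ger0_norm ?subr_ge0// (le_trans _ hb)// lerBlDl.
Qed.

Variable v : nat -> E -> R.
Hypothesis mv : forall n, measurable_fun [set: borel E] (v n : borel E -> R).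
Hypothesis v_bounds : forall n y, 1 <= v n y <= expR (gamma * beta ^+ n * c).

Definition one_step (n : nat) (y : E) : \bar R :=
  (\int[f n y]_a \int[g n y]_b ((expR (gamma * beta ^+ n * r G (y, a, b)))%:E *
     \int[Qp G (y, a, b)]_y' (v n.+1 y')%:E))%E.

Let stage n : \bar R := (\int[P]_w ((expR (gamma * partial_reward n w))%:E *
  (v n (X_ n w))%:E))%E.

Let v0 n y : 0 <= v n y. Proof. by have /andP[h _] := v_bounds n y; rewrite (le_trans ler01). Qed.

Let mexp n : measurable_fun setT (fun w : g_sigma_algebraType (past n) =>
  (expR (gamma * partial_reward n w))%:E : \bar R).
Proof.
apply/measurable_EFinP; apply: measurableT_comp => //.
by apply: measurable_funM => //; exact: measurable_partial_reward.
Qed.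

Let stageS n : stage n.+1 = (\int[P]_w ((expR (gamma * partial_reward n w))%:E *
  one_step n (X_ n w)))%E.
Proof.
pose rho (s : SS) : \bar R := (expR (gamma * beta ^+ n * r G s))%:E.
have mrho : measurable_fun setT rho.
  apply/measurable_EFinP; apply: measurableT_comp => //.
  by apply: measurable_funM => //; exact: r_measurable.
have rho0 s : (0 <= rho s)%E by rewrite lee_fin expR_ge0.
have mvE : measurable_fun [set: borel E] (fun y => (v n.+1 y)%:E : \bar R).
  by apply/measurable_EFinP; exact: mv.
have exp0 (w : W) : (0 <= (expR (gamma * partial_reward n w))%:E :> \bar R)%E.
  by rewrite lee_fin expR_ge0.
transitivity (\int[P]_w ((expR (gamma * partial_reward n w))%:E * rho (w n) *
    (v n.+1 (X_ n.+1 w))%:E))%E.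
  apply: eq_integral => w _; rewrite /rho /partial_reward big_nat_recr//= mulrDr expRD.
  by rewrite mulrA EFinM.
rewrite (law_next_state lawP exp0 (@mexp n) rho0 mrho (v := fun y => (v n.+1 y)%:E) _ mvE); last first.
  by move=> y; rewrite lee_fin.
rewrite (law_actions kf kg lawP exp0 (@mexp n)
  (rho := fun s => rho s * \int[Qp G s]_y (v n.+1 y)%:E)%E)//.
- by move=> s; rewrite mule_ge0// integral_ge0// => y _; rewrite lee_fin.
- apply: emeasurable_funM => //.
  apply: (@measurable_integral_kernel _ _ SS (borel E) R (Qp G) (fun z => (v n.+1 z.2)%:E)).
  + exact: is_kernel_Qp.
  + by move=> z; rewrite lee_fin.
  + exact: (measurableT_comp mvE measurable_snd).
Qed.

Let stage0 : stage 0 = (v 0 x)%:E.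
Proof.
have [law1 _ _] := lawP.
have mvE : measurable_fun [set: borel E] (fun y => (v 0 y)%:E : \bar R).
  by apply/measurable_EFinP; exact: mv.
have kX : is_kernel (fun w : W => \d_(X_ 0 w : borel E) : probability (borel E) R).
  exact: (@is_kernel_dirac _ _ W (borel E) R _ (@measurable_X E A B 0)).
transitivity (\int[kernel_bind P (fun w => \d_(X_ 0 w : borel E) : probability (borel E) R)]_y
    (v 0 y)%:E)%E.
  rewrite integral_kernel_bind//; last by move=> y; rewrite lee_fin.
  apply: eq_integral => w _.
  rewrite integral_dirac// diracT mul1e /partial_reward big_geq// mulr0 expR0.
  by rewrite mul1e.
transitivity (\int[\d_(x : borel E) : probability (borel E) R]_y (v 0 y)%:E)%E.
  apply: eq_measure_integral => C mC _.
  transitivity (P (X_ 0 @^-1` C)); last exact: law1.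
  transitivity (\int[P]_w (\d_(X_ 0 w : borel E) : probability (borel E) R) C)%E.
    exact: kernel_bindE.
  transitivity (\int[P]_w (\1_(X_ 0 @^-1` C) w)%:E)%E.
    by apply: eq_integral => w _; rewrite /= diracE indicE.
  rewrite integral_indic// ?setIT//.
  rewrite -[X in measurable X]setTI; exact: (@measurable_X E A B 0).
by rewrite integral_dirac// diracT mul1e.
Qed.

Let total := (\int[P]_w (expR (gamma * total_reward G beta w))%:E)%E.

Let mexpW n : measurable_fun [set: W] (fun w => (expR (gamma * partial_reward n w))%:E : \bar R).
Proof.
apply/measurable_EFinP; apply: measurableT_comp => //.
by apply: measurable_funM => //; exact: measurable_partial_rewardW.
Qed.

Let mtotal : measurable_fun [set: W] (fun w => (expR (gamma * total_reward G beta w))%:E : \bar R).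
Proof.
apply/measurable_EFinP; apply: measurableT_comp => //.
by apply: measurable_funM => //; exact: measurable_total_reward.
Qed.

Let mvX n : measurable_fun [set: W] (fun w => (v n (X_ n w))%:E : \bar R).
Proof. by apply/measurable_EFinP; exact: (measurableT_comp (mv n) (@measurable_X E A B n)). Qed.

(** With [total_le], this keeps stage n and the total payoff within a factor e^(gamma beta^n c) of
    each other: both v_n and the exponential of the rewards still to come lie between 1 and this
    factor, which tends to 1. *)
Let stage_le n : (stage n <= (expR (gamma * beta ^+ n * c))%:E * total)%E.
Proof.
rewrite -ge0_integralZl ?lee_fin ?expR_ge0//.
apply: ge0_le_integral => //.
- by move=> w _; rewrite mule_ge0// lee_fin ?expR_ge0.
- exact: emeasurable_funM.
- by apply: emeasurable_funM => //; exact: measurable_cst.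
move=> w _; rewrite muleC lee_pmul ?lee_fin ?expR_ge0//; first by case/andP: (v_bounds n (X_ n w)).
by rewrite ler_expR ler_pM2l//; case/andP: (total_reward_bounds n w).
Qed.

Let total_le n : (total <= (expR (gamma * beta ^+ n * c))%:E * stage n)%E.
Proof.
rewrite -ge0_integralZl ?lee_fin ?expR_ge0//; first last.
- by move=> w _; rewrite mule_ge0// lee_fin ?expR_ge0.
- exact: emeasurable_funM.
apply: ge0_le_integral => //.
- by apply: emeasurable_funM; [exact: measurable_cst|exact: emeasurable_funM].
move=> w _; rewrite -!EFinM lee_fin mulrA -expRD.
have /andP[h1 _] := v_bounds n (X_ n w).
apply: (@le_trans _ _ (expR (gamma * beta ^+ n * c + gamma * partial_reward n w))); last first.
  by rewrite ler_peMr// expR_ge0.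
have /andP[_ h] := total_reward_bounds n w.
rewrite ler_expR; apply: (@le_trans _ _ (gamma * (partial_reward n w + c * beta ^+ n))).
  by rewrite ler_pM2l.
by rewrite le_eqVlt; apply/orP; left; apply/eqP; ring.
Qed.

Let expR_cvg : expR (gamma * beta ^+ n * c) @[n --> \oo] --> (1 : R).
Proof.
have h : gamma * beta ^+ n * c @[n --> \oo] --> gamma * 0 * c.
  apply: cvgMr_tmp; apply: cvgMl_tmp.
  by apply: cvg_expr; rewrite gtr0_norm//; case/andP: beta01.
have := cvg_comp _ _ h (@continuous_expR R (gamma * 0 * c)).
by rewrite mulr0 mul0r expR0.
Qed.

Let total_fin : total \is a fin_num.
Proof.
rewrite ge0_fin_numE; last by apply: integral_ge0 => w _; rewrite lee_fin expR_ge0.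
by apply: (le_lt_trans (total_le 0)); rewrite stage0 -EFinM ltry.
Qed.

Let one_step_ge0 n y : (0 <= one_step n y)%E.
Proof.
apply: integral_ge0 => a _; apply: integral_ge0 => b _; apply: mule_ge0.
  by rewrite lee_fin expR_ge0.
by apply: integral_ge0 => y' _; rewrite lee_fin.
Qed.

Let measurable_one_stepX n : measurable_fun [set: W] (fun w => one_step n (X_ n w)).
Proof.
apply: (measurableT_comp (f := one_step n : borel E -> \bar R) _ (@measurable_X E A B n)).
pose h (s : SS) : \bar R := ((expR (gamma * beta ^+ n * r G s))%:E *
  \int[Qp G s]_y' (v n.+1 y')%:E)%E.
have h0 s : (0 <= h s)%E.
  by rewrite mule_ge0 ?lee_fin ?expR_ge0//; apply: integral_ge0 => y _; rewrite lee_fin.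
have mh : measurable_fun setT h.
  apply: emeasurable_funM.
    apply/measurable_EFinP; apply: measurableT_comp => //.
    by apply: measurable_funM => //; exact: r_measurable.
  apply: (@measurable_integral_kernel _ _ SS (borel E) R (Qp G) (fun z => (v n.+1 z.2)%:E)).
  - exact: is_kernel_Qp.
  - by move=> z; rewrite lee_fin.
  - by apply/measurable_EFinP; exact: (measurableT_comp (mv n.+1) measurable_snd).
rewrite (_ : one_step n = fun y => (\int[play f g n y]_s h s)%E).
  apply: (@measurable_integral_kernel _ _ (borel E) SS R (play f g n) (fun z => h z.2)) => //.
  - exact: is_kernel_play.
  - exact: (measurableT_comp mh measurable_snd).
by apply/funext => y; rewrite integral_play.
Qed.

Lemma lower_verification : (forall n y, ((v n y)%:E <= one_step n y)%E) ->
  ((v 0 x)%:E <= 'E_P[fun w => expR (gamma * total_reward G beta w)])%E.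
Proof.
move=> h; rewrite unlock.
have hn n : ((v 0 x)%:E <= stage n)%E.
  elim: n => [|n IH]; first by rewrite stage0.
  apply: (le_trans IH); rewrite stageS; apply: ge0_le_integral => //.
  - by move=> w _; rewrite mule_ge0// lee_fin ?expR_ge0.
  - exact: emeasurable_funM.
  - by apply: emeasurable_funM => //; exact: measurable_one_stepX.
  by move=> w _; apply: lee_wpmul2l; [rewrite lee_fin expR_ge0|exact: h].
rewrite -/total -(fineK total_fin) lee_fin.
have lim : expR (gamma * beta ^+ n * c) * fine total @[n --> \oo] --> 1 * fine total.
  by apply: cvgMr_tmp; exact: expR_cvg.
rewrite mul1r in lim; apply: (ler_cvg_to (cvg_cst (v 0 x)) lim); apply: nearW => n; rewrite -lee_fin EFinM fineK ?total_fin//.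
exact: le_trans (hn n) (stage_le n).
Qed.

Lemma upper_verification : (forall n y, (one_step n y <= (v n y)%:E)%E) ->
  ('E_P[fun w => expR (gamma * total_reward G beta w)] <= (v 0 x)%:E)%E.
Proof.
move=> h; rewrite unlock.
have hn n : (stage n <= (v 0 x)%:E)%E.
  elim: n => [|n IH]; first by rewrite stage0.
  apply: le_trans IH; rewrite stageS; apply: ge0_le_integral => //.
  - by move=> w _; rewrite mule_ge0 ?lee_fin ?expR_ge0// one_step_ge0.
  - by apply: emeasurable_funM => //; exact: measurable_one_stepX.
  - exact: emeasurable_funM.
  by move=> w _; apply: lee_wpmul2l; [rewrite lee_fin expR_ge0|exact: h].
rewrite -/total -(fineK total_fin) lee_fin.
have lim : expR (gamma * beta ^+ n * c) * v 0 x @[n --> \oo] --> 1 * v 0 x.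
  by apply: cvgMr_tmp; exact: expR_cvg.
rewrite mul1r in lim; apply: (ler_cvg_to (cvg_cst (fine total)) lim); apply: nearW => n; rewrite -lee_fin EFinM fineK ?total_fin//.
by apply: (le_trans (total_le n)); apply: lee_wpmul2l.
Qed.

End verification.

(** * Dynamic programming *)

Section integrator.
Import HBNNSimple.

(** [tildeQmix] is given as a mere set function. The integral is built from simple functions with
    measurable level sets, so it sees the integrator on measurable sets only and a genuine measure
    can be substituted. *)
Lemma integral_ext_measurable d (T : measurableType d) (R : realType)
    (m1 m2 : set T -> \bar R) (f : T -> \bar R) :
  (forall S, measurable S -> m1 S = m2 S) ->
  (\int[m1]_x f x = \int[m2]_x f x)%E.
Proof.
move=> h.
have hs (k : {nnsfun T >-> R}) : sintegral m1 k = sintegral m2 k.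
  rewrite /sintegral; apply: eq_fsbigr => r _; congr (_ * _)%E; apply: h.
  exact: measurable_sfunP.
by rewrite /integral; congr (_ - _)%E; congr ereal_sup;
  apply/seteqP; split => _ [k' kk' <-]; exists k' => //; rewrite hs.
Qed.

End integrator.

Section weighted_mixture.
Context d d' (X : measurableType d) (Y : measurableType d') (R : realType).
Variables (P : probability X R) (q : X -> probability Y R) (w : X -> R) (K : R).
Hypothesis kq : is_kernel q.
Hypothesis mw : measurable_fun setT w.
Hypothesis wK : forall x, 0 <= w x <= K.

Let w0 x : 0 <= w x. Proof. by case/andP: (wK x). Qed.

(** The mixed set function is the composition of the constant kernel [P] with the scaled kernel w q;
    [unit] is the dummy source of that composition. *)
Let k (z : unit * X) : {measure set Y -> \bar R} := mscale (NngNum (w0 z.2)) (q z.2).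

Let mk (U : set Y) : measurable U -> measurable_fun setT (k ^~ U).
Proof.
move=> mU; rewrite /k /mscale /=; apply: emeasurable_funM.
  by apply/measurable_EFinP; exact: (measurableT_comp mw measurable_snd).
exact: (measurableT_comp (kq mU) measurable_snd).
Qed.

HB.instance Definition _ := isKernel.Build _ _ (unit * X)%type Y R k mk.

Let k_uub : measure_fam_uub k.
Proof.
exists (K + 1) => -[u x]; rewrite /k /= /mscale /=.
have -> : (q x setT = 1)%E by exact: probability_setT.
by rewrite mule1 lte_fin ltr_pwDr//; case/andP: (wK x).
Qed.

HB.instance Definition _ := @Kernel_isFinite.Build _ _ (unit * X)%type Y R k k_uub.

Let mP : measurable_fun [set: unit] (fun _ : unit => P : pprobability X R).
Proof. exact: measurable_cst. Qed.

Lemma integral_weighted_mixture (phi : Y -> \bar R) : (forall y, 0 <= phi y)%E ->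
  measurable_fun setT phi ->
  (\int[fun S => \int[P]_x ((w x)%:E * q x S)]_y phi y =
   \int[P]_x ((w x)%:E * \int[q x]_y phi y))%E.
Proof.
move=> phi0 mphi.
transitivity (\int[kcomp (kprobability mP) k tt]_y phi y)%E.
  exact: integral_ext_measurable.
rewrite (integral_kcomp (kprobability mP) k)//.
by apply: eq_integral => x _; rewrite /k ge0_integral_mscale.
Qed.

End weighted_mixture.

Lemma mean_le_scale (R : realType) (S : ptopologicalType)
    (mu : probability (borel S) R) (phi psi : S -> R) (M k : R) :
  measurable_fun [set: borel S] (phi : borel S -> R) ->
  measurable_fun [set: borel S] (psi : borel S -> R) ->
  (forall s, 0 <= phi s <= M) -> (forall s, 0 <= psi s <= M) -> 0 < k ->
  (forall s, phi s <= k * psi s) -> mean mu phi <= k * mean mu psi.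
Proof.
move=> mphi mpsi phiM psiM k0 h.
have psiM' s : `|psi s| <= M by have /andP[? ?] := psiM s; rewrite ger0_norm.
rewrite -[leRHS]addr0 -(mean_affine mu k 0 mpsi psiM')//.
apply: (@le_mean _ _ mu _ _ (M + k * M)) => //.
- by apply: measurable_funD => //; exact: measurable_funM.
- move=> s; have /andP[h0 h1] := phiM s; have /andP[h2 h3] := psiM s.
  by rewrite ger0_norm// (le_trans h1)// lerDl mulr_ge0 ?(ltW k0)// (le_trans h2).
- move=> s; have /andP[h0 h1] := phiM s; have /andP[h2 h3] := psiM s.
  rewrite addr0 ger0_norm ?mulr_ge0 ?(ltW k0)//.
  by rewrite -[leLHS]add0r lerD ?(le_trans h0)// ler_pM2l.
- by move=> s; rewrite addr0.
Qed.

Section dynamic_programming.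
Context (R : realType) (E A B : ptopologicalType) (G : game R E A B).
Variables (dE : E -> E -> R) (dA : A -> A -> R) (dB : B -> B -> R).
Hypotheses (mdE : metrizes dE) (mdA : metrizes dA) (mdB : metrizes dB).
Hypothesis dA0 : forall x y, dA x y = 0 -> x = y.
Hypothesis dB0 : forall x y, dB x y = 0 -> x = y.
Variables (UE : nat -> set E) (UA : nat -> set A) (UB : nat -> set B).
Hypotheses (cbE : countable_base UE) (cbA : countable_base UA) (cbB : countable_base UB).
Variables (beta gammabar : R).
Hypothesis beta01 : 0 < beta < 1.
Hypothesis gammabar0 : 0 < gammabar.
Hypothesis cpt : forall x, compact (adm (DA G) x) /\ compact (adm (DB G) x).
Hypothesis ccorr : continuous_corr (DA G) /\ continuous_corr (DB G).
Hypothesis cr : continuous (r G).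
Hypothesis feller : forall v : E -> R, bounded_continuous v ->
  continuous (fun z : E * A * B => (\int[Q G z]_x' v x' : R)).

Let T := (E * R)%type.
Let SS := (borel E * borel A * borel B)%type.
Let dT (s t : T) : R := dE s.1 t.1 + `|s.2 - t.2|.
Let mdT : metrizes dT. Proof. exact: metrizes_prod mdE (metrizes_real R). Qed.

Let KA (t : T) : set A := adm (DA G) t.1.
Let KB (t : T) : set B := adm (DB G) t.1.

(** The two semicontinuities, given through sets of states hit by closed or open sets, become
    neighbourhood conditions at a pair (state, parameter); the correspondence is constant in the
    parameter. *)
Let corr_usc (Y : ptopologicalType) (D : set (E * Y)) : usc_corr D ->
  forall (t : T) V, open V -> adm D t.1 `<=` V -> \forall s \near t, adm D s.1 `<=` V.
Proof.
move=> usc t V oV sub.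
have oU : open (~` [set x | adm D x `&` ~` V !=set0]).
  by apply: closed_openC; apply: usc; exact: open_closedC.
have : nbhs t.1 (~` [set x | adm D x `&` ~` V !=set0]).
  by apply: open_nbhs_nbhs; split => // -[y [Dy nVy]]; apply: nVy; exact: sub.
move=> N; have : nbhs t ((fst : T -> E) @^-1` (~` [set x | adm D x `&` ~` V !=set0])).
  exact: (@cvg_fst _ _ (nbhs t.1) (nbhs t.2)).
by apply: filterS => s /= h y Dy; apply: contrapT => nVy; apply: h; exists y.
Qed.

Let corr_lsc (Y : ptopologicalType) (D : set (E * Y)) : lsc_corr D ->
  forall (t : T) b V, adm D t.1 b -> nbhs b V ->
    \forall s \near t, adm D s.1 `&` V !=set0.
Proof.
move=> lsc t b V Db Vb.
have oU : open [set x | adm D x `&` V^° !=set0] by apply: lsc; exact: open_interior.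
have N : nbhs t.1 [set x | adm D x `&` V^° !=set0].
  by apply: open_nbhs_nbhs; split => //; exists b.
have : nbhs t ((fst : T -> E) @^-1` [set x | adm D x `&` V^° !=set0]).
  exact: (@cvg_fst _ _ (nbhs t.1) (nbhs t.2)).
apply: filterS => s [y [Dy Vy]]; exists y; split => //; exact: interior_subset Vy.
Qed.

Let corr_neq0 (Y : ptopologicalType) (D : set (E * Y)) : action_constraint D ->
  forall t : T, adm D t.1 !=set0.
Proof. by move=> [_ [h _ hD]] t; exists (h t.1); exact: hD. Qed.

Definition clamp (gamma : R) : R := Num.min (Num.max 0 gamma) gammabar.

Lemma clamp_bounds gamma : 0 <= clamp gamma <= gammabar.
Proof.
by rewrite /clamp ge_min lexx orbT andbT le_min le_max lexx /= ltW.
Qed.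

Lemma clamp_id gamma : 0 <= gamma <= gammabar -> clamp gamma = gamma.
Proof. by move=> /andP[h1 h2]; rewrite /clamp max_r// min_l. Qed.

Lemma clamp_continuous : continuous clamp.
Proof.
move=> x; apply: continuous_min; last exact: cvg_cst.
by apply: continuous_max; [exact: cvg_cst|exact: cvg_id].
Qed.

Lemma clamp_beta gamma : clamp (beta * clamp gamma) = beta * clamp gamma.
Proof.
have /andP[h1 h2] := clamp_bounds gamma; have /andP[b0 b1] := beta01.
apply: clamp_id; apply/andP; split; first by apply: mulr_ge0 => //; exact: ltW.
by apply: le_trans h2; rewrite ler_piMl// ltW.
Qed.

(* The parameter gamma is clamped to [0, gammabar], so that continuity can be
   stated on the whole product E * R. *)
Definition payoff (v : T -> R) (t : T) (a : A) (b : B) : R :=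
  expR (clamp t.2 * r G (t.1, a, b)) *
  mean (Qp G (t.1, a, b)) (fun x' => v (x', beta * clamp t.2)).

Section payoff_properties.
Variables (v : T -> R) (M : R).
Hypothesis cv : continuous v.
Hypothesis vM : forall t, 0 <= v t <= M.

Let r0 z : 0 <= r G z <= rbar G. Proof. exact: r_bounded. Qed.

Let cvx gamma : continuous (fun x => v (x, gamma)).
Proof.
have c1 : continuous (fun x : E => (x, gamma)).
  by apply: continuous_pair => x; [exact: cvg_id|exact: cvg_cst].
by move=> x; exact: (cvg_comp _ _ (c1 x) (@cv (x, gamma))).
Qed.

Let mvx gamma : measurable_fun [set: borel E] (fun x : borel E => v (x, gamma)).
Proof. exact: (@continuous_measurable_borel R E _ (@cvx gamma)). Qed.

Let mean01 z gamma : 0 <= mean (Qp G z) (fun x' => v (x', gamma)) <= M.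
Proof. by apply: mean_ge0_le => //; exact: mvx. Qed.

Lemma payoff_bounds t a b : 0 <= payoff v t a b <= expR (gammabar * rbar G) * M.
Proof.
have /andP[m0 m1] := mean01 (t.1, a, b) (beta * clamp t.2).
have /andP[c0 c1] := clamp_bounds t.2; have /andP[h0 h1] := r0 (t.1, a, b).
rewrite /payoff mulr_ge0 ?expR_ge0//=; apply: ler_pM => //; rewrite ?expR_ge0//.
by rewrite ler_expR; apply: ler_pM.
Qed.

(** The integrand v(., beta gamma) moves along with the transition law. The Feller property gives
    weak convergence of the law against fixed tests, and [joint_mean_cvg] combines the two
    motions. *)
Lemma payoff_continuous : continuous (fun z : T * A * B => payoff v z.1.1 z.1.2 z.2).
Proof.
move=> [[t a] b].
have c0 : continuous (fun z : T * A * B => z.1.1) by move=> z; exact: (cvg_comp _ _ cvg_fst cvg_fst).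
have c1 : continuous (fun z : T * A * B => z.1.1.1) by move=> z; exact: (cvg_comp _ _ (c0 z) cvg_fst).
have c2 : continuous (fun z : T * A * B => z.1.1.2) by move=> z; exact: (cvg_comp _ _ (c0 z) cvg_snd).
have c3 : continuous (fun z : T * A * B => z.1.2) by move=> z; exact: (cvg_comp _ _ cvg_fst cvg_snd).
have c4 : continuous (fun z : T * A * B => z.2) by move=> z; exact: cvg_snd.
have cz : continuous (fun z : T * A * B => (z.1.1.1, z.1.2, z.2)).
  by apply: continuous_pair => //; exact: continuous_pair.
have cc : continuous (fun z : T * A * B => clamp z.1.1.2).
  by move=> z; exact: (cvg_comp _ _ (c2 z) (@clamp_continuous _)).
apply: cvgM.
  have h : clamp z.1.1.2 * r G (z.1.1.1, z.1.2, z.2) @[z --> (t, a, b)] -->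
      clamp t.2 * r G (t.1, a, b).
    by apply: cvgM; [exact: (cc (t, a, b))|exact: (cvg_comp _ _ (cz (t, a, b)) (@cr _))].
  exact: (cvg_comp _ _ h (@continuous_expR R _)).
apply: (@joint_mean_cvg R E R dE _ (fun q x' => v (x', q)) M (T * A * B)%type
  (nbhs (t, a, b)) (fun z => beta * clamp z.1.1.2) (beta * clamp t.2)
  (fun z => Qp G (z.1.1.1, z.1.2, z.2)) (Qp G (t.1, a, b)) mdE (metrizes_real R)).
- have c5 : continuous (fun z : R * E => (z.2, z.1)).
    by apply: continuous_pair => z; [exact: cvg_snd|exact: cvg_fst].
  by move=> [q x']; exact: (cvg_comp _ _ (c5 (q, x')) (@cv (x', q))).
- by move=> q s; exact: vM.
- by apply: cvgMl_tmp; exact: (cc (t, a, b)).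
- move=> phi bphi.
  have fe : continuous (fun z : E * A * B => mean (Qp G z) phi).
    rewrite (_ : (fun z => _) = fun z => \int[Q G z]_x' phi x'); first exact: feller.
    by apply/funext => z; rewrite /mean /Rintegral integral_Qp.
  exact: (cvg_comp _ _ (cz (t, a, b)) (fe _)).
Qed.

Lemma measurable_payoff t : measurable_fun [set: borel A * borel B]
  ((fun z => payoff v t z.1 z.2) : borel A * borel B -> R).
Proof.
have ms : measurable_fun setT (fun z : borel A * borel B => (t.1 : borel E, z.1, z.2)).
  by do 2 (apply: measurable_fun_pair => //).
apply: measurable_funM.
  apply: measurableT_comp => //; apply: measurable_funM => //.
  exact: (measurableT_comp (r_measurable G) ms).
apply/measurable_EFinP.
rewrite (_ : _ \o _ = (fun s : SS => (\int[Qp G s]_x' (v (x', beta * clamp t.2))%:E)%E) \o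
   (fun z : borel A * borel B => (t.1 : borel E, z.1, z.2))).
  apply: measurableT_comp ms.
  apply: (@measurable_integral_kernel _ _ SS (borel E) R (Qp G)
    (fun z => (v (z.2, beta * clamp t.2))%:E)).
  - exact: is_kernel_Qp.
  - by move=> z; rewrite lee_fin; case/andP: (vM (z.2, beta * clamp t.2)).
  - by apply/measurable_EFinP; exact: (measurableT_comp (mvx _) measurable_snd).
apply/funext => z /=.
apply: (@EFin_Rintegral_prob _ (borel E) R (Qp G _) _ M (@mvx _)) => x.
by case/andP: (vM (x, beta * clamp t.2)) => ? ?; rewrite ger0_norm.
Qed.

(** Open sets of the product topology belong to the product sigma-algebra because both factors have
    countable bases. *)
Lemma measurable_closed (C : set T) : closed C -> measurable (C : set (borel E * R)%type).
Proof.
move=> cC; rewrite -[C]setCK; apply: measurableC.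
have [UR cbR] := realType_countable_base R.
apply: (@rel_open_measurable E R _ _ (borel E) R id id UE UR setT (~` C)) => //.
- by move=> k; apply: open_measurable_borel; exact: cbE.1.
- by move=> k; apply: open_measurable; exact: cbR.1.
- move=> [z1 z2] nCz; exists (~` C) => //.
    by apply: open_nbhs_nbhs; split => //; exact: closed_openC.
  by move=> [? ?] _.
Qed.

Lemma shapley_step : exists u : T -> R, [/\ continuous u,
  forall t, guarantees KA KB (payoff v) t (u t) !=set0 /\
            caps KA KB (payoff v) t (u t) !=set0,
  (exists s : (borel E * R)%type -> probability (borel A) R,
    measurable_fun setT (s : (borel E * R)%type -> borel (Pweak R A)) /\
    forall p, guarantees KA KB (payoff v) p (u p) (s p)) &
  (exists s : (borel E * R)%type -> probability (borel B) R,
    measurable_fun setT (s : (borel E * R)%type -> borel (Pweak R B)) /\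
    forall p, caps KA KB (payoff v) p (u p) (s p))].
Proof.
have cKA t : compact (KA t) := (cpt t.1).1.
have cKB t : compact (KB t) := (cpt t.1).2.
have KA0 := corr_neq0 (DA_constraint G).
have KB0 := corr_neq0 (DB_constraint G).
have uA := corr_usc ccorr.1.1.
have uB := corr_usc ccorr.2.1.
have lA := corr_lsc ccorr.1.2.
have lB := corr_lsc ccorr.2.2.
exists (game_value mdA mdB mdT dA0 dB0 cKA cKB KA0 KB0 payoff_bounds
  payoff_continuous measurable_payoff).
have [s1 s2] := @measurable_saddle_selectors R A B T dA dB dT mdA mdB mdT dA0 dB0
  KA KB cKA cKB KA0 KB0 uA uB lA lB (payoff v) _ payoff_bounds payoff_continuous
  measurable_payoff UA UB _ (borel E * R)%type id cbA cbB measurable_closed.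
split.
- exact: game_value_continuous.
- exact: game_valueP.
- exact: s1.
- exact: s2.
Qed.

End payoff_properties.

Definition is_value (v u : T -> R) : Prop :=
  forall t, guarantees KA KB (payoff v) t (u t) !=set0 /\
            caps KA KB (payoff v) t (u t) !=set0.

Let cKA t : compact (KA t). Proof. exact: (cpt t.1).1. Qed.
Let cKB t : compact (KB t). Proof. exact: (cpt t.1).2. Qed.
Let KA0 := corr_neq0 (DA_constraint G).
Let KB0 := corr_neq0 (DB_constraint G).

Let measurable_payoffA (v : T -> R) M t b : continuous v -> (forall t, 0 <= v t <= M) ->
  measurable_fun [set: borel A] (payoff v t ^~ b : borel A -> R).
Proof.
move=> cv vM; exact: (measurableT_comp (measurable_payoff cv vM t) (measurable_pair2 (b : borel B))).
Qed.

Let measurable_payoffB (v : T -> R) M t a : continuous v -> (forall t, 0 <= v t <= M) ->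
  measurable_fun [set: borel B] (payoff v t a : borel B -> R).
Proof.
move=> cv vM; exact: (measurableT_comp (measurable_payoff cv vM t) (measurable_pair1 (a : borel A))).
Qed.

Let measurable_section (v : T -> R) gamma : continuous v ->
  measurable_fun [set: borel E] (fun x : borel E => v (x, gamma)).
Proof.
move=> cv; apply: (@continuous_measurable_borel R E) => x.
have c1 : continuous (fun x : E => (x, gamma)).
  by apply: continuous_pair => y; [exact: cvg_id|exact: cvg_cst].
exact: (cvg_comp _ _ (c1 x) (cv (x, gamma))).
Qed.

(** A guarantee for [v], divided by k, is a guarantee for [w], and weak duality compares it with a
    cap. The comparison involves only the slice at beta gamma, which is what improves the factor
    under iteration. *)
Lemma value_le (v w : T -> R) M (u u' : T -> R) t k : continuous v ->
  (forall t, 0 <= v t <= M) -> continuous w -> (forall t, 0 <= w t <= M) -> 0 < k ->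
  (forall x, v (x, beta * clamp t.2) <= k * w (x, beta * clamp t.2)) ->
  is_value v u -> is_value w u' -> u t <= k * u' t.
Proof.
move=> cv vM cw wM k0 vw /(_ t)[[mu [muK h]] _] /(_ t)[_ [nu Cnu]].
have Gmu : guarantees KA KB (payoff w) t (u t / k) mu.
  split=> // b Kb; rewrite ler_pdivrMr// mulrC; apply: (le_trans (h b Kb)).
  apply: (@mean_le_scale _ _ _ _ _ (expR (gammabar * rbar G) * M)) => //.
  - exact: measurable_payoffA cv vM.
  - exact: measurable_payoffA cw wM.
  - by move=> a; exact: payoff_bounds.
  - by move=> a; exact: payoff_bounds.
  move=> a; rewrite /payoff mulrCA ler_pM2l ?expR_gt0//.
  apply: (@mean_le_scale _ _ _ _ _ (M)) => //.
  - exact: measurable_section.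
  - exact: measurable_section.
have := guarantees_le_caps mdA mdB mdT dA0 dB0 cKA cKB (payoff_bounds cw wM)
  (payoff_continuous cw wM) (measurable_payoff cw wM) Gmu Cnu.
by rewrite ler_pdivrMr// mulrC.
Qed.

Let c := rbar G / (1 - beta).
Let beta0 : 0 < beta. Proof. by case/andP: beta01. Qed.
Let beta1 : 0 < 1 - beta. Proof. by rewrite subr_gt0; case/andP: beta01. Qed.
Let rbar0 : 0 <= rbar G. Proof. by have /andP[h1 h2] := r_bounded G point; exact: le_trans h2. Qed.
Let c0 : 0 <= c. Proof. by rewrite divr_ge0// ltW. Qed.

(** Thanks to the clamp the bounds make sense on all of [E * R]; they force the value 1 for gamma <=
    0. *)
Definition bracketed (v : T -> R) : Prop :=
  continuous v /\ forall t, 1 <= v t <= expR (clamp t.2 * c).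

Lemma bracketed_bounds v : bracketed v -> forall t, 0 <= v t <= expR (gammabar * c).
Proof.
move=> [_ vb] t; have /andP[h1 h2] := vb t; have /andP[_ h3] := clamp_bounds t.2.
by rewrite (le_trans ler01)//= (le_trans h2)// ler_expR ler_wpM2r.
Qed.

(** The one-shot payoff itself lies in the bracket; the value inherits the bounds by confronting an
    optimal strategy with one admissible pure action of the other player. *)
Lemma bracketed_value v u : bracketed v -> continuous u -> is_value v u -> bracketed u.
Proof.
move=> bv cu vu; split=> // t; have vM := bracketed_bounds bv; have [cv vb] := bv.
have K1 : 1 <= expR (gammabar * c) by rewrite -expR0 ler_expR mulr_ge0// ltW.
have /andP[g0 g1] := clamp_bounds t.2.
have mean_cst (S : ptopologicalType) (mu : probability (borel S) R) : mean mu (cst 1) = 1.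
  exact: Rintegral_prob_cst.
have cst01 (S : Type) (s : S) M : 1 <= M -> 0 <= (cst 1 : S -> R) s <= M.
  by move=> M1 /=; rewrite ler01.
have mv1 z : 1 <= mean (Qp G z) (fun x => v (x, beta * clamp t.2)).
  rewrite -[leLHS](mean_cst E (Qp G z)) -[leRHS]mul1r.
  apply: (@mean_le_scale _ _ _ _ _ (expR (gammabar * c))) => //.
  - exact: measurable_section.
  - by move=> s; exact: cst01.
  - by move=> s; rewrite mul1r; have /andP[] := vb (s, beta * clamp t.2).
have mv2 z : mean (Qp G z) (fun x => v (x, beta * clamp t.2)) <= expR (beta * clamp t.2 * c).
  rewrite -[leRHS]mulr1 -(mean_cst E (Qp G z)).
  apply: (@mean_le_scale _ _ _ _ _ (expR (gammabar * c))) => //.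
  - exact: measurable_section.
  - by move=> s; exact: cst01.
  - exact: expR_gt0.
  move=> s; rewrite /cst mulr1; have /andP[_] := vb (s, beta * clamp t.2).
  by rewrite /= clamp_beta.
have p1 a b : 1 <= payoff v t a b.
  rewrite /payoff -[leLHS]mul1r; apply: ler_pM => //.
  rewrite -expR0 ler_expR mulr_ge0//.
  by case/andP: (r_bounded G (t.1, a, b)).
have p2 a b : payoff v t a b <= expR (clamp t.2 * c).
  have -> : clamp t.2 * c = clamp t.2 * rbar G + beta * clamp t.2 * c.
    by rewrite /c; field; rewrite lt0r_neq0.
  rewrite expRD /payoff; apply: ler_pM => //; rewrite ?expR_ge0//.
    by rewrite (le_trans ler01).
  by rewrite ler_expR ler_wpM2l//; case/andP: (r_bounded G (t.1, a, b)).
have [[mu [muK h1]] [nu [nuK h2]]] := vu t.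
have [a Ka] := KA0 t; have [b Kb] := KB0 t.
have M1 : 1 <= expR (gammabar * rbar G) * expR (gammabar * c).
  by rewrite -[leLHS]mul1r; apply: ler_pM => //; rewrite -expR0 ler_expR mulr_ge0// ltW.
apply/andP; split.
  apply: le_trans (h2 a Ka); rewrite -[leLHS](mean_cst B nu) -[leRHS]mul1r.
  apply: (@mean_le_scale _ _ _ _ _ (expR (gammabar * rbar G) * expR (gammabar * c))) => //.
  - exact: measurable_payoffB cv vM.
  - by move=> s; exact: cst01.
  - by move=> s; exact: payoff_bounds.
  - by move=> s; rewrite mul1r; exact: p1.
apply: (le_trans (h1 b Kb)); rewrite -[leRHS]mulr1 -(mean_cst A mu).
apply: (@mean_le_scale _ _ _ _ _ (expR (gammabar * rbar G) * expR (gammabar * c))) => //.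
- exact: measurable_payoffA cv vM.
- by move=> s; exact: payoff_bounds.
- by move=> s; exact: cst01.
- exact: expR_gt0.
- by move=> s; rewrite /cst mulr1; exact: p2.
Qed.

Theorem fixed_point_ex : exists v : T -> R, bracketed v /\ is_value v v.
Proof.
have bge0 n : 0 <= beta ^+ n by rewrite exprn_ge0// ltW.
(* The Shapley operator in clamped form: a continuous value function exists for bracketed [v] by
   [shapley_step], and [S] picks one. *)
pose S v := get [set u : T -> R | continuous u /\ is_value v u].
have SP v : bracketed v -> bracketed (S v) /\ is_value v (S v).
  move=> bv; have [cv _] := bv.
  have [u [cu vu _ _]] := shapley_step cv (bracketed_bounds bv).
  have [cS vS] : continuous (S v) /\ is_value v (S v).
    by apply: (getPex (P := [set u : T -> R | continuous u /\ is_value v u])); exists u.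
  by split => //; exact: bracketed_value vS.
pose vn n := iter n S (cst 1).
have b1 : bracketed (cst 1).
  split; first by move=> x; exact: cvg_cst.
  move=> s; rewrite lexx /= -expR0 ler_expR mulr_ge0//.
  by case/andP: (clamp_bounds s.2).
have bvn n : bracketed (vn n) by elim: n => // n IH; exact: (SP _ IH).1.
have vvn n : is_value (vn n) (vn n.+1) by exact: (SP _ (bvn n)).2.
have vn0 t : vn 0%N t = 1 by [].
clearbody vn; clearbody S.
have bb n := bracketed_bounds (bvn n).
have le_value (v w u u' : T -> R) t k : bracketed v -> bracketed w -> 0 < k ->
    (forall x, v (x, beta * clamp t.2) <= k * w (x, beta * clamp t.2)) ->
    is_value v u -> is_value w u' -> u t <= k * u' t.
  move=> bv bw; exact: (value_le bv.1 (bracketed_bounds bv) bw.1 (bracketed_bounds bw)).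
have mono n t : vn n t <= vn n.+1 t.
  elim: n t => [|n IH] t; first by rewrite vn0; have [_ /(_ t)/andP[]] := bvn 1%N.
  rewrite -[leRHS]mul1r; apply: (le_value (vn n) (vn n.+1) (vn n.+1) (vn n.+2) t 1) => //.
  by move=> x; rewrite mul1r.
have monoD n m t : vn n t <= vn (n + m)%N t.
  by elim: m => [|m IH]; [rewrite addn0|rewrite addnS (le_trans IH)].
(* For n = 0 this is the bracket. Each application of [S] looks at the parameter beta gamma, so the
   exponent gains one factor beta. *)
have contr n m t : vn (n + m)%N t <= expR (beta ^+ n * clamp t.2 * c) * vn n t.
  elim: n t => [|n IH] t.
    by rewrite vn0 expr0 mul1r add0n mulr1; have [_ /(_ t)/andP[]] := bvn m.
  rewrite addSn; apply: (le_value (vn (n + m)%N) (vn n) (vn (n + m).+1) (vn n.+1) t) => //; first exact: expR_gt0.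
  move=> x; apply: (le_trans (IH _)); rewrite /= clamp_beta exprSr.
  by rewrite le_eqVlt; apply/orP; left; apply/eqP; congr (expR _ * _); ring.
pose v t := lim (vn n t @[n --> \oo]).
have cvgv t : vn n t @[n --> \oo] --> v t.
  apply: nondecreasing_is_cvgn.
    by move=> i j /subnKC <-.
  by exists (expR (gammabar * c)) => _ [n _ <-]; case/andP: (bb n t).
have lev n t : vn n t <= v t.
  apply: limr_ge; first exact: cvgv.
  by exists n => // m /= /subnKC <-.
have vle n t : v t <= expR (beta ^+ n * clamp t.2 * c) * vn n t.
  apply: limr_le; first exact: cvgv.
  by exists n => // m /= /subnKC <-.
clearbody v.
have expc : expR (beta ^+ n * gammabar * c) @[n --> \oo] --> (1 : R).
  have h : beta ^+ n * gammabar * c @[n --> \oo] --> 0 * gammabar * c.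
    apply: cvgMr_tmp; apply: cvgMr_tmp.
    by apply: cvg_expr; rewrite gtr0_norm//; case/andP: beta01.
  have := cvg_comp _ _ h (@continuous_expR R (0 * gammabar * c)).
  by rewrite !mul0r expR0.
(* The multiplicative bound [vle] becomes a uniform additive one, as clamping keeps gamma below
   gammabar and v_n below e^(gammabar c). *)
have unif (e : R) : 0 < e -> exists n, forall t, `|v t - vn n t| <= e.
  move=> e0; have h : (expR (beta ^+ n * gammabar * c) - 1) * expR (gammabar * c)
      @[n --> \oo] --> (1 - 1) * expR (gammabar * c).
    by apply: cvgMr_tmp; apply: cvgB => //; exact: cvg_cst.
  rewrite subrr mul0r in h.
  have /cvgrPdist_le/(_ e e0)[n _ hn] := h.
  exists n => t; rewrite ger0_norm ?subr_ge0//.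
  have := hn n (leqnn n); rewrite sub0r normrN => /(le_trans (ler_norm _)).
  apply: le_trans; apply: (@le_trans _ _ ((expR (beta ^+ n * clamp t.2 * c) - 1) * vn n t)).
    by rewrite mulrBl mul1r lerD2r.
  have /andP[g0 g1] := clamp_bounds t.2; have /andP[w0 w1] := bb n t.
  apply: ler_pM => //.
    rewrite subr_ge0 -expR0 ler_expR; apply: mulr_ge0 => //; exact: mulr_ge0.
  by rewrite lerD2r ler_expR ler_wpM2r// ler_wpM2l.
have cv : continuous v.
  move=> t0; apply/cvgrPdist_le => e e0.
  have e3 : 0 < e / 3 by rewrite divr_gt0.
  have [n hn] := unif _ e3; have [cn _] := bvn n.
  have /cvgrPdist_le/(_ _ e3) := cn t0.
  apply: filterS => t ht; have h1 := hn t0; have h2 := hn t.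
  have -> : v t0 - v t = (v t0 - vn n t0) + (vn n t0 - vn n t) - (v t - vn n t) by ring.
  apply: (le_trans (ler_normB _ _)); have := ler_normD (v t0 - vn n t0) (vn n t0 - vn n t).
  by move=> h3; lra.
have bv : bracketed v.
  split=> // t; apply/andP; split; first by apply: le_trans (lev 0%N t); rewrite vn0.
  by apply: (le_trans (vle 0%N t)); rewrite vn0 expr0 mul1r mulr1.
have [bS vS] := SP v bv.
(* From v_n <= v follows v_(n+1) <= S v, and from v <= e^(beta^n gamma c) v_n follows S v <=
   e^(beta^(n+1) gamma c) v_(n+1), with gamma clamped; both bounds tend to v. *)
have vE t : S v t = v t.
  apply/eqP; rewrite eq_le; apply/andP; split; last first.
    have ge n : vn n.+1 t <= S v t.
      have hx x : vn n (x, beta * clamp t.2) <= 1 * v (x, beta * clamp t.2).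
        by rewrite mul1r; exact: lev.
      have := le_value (vn n) v (vn n.+1) (S v) t 1 (bvn n) bv ltr01 hx (vvn n) vS.
      by rewrite mul1r.
    apply: (ler_cvg_to (cvgv t) (cvg_cst (S v t))).
    by exists 1%N => // -[|n] // _; exact: ge.
  have le n : S v t <= expR (beta ^+ n.+1 * gammabar * c) * v t.
    have /andP[g0 g1] := clamp_bounds t.2.
    apply: (@le_trans _ _ (expR (beta ^+ n.+1 * clamp t.2 * c) * vn n.+1 t)).
      have hx x : v (x, beta * clamp t.2) <=
          expR (beta ^+ n.+1 * clamp t.2 * c) * vn n (x, beta * clamp t.2).
        apply: (le_trans (vle n _)); rewrite /= clamp_beta exprSr.
        by rewrite le_eqVlt; apply/orP; left; apply/eqP; congr (expR _ * _); ring.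
      exact: (le_value v (vn n) (S v) (vn n.+1) t _ bv (bvn n) (expR_gt0 _) hx vS (vvn n)).
    have /andP[w0 w1] := bb n.+1 t.
    apply: ler_pM => //; rewrite ?expR_ge0//.
    by rewrite ler_expR ler_wpM2r// ler_wpM2l// bge0.
  have h : expR (beta ^+ n * gammabar * c) * v t @[n --> \oo] --> 1 * v t.
    by apply: cvgMr_tmp.
  rewrite mul1r in h; apply: (ler_cvg_to (cvg_cst (S v t)) h).
  by exists 1%N => // -[|n] // _; exact: le.
exists v; split => // t; have := vS t; by rewrite vE.
Qed.

End dynamic_programming.

(** * From one-shot optimal strategies to the value of the game and optimal policies *)

Section verification_of_selectors.
Context (R : realType) (E A B : ptopologicalType) (G : game R E A B).
Variables (dA : A -> A -> R) (dB : B -> B -> R).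
Hypotheses (mdA : metrizes dA) (mdB : metrizes dB).
Hypothesis dA0 : forall x y, dA x y = 0 -> x = y.
Hypothesis dB0 : forall x y, dB x y = 0 -> x = y.
Variables (beta gammabar : R).
Hypothesis beta01 : 0 < beta < 1.
Hypothesis gammabar0 : 0 < gammabar.
Hypothesis cpt : forall x, compact (adm (DA G) x) /\ compact (adm (DB G) x).

Let T := (E * R)%type.
Let SS := (borel E * borel A * borel B)%type.
Let KA (t : T) : set A := adm (DA G) t.1.
Let KB (t : T) : set B := adm (DB G) t.1.
Let c := rbar G / (1 - beta).
Let beta0 : 0 < beta. Proof. by case/andP: beta01. Qed.

Lemma dom_clamp (p : T) : dom gammabar p -> clamp gammabar p.2 = p.2.
Proof. by move=> /andP[h1 h2]; rewrite clamp_id// ltW. Qed.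

Lemma dom_next (x y : E) (gamma : R) : dom gammabar (x, gamma) -> dom gammabar (y, beta * gamma).
Proof.
move=> /andP[/= h1 h2]; apply/andP; split; first exact: mulr_gt0.
by rewrite (le_trans _ h2)// ler_piMl ?(ltW h1)//; case/andP: beta01 => _ /ltW.
Qed.

Lemma dom_discount (x y : E) (gamma : R) n : dom gammabar (x, gamma) ->
  dom gammabar (y, gamma * beta ^+ n).
Proof.
move=> h; elim: n => [|n IH]; first by rewrite expr0 mulr1; exact: h.
by rewrite exprS mulrCA; exact: dom_next IH.
Qed.

Variable V : T -> R.
Hypothesis bV : bracketed G beta gammabar V.
Let cV : continuous V. Proof. exact: bV.1. Qed.
Let vM := bracketed_bounds beta01 gammabar0 bV.
Let F := payoff G beta gammabar V.
Let M := expR (gammabar * rbar G) * expR (gammabar * c).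

Let FM t a b : 0 <= F t a b <= M.
Proof. exact: payoff_bounds. Qed.

Let F0 t a b : 0 <= F t a b. Proof. by case/andP: (FM t a b). Qed.

Let absF t a b : `|F t a b| <= M.
Proof. by case/andP: (FM t a b) => ? ?; rewrite ger0_norm. Qed.

Let mF t : measurable_fun [set: borel A * borel B]
  ((fun z => F t z.1 z.2) : borel A * borel B -> R).
Proof. exact: measurable_payoff cV vM t. Qed.

Let mFA t b : measurable_fun [set: borel A] (F t ^~ b : borel A -> R).
Proof. exact: (measurableT_comp (mF t) (measurable_pair2 (b : borel B))). Qed.

Let mFB t a : measurable_fun [set: borel B] (F t a : borel B -> R).
Proof. exact: (measurableT_comp (mF t) (measurable_pair1 (a : borel A))). Qed.

Definition mixed_payoff (t : T) (mu : probability (borel A) R)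
  (nu : probability (borel B) R) : R := mean nu (fun b => mean mu (fun a => F t a b)).

Let EFin_meanA t (mu : probability (borel A) R) b :
  (\int[mu]_a (F t a b)%:E = (mean mu (fun a => F t a b))%:E)%E.
Proof. by rewrite -(@EFin_Rintegral_prob _ (borel A) R mu _ M (@mFA t b)). Qed.

Let EFin_meanB t (nu : probability (borel B) R) a :
  (\int[nu]_b (F t a b)%:E = (mean nu (F t a))%:E)%E.
Proof. by rewrite -(@EFin_Rintegral_prob _ (borel B) R nu _ M (@mFB t a)). Qed.

Let meanA_bounds t (mu : probability (borel A) R) b :
  `|mean mu (fun a => F t a b)| <= M.
Proof.
by have /andP[h1 h2] := mean_ge0_le mu (@mFA t b) (fun a => FM t a b); rewrite ger0_norm.
Qed.

Let meanB_bounds t (nu : probability (borel B) R) a : `|mean nu (F t a)| <= M.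
Proof.
by have /andP[h1 h2] := mean_ge0_le nu (@mFB t a) (fun b => FM t a b); rewrite ger0_norm.
Qed.

Let measurable_meanA t (mu : probability (borel A) R) :
  measurable_fun [set: borel B] (fun b : borel B => mean mu (fun a => F t a b)).
Proof.
apply/measurable_EFinP.
rewrite (_ : _ \o _ = fun b : borel B => (\int[mu]_a (F t a b)%:E)%E); last first.
  by apply/funext => b; rewrite /= EFin_meanA.
apply: (@measurable_integral_kernel _ _ (borel B) (borel A) R (fun=> mu)
  (fun z => (F t z.2 z.1)%:E)).
- exact: is_kernel_cst.
- by move=> z; rewrite lee_fin.
- apply/measurable_EFinP.
  have ms : measurable_fun setT (fun z : borel B * borel A => (z.2, z.1)).
    exact: measurable_fun_pair.
  exact: (measurableT_comp (mF t) ms).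
Qed.

Let measurable_meanB t (nu : probability (borel B) R) :
  measurable_fun [set: borel A] (fun a : borel A => mean nu (F t a)).
Proof.
apply/measurable_EFinP.
rewrite (_ : _ \o _ = fun a : borel A => (\int[nu]_b (F t a b)%:E)%E); last first.
  by apply/funext => b; rewrite /= EFin_meanB.
apply: (@measurable_integral_kernel _ _ (borel A) (borel B) R (fun=> nu)
  (fun z => (F t z.1 z.2)%:E)).
- exact: is_kernel_cst.
- by move=> z; rewrite lee_fin.
- by apply/measurable_EFinP; exact: mF.
Qed.

Let mixed_payoffC t mu nu : mixed_payoff t mu nu = mean mu (fun a => mean nu (F t a)).
Proof. exact: (mean_fubini mu nu (FM t) (@mF t) (@mFB t) (@mFA t)). Qed.

Lemma mixed_payoffE t (mu : probability (borel A) R) (nu : probability (borel B) R) :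
  (\int[nu]_b \int[mu]_a (F t a b)%:E = (mixed_payoff t mu nu)%:E)%E.
Proof.
under eq_integral do rewrite EFin_meanA.
by rewrite -(@EFin_Rintegral_prob _ (borel B) R nu _ M (@measurable_meanA t mu)).
Qed.

Lemma mixed_payoffE2 t (mu : probability (borel A) R) (nu : probability (borel B) R) :
  (\int[mu]_a \int[nu]_b (F t a b)%:E = (mixed_payoff t mu nu)%:E)%E.
Proof.
under eq_integral do rewrite EFin_meanB.
rewrite mixed_payoffC.
by rewrite -(@EFin_Rintegral_prob _ (borel A) R mu _ M (@measurable_meanB t nu)).
Qed.

Lemma guarantee_mixed t s mu nu : guarantees KA KB F t s mu -> carried (KB t) nu ->
  s <= mixed_payoff t mu nu.
Proof.
move=> [_ h] nuK; apply: (mean_ge_carried _ nuK (measurable_meanA t mu) (meanA_bounds t mu)) => //.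
by apply: (compact_measurable_borel mdB dB0); exact: (cpt t.1).2.
Qed.

Lemma caps_mixed t s mu nu : caps KA KB F t s nu -> carried (KA t) mu ->
  mixed_payoff t mu nu <= s.
Proof.
move=> [_ h] muK; rewrite mixed_payoffC.
apply: (mean_le_carried _ muK (measurable_meanB t nu) (meanB_bounds t nu)) => //.
by apply: (compact_measurable_borel mdA dA0); exact: (cpt t.1).1.
Qed.

(** State and actions under one law, with [nu] outside and [mu] inside as in [tildeQmix]; the
    operator then becomes a single weighted mixture. *)
Let action_law (x : borel E) (mu : probability (borel A) R) (nu : probability (borel B) R) :
  exists P : probability SS R, forall h : SS -> \bar R, (forall s, 0 <= h s)%E ->
    measurable_fun setT h ->
    (\int[P]_s h s = \int[nu]_b \int[mu]_a h (x, a, b))%E.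
Proof.
pose dir (b : borel B) (a : borel A) : probability SS R := \d_(x, a, b).
have kd : is_kernel (fun z : borel B * borel A => dir z.1 z.2).
  apply: (@is_kernel_dirac _ _ (borel B * borel A)%type SS R (fun z => (x, z.2, z.1))).
  by do 2 (apply: measurable_fun_pair => //).
have kdb (b : borel B) : is_kernel (dir b).
  exact: is_kernel_comp (measurable_pair1 b) kd.
have kk : is_kernel (fun b => kernel_bind mu (dir b)).
  exact: (is_kernel_bind (is_kernel_cst mu) kd).
exists (kernel_bind nu (fun b => kernel_bind mu (dir b))) => h h0 mh.
rewrite integral_kernel_bind//; apply: eq_integral => b _.
rewrite integral_kernel_bind//; apply: eq_integral => a _.
by rewrite integral_dirac// diracT mul1e.
Qed.

(** [w] has to match the continuous function [V] on the slice at beta gamma only. So the formula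
    applies to [Vinf] and to any other solution, whose values outside the domain are arbitrary. *)
Lemma LopE (w : T -> R) (p : T) mu nu : dom gammabar p ->
  (forall x, w (x, beta * p.2) = V (x, beta * p.2)) ->
  Lop G beta w p.1 p.2 mu nu = (mixed_payoff p mu nu)%:E.
Proof.
move=> dp wV; have [P PE] := action_law (p.1 : borel E) mu nu.
pose k (s : SS) := expR (p.2 * r G s).
have mk : measurable_fun setT k.
  by apply: measurableT_comp => //; apply: measurable_funM => //; exact: r_measurable.
have /andP[g0 g1] := dp.
have kK s : 0 <= k s <= expR (p.2 * rbar G).
  by rewrite expR_ge0/= ler_expR ler_wpM2l ?(ltW g0)//; case/andP: (r_bounded G s).
have k0 s : (0 <= (k s)%:E :> \bar R)%E by rewrite lee_fin expR_ge0.
have mkE : measurable_fun setT (fun s => (k s)%:E : \bar R) by exact/measurable_EFinP.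
have V0 t : 0 <= V t by case/andP: (vM t).
have mV : measurable_fun [set: borel E] (fun y : borel E => (V (y, beta * p.2))%:E : \bar R).
  apply/measurable_EFinP; apply: (@continuous_measurable_borel R E) => y.
  have c1 : continuous (fun y : E => (y, beta * p.2)).
    by apply: continuous_pair => z; [exact: cvg_id|exact: cvg_cst].
  exact: (cvg_comp _ _ (c1 y) (@cV (y, beta * p.2))).
rewrite /Lop (_ : (fun x' => _) = (fun x' => (V (x', beta * p.2))%:E)); last first.
  by apply/funext => x'; rewrite wV.
transitivity (\int[fun S => \int[P]_s ((k s)%:E * Qp G s S)]_y (V (y, beta * p.2))%:E)%E.
  apply: integral_ext_measurable => S mS; rewrite PE.
  - apply: eq_integral => b _; apply: eq_integral => a _.
    by rewrite /tildeQ QpE.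
  - by move=> s; rewrite mule_ge0.
  - by apply: emeasurable_funM => //; exact: is_kernel_Qp.
rewrite (integral_weighted_mixture P (@is_kernel_Qp R E A B G) mk kK)//; last first.
  by move=> y; rewrite lee_fin.
rewrite PE.
- rewrite -mixed_payoffE; apply: eq_integral => b _; apply: eq_integral => a _.
  rewrite /F /payoff dom_clamp// EFinM; congr (_ * _)%E.
  rewrite /mean (@EFin_Rintegral_prob _ (borel E) R (Qp G _) _ (expR (gammabar * c)))//.
    exact/measurable_EFinP.
  by move=> y; case/andP: (vM (y, beta * p.2)) => ? ?; rewrite ger0_norm.
- move=> s; rewrite mule_ge0//; apply: integral_ge0 => y _; by rewrite lee_fin.
- apply: emeasurable_funM => //.
  apply: (@measurable_integral_kernel _ _ SS (borel E) R (Qp G)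
    (fun z => (V (z.2, beta * p.2))%:E)).
  + exact: is_kernel_Qp.
  + by move=> z; rewrite lee_fin.
  + exact: (measurableT_comp mV measurable_snd).
Qed.

(** A guarantee and a cap at the same level pin down the inf-sup over mixed actions. *)
Lemma TopE (w : T -> R) (p : T) s mu0 nu0 : dom gammabar p ->
  (forall x, w (x, beta * p.2) = V (x, beta * p.2)) ->
  guarantees KA KB F p s mu0 -> caps KA KB F p s nu0 ->
  Top G beta w p.1 p.2 = s%:E.
Proof.
move=> dp wV gmu gnu; apply/eqP; rewrite eq_le; apply/andP; split.
  apply: (@le_trans _ _ (ereal_sup [set Lop G beta w p.1 p.2 mu nu0
      | mu in @Padm E A R (DA G) p.1])).
    by apply: ereal_inf_lbound; exists nu0 => //; exact: gnu.1.
  apply: ge_ereal_sup => _ [mu muK <-]; rewrite LopE// lee_fin.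
  exact: caps_mixed gnu muK.
apply: le_ereal_inf_tmp => _ [nu nuK <-].
apply: (@le_trans _ _ (Lop G beta w p.1 p.2 mu0 nu)).
  by rewrite LopE// lee_fin; exact: guarantee_mixed gmu nuK.
by apply: ereal_sup_ubound; exists mu0 => //; exact: gmu.1.
Qed.

Let policy_kernelA f : policy (DA G) f ->
  forall n, @is_kernel _ _ (borel E) (borel A) R (f n).
Proof. by move=> pf n; apply: (is_kernel_borel mdA (X := borel E)); exact: (pf n).1. Qed.

Let policy_kernelB g : policy (DB G) g ->
  forall n, @is_kernel _ _ (borel E) (borel B) R (g n).
Proof. by move=> pg n; apply: (is_kernel_borel mdB (X := borel E)); exact: (pg n).1. Qed.

Section policies.
Variables (f : nat -> E -> probability (borel A) R)
  (g : nat -> E -> probability (borel B) R) (x : E) (gamma : R).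
Hypothesis pf : policy (DA G) f.
Hypothesis pg : policy (DB G) g.
Hypothesis dgamma : dom gammabar (x, gamma).

Let v n y := V (y, gamma * beta ^+ n).

Let mv n : measurable_fun [set: borel E] (v n : borel E -> R).
Proof.
apply: (@continuous_measurable_borel R E) => y.
have c1 : continuous (fun y : E => (y, gamma * beta ^+ n)).
  by apply: continuous_pair => z; [exact: cvg_id|exact: cvg_cst].
exact: (cvg_comp _ _ (c1 y) (@cV (y, gamma * beta ^+ n))).
Qed.

Let v_bounds n y : 1 <= v n y <= expR (gamma * beta ^+ n * (rbar G / (1 - beta))).
Proof.
have := bV.2 (y, gamma * beta ^+ n).
by rewrite dom_clamp//; exact: dom_discount dgamma.
Qed.

Let one_stepE n y : one_step G f g beta gamma v n y =
  (mixed_payoff (y, gamma * beta ^+ n) (f n y) (g n y))%:E.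
Proof.
rewrite -mixed_payoffE2; apply: eq_integral => a _; apply: eq_integral => b _.
have dy : dom gammabar (y, gamma * beta ^+ n) by exact: dom_discount dgamma.
rewrite /F /payoff dom_clamp//= EFinM; congr (_ * _)%E.
rewrite /mean (@EFin_Rintegral_prob _ (borel E) R (Qp G _) _ (expR (gammabar * c)))//.
- by apply: eq_integral => y' _; rewrite /v exprS mulrCA.
- by move=> mT C mC; have := mv n.+1 mT mC; rewrite /v exprS mulrCA.
- by move=> y'; case/andP: (vM (y', beta * (gamma * beta ^+ n))) => ? ?; rewrite ger0_norm.
Qed.

Let law_fg : is_law G f g x (law G f g x).
Proof. exact: getPex (law_exists G (policy_kernelA pf) (policy_kernelB pg) x). Qed.

Let gamma0 : 0 < gamma. Proof. by case/andP: dgamma. Qed.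

Lemma Vpol_ge : (forall n y, V (y, gamma * beta ^+ n) <=
    mixed_payoff (y, gamma * beta ^+ n) (f n y) (g n y)) ->
  ((V (x, gamma))%:E <= Vpol G beta f g x gamma)%E.
Proof.
move=> h; have vE : v 0%N x = V (x, gamma) by rewrite /v expr0 mulr1.
rewrite -vE; apply: (lower_verification (policy_kernelA pf) (policy_kernelB pg) law_fg
  beta01 gamma0 mv v_bounds) => n y; rewrite one_stepE lee_fin; exact: h.
Qed.

Lemma Vpol_le : (forall n y, mixed_payoff (y, gamma * beta ^+ n) (f n y) (g n y) <=
    V (y, gamma * beta ^+ n)) ->
  (Vpol G beta f g x gamma <= (V (x, gamma))%:E)%E.
Proof.
move=> h; have vE : v 0%N x = V (x, gamma) by rewrite /v expr0 mulr1.
rewrite -vE; apply: (upper_verification (policy_kernelA pf) (policy_kernelB pg) law_fg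
  beta01 gamma0 mv v_bounds) => n y; rewrite one_stepE lee_fin; exact: h.
Qed.

End policies.

Lemma selector_policy (Y : ptopologicalType) (D : set (E * Y))
    (s : T -> probability (borel Y) R) (x : E) (gamma : R) : dom gammabar (x, gamma) ->
  measurable_fun (dom gammabar : set (borel E * R)%type)
    (s : (borel E * R)%type -> borel (Pweak R Y)) ->
  (forall p, dom gammabar p -> Padm D p.1 (s p)) ->
  policy D (fun n y => s (y, gamma * beta ^+ n)).
Proof.
move=> dg ms sD n; split; last by move=> y; apply: (sD (y, _)); exact: dom_discount dg.
move=> _ C mC; rewrite setTI.
have md : measurable (dom gammabar : set (borel E * R)%type).
  rewrite (_ : dom gammabar = setT `*` `]0, gammabar]%classic).
    by apply: measurableX => //; exact: measurable_itv.
  by apply/seteqP; split => -[y t]; rewrite /dom /= in_itv /=; tauto.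
have mDC := ms md C mC.
have mp : measurable_fun [set: borel E] (fun y : borel E => (y, gamma * beta ^+ n)).
  exact: measurable_pair2.
have := mp measurableT _ mDC; rewrite setTI.
rewrite (_ : _ @^-1` _ = (fun y : borel E => s (y, gamma * beta ^+ n)) @^-1` C)//.
apply/seteqP; split => y; first by move=> [].
by move=> h; split => //; exact: dom_discount dg.
Qed.

(** Each selector enters with a one-sided bound, the one that verification uses against an arbitrary
    policy of the other player. The two resulting inequalities enclose both the upper and the lower
    value. *)
Theorem selectors_value (s1 : T -> probability (borel A) R)
    (s2 : T -> probability (borel B) R) :
  measurable_fun (dom gammabar : set (borel E * R)%type)
    (s1 : (borel E * R)%type -> borel (Pweak R A)) ->
  measurable_fun (dom gammabar : set (borel E * R)%type)
    (s2 : (borel E * R)%type -> borel (Pweak R B)) ->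
  (forall p, dom gammabar p -> carried (KA p) (s1 p) /\
     forall nu, carried (KB p) nu -> V p <= mixed_payoff p (s1 p) nu) ->
  (forall p, dom gammabar p -> carried (KB p) (s2 p) /\
     forall mu, carried (KA p) mu -> mixed_payoff p mu (s2 p) <= V p) ->
  forall p, dom gammabar p ->
  let f := fun n y => s1 (y, p.2 * beta ^+ n) in
  let g := fun n y => s2 (y, p.2 * beta ^+ n) in
  [/\ upper_value G beta p.1 p.2 = (V p)%:E, lower_value G beta p.1 p.2 = (V p)%:E,
      policy (DA G) f /\ (forall g', policy (DB G) g' ->
         ((V p)%:E <= Vpol G beta f g' p.1 p.2)%E) &
      policy (DB G) g /\ (forall f', policy (DA G) f' ->
         (Vpol G beta f' g p.1 p.2 <= (V p)%:E)%E)].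
Proof.
move=> ms1 ms2 h1 h2 [x gamma] dp f g.
have pf : policy (DA G) f by apply: (selector_policy dp ms1) => q /h1[].
have pg : policy (DB G) g by apply: (selector_policy dp ms2) => q /h2[].
have Hf g' : policy (DB G) g' -> ((V (x, gamma))%:E <= Vpol G beta f g' x gamma)%E.
  move=> pg'; apply: Vpol_ge => // n y.
  by apply: (h1 _ _).2; [exact: dom_discount dp|exact: (pg' n).2].
have Hg f' : policy (DA G) f' -> (Vpol G beta f' g x gamma <= (V (x, gamma))%:E)%E.
  move=> pf'; apply: Vpol_le => // n y.
  by apply: (h2 _ _).2; [exact: dom_discount dp|exact: (pf' n).2].
split => //=; apply/eqP; rewrite eq_le; apply/andP; split.
- apply: (@le_trans _ _ (ereal_sup [set Vpol G beta f' g x gamma | f' in policy (DA G)])).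
    by apply: ereal_inf_lbound; exists g.
  by apply: ge_ereal_sup => _ [f' pf' <-]; exact: Hg.
- apply: le_ereal_inf_tmp => _ [g' pg' <-]; apply: (le_trans (Hf g' pg')).
  by apply: ereal_sup_ubound; exists f.
- apply: ge_ereal_sup => _ [f' pf' <-]; apply: le_trans (Hg f' pf').
  by apply: ereal_inf_lbound; exists g.
- apply: (@le_trans _ _ (ereal_inf [set Vpol G beta f g' x gamma | g' in policy (DB G)])).
    by apply: le_ereal_inf_tmp => _ [g' pg' <-]; exact: Hf.
  by apply: ereal_sup_ubound; exists f.
Qed.

End verification_of_selectors.

(* Extending by 1 = exp (0) to gamma <= 0 and by a constant to gamma > gammabar
   preserves continuity because of the bounds. *)
Lemma bracketed_extension (R : realType) (E A B : ptopologicalType) (G : game R E A B)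
    (beta gammabar : R) (v : E * R -> R) : 0 < beta < 1 -> 0 < gammabar ->
  shapley_solution G beta gammabar v ->
  exists V : E * R -> R, bracketed G beta gammabar V /\
    forall p, dom gammabar p -> V p = v p.
Proof.
move=> beta01 g0 [[cv _] vb _].
pose V (p : E * R) := if 0 < p.2 then v (p.1, Num.min p.2 gammabar) else 1.
have dmin (p : E * R) : 0 < p.2 -> dom gammabar (p.1, Num.min p.2 gammabar).
  by move=> h; rewrite /dom /= lt_min h g0/= ge_min lexx orbT.
have Vb p : 1 <= V p <= expR (clamp gammabar p.2 * (rbar G / (1 - beta))).
  rewrite /V; case: ltP => h.
    have /= := vb _ (dmin _ h).
    by rewrite /clamp (max_r (ltW h)).
  rewrite lexx/= -expR0 ler_expR /clamp max_l// min_l ?(ltW g0)//.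
  by rewrite mul0r.
exists V; split; last first.
  move=> [x gamma] /andP[/= h1 h2]; rewrite /V /= h1 min_l//.
split => // p0; have [h|h] := ltP 0 p0.2; last first.
  have Vp0 : V p0 = 1 by rewrite /V ltNge h.
  have e0 : clamp gammabar p0.2 = 0 by rewrite /clamp max_l// min_l// ltW.
  rewrite /continuous_at Vp0; apply: (@squeeze_cvgr _ _ _ _ (fun=> 1)
    (fun p => expR (clamp gammabar p.2 * (rbar G / (1 - beta))))).
  - by apply: nearW => p; exact: Vb.
  - exact: cvg_cst.
  have c1 : clamp gammabar p.2 * (rbar G / (1 - beta)) @[p --> p0] -->
      clamp gammabar p0.2 * (rbar G / (1 - beta)).
    apply: cvgMr_tmp; apply: (cvg_comp _ _ cvg_snd); exact: clamp_continuous.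
  have := cvg_comp _ _ c1 (@continuous_expR R _).
  by rewrite e0 mul0r expR0.
pose q (p : E * R) : E * R := (p.1, Num.min p.2 gammabar).
have Vp0 : V p0 = v (q p0) by rewrite /V h.
rewrite /continuous_at Vp0.
have cq : continuous q.
  apply: continuous_pair => p; first exact: cvg_fst.
  by apply: continuous_min; [exact: cvg_snd|exact: cvg_cst].
have pos : \forall p \near p0, 0 < p.2.
  have : nbhs p0 ((snd : E * R -> R) @^-1` [set r | 0 < r]).
    apply: (@cvg_snd _ _ (nbhs p0.1) (nbhs p0.2)).
    by apply: open_nbhs_nbhs; split => //; exact: open_gt.
  by [].
(* Near a point with positive parameter, [q] takes its values in the domain, as continuity of [v]
   relative to the domain requires. *)
have qw : q @ p0 --> within (dom gammabar) (nbhs (q p0)).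
  move=> N Nq; have h2 : nbhs p0 (q @^-1` [set p | dom gammabar p -> N p]).
    exact: (cq p0).
  apply: filterS2 pos h2 => p pp /=; apply; exact: dmin.
have vq := (subspace_continuousP _ _).1 cv (q p0) (dmin _ h).
have := cvg_comp _ _ qw vq.
apply: cvg_trans; apply: near_eq_cvg; apply: filterS pos => p pp /=.
by rewrite /V pp.
Qed.

Theorem theorem4p1 (R : realType) (E A B : ptopologicalType)
  (hE : borel_space R E) (hA : borel_space R A) (hB : borel_space R B)
  (G : game R E A B)
  (gammabar : R) (hgammabar : 0 < gammabar)
  (beta : R) (hbeta : 0 < beta < 1)
  (gamma : R) (hgamma : 0 < gamma <= gammabar)
  (A1 : forall x : E, compact (adm (DA G) x) /\ compact (adm (DB G) x))
  (A2 : continuous_corr (DA G) /\ continuous_corr (DB G))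
  (A3 : continuous (r G))
  (A4 : forall v : E -> R, bounded_continuous v ->
     continuous (fun z : E * A * B => (\int[Q G z]_x' v x' : R))) :
  [/\
    shapley_solution G beta gammabar (Vinf G beta) /\
    (forall v : E * R -> R, shapley_solution G beta gammabar v ->
       forall p, dom gammabar p -> v p = Vinf G beta p),
    (exists (mus : E * R -> probability (borel A) R)
            (nus : E * R -> probability (borel B) R),
       saddle_selector G beta gammabar mus nus),
    (forall p : E * R, dom gammabar p ->
       upper_value G beta p.1 p.2 = lower_value G beta p.1 p.2)
  & (forall (mus : E * R -> probability (borel A) R)
            (nus : E * R -> probability (borel B) R),
       saddle_selector G beta gammabar mus nus ->
       optimal1 G beta gamma (fun n x => mus (x, gamma * beta ^+ n)) /\
       optimal2 G beta gamma (fun n x => nus (x, gamma * beta ^+ n)))].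
Proof.
have [dE [UE [mdE _ cbE]]] := borel_space_metrizes hE.
have [dA [UA [mdA dA0 cbA]]] := borel_space_metrizes hA.
have [dB [UB [mdB dB0 cbB]]] := borel_space_metrizes hB.
pose KA (t : E * R) := adm (DA G) t.1; pose KB (t : E * R) := adm (DB G) t.1.
pose F := payoff G beta gammabar.
have step V : bracketed G beta gammabar V -> exists u : E * R -> R,
    [/\ is_value G beta gammabar V u,
      (exists s : (borel E * R)%type -> probability (borel A) R,
        measurable_fun setT (s : (borel E * R)%type -> borel (Pweak R A)) /\
        forall p, guarantees KA KB (F V) p (u p) (s p)) &
      (exists s : (borel E * R)%type -> probability (borel B) R,
        measurable_fun setT (s : (borel E * R)%type -> borel (Pweak R B)) /\
        forall p, caps KA KB (F V) p (u p) (s p))].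
  move=> bV; have [u [_ h1 h2 h3]] := shapley_step mdE mdA mdB dA0 dB0 cbE cbA cbB
    beta hgammabar A1 A2 A3 A4 bV.1 (bracketed_bounds hbeta hgammabar bV).
  by exists u.
(* The second assumption says that one-shot values with continuation [V] reproduce [V] on the
   domain. In this form it covers the fixed point and also, for uniqueness, the extension of another
   solution. *)
have value V : bracketed G beta gammabar V ->
    (forall u, is_value G beta gammabar V u -> forall p, dom gammabar p -> u p = V p) ->
    exists (s1 : E * R -> probability (borel A) R) (s2 : E * R -> probability (borel B) R),
    [/\ measurable_fun (dom gammabar : set (borel E * R)%type)
          (s1 : (borel E * R)%type -> borel (Pweak R A)),
        measurable_fun (dom gammabar : set (borel E * R)%type)
          (s2 : (borel E * R)%type -> borel (Pweak R B)),
        (forall p, dom gammabar p -> carried (KA p) (s1 p) /\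
           forall nu, carried (KB p) nu -> V p <= mixed_payoff G beta gammabar V p (s1 p) nu),
        (forall p, dom gammabar p -> carried (KB p) (s2 p) /\
           forall mu, carried (KA p) mu -> mixed_payoff G beta gammabar V p mu (s2 p) <= V p) &
        (forall w p, dom gammabar p ->
           (forall x, w (x, beta * p.2) = V (x, beta * p.2)) ->
           Top G beta w p.1 p.2 = (V p)%:E)].
  move=> bV hu; have [u [vu [s1 [ms1 g1]] [s2 [ms2 g2]]]] := step V bV.
  have uV := hu u vu; exists s1, s2; split.
  - exact: measurable_funTS.
  - exact: measurable_funTS.
  - move=> p dp; split; first exact: (g1 p).1.
    move=> nu nuK; rewrite -uV//.
    exact: (guarantee_mixed mdB dB0 hbeta hgammabar A1 bV (g1 p) nuK).
  - move=> p dp; split; first exact: (g2 p).1.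
    move=> mu muK; rewrite -uV//.
    exact: (caps_mixed mdA dA0 hbeta hgammabar A1 bV (g2 p) muK).
  - move=> w p dp wV; rewrite -uV//.
    exact: (TopE mdA mdB dA0 dB0 hbeta hgammabar A1 bV dp wV (g1 p) (g2 p)).
have val V : bracketed G beta gammabar V ->
    (forall u, is_value G beta gammabar V u -> forall p, dom gammabar p -> u p = V p) ->
    forall p, dom gammabar p ->
    upper_value G beta p.1 p.2 = (V p)%:E /\ lower_value G beta p.1 p.2 = (V p)%:E.
  move=> bV hu p dp; have [s1 [s2 [ms1 ms2 h1 h2 _]]] := value V bV hu.
  by have [] := selectors_value mdA mdB hbeta hgammabar bV ms1 ms2 h1 h2 dp.
have [V [bV vV]] := fixed_point_ex mdE mdA mdB dA0 dB0 cbE cbA cbB hbeta hgammabar A1 A2 A3 A4.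
have bb := bracketed_bounds hbeta hgammabar bV.
(* One-shot values are unique: [value_le] with k = 1 in both directions. *)
have uV u : is_value G beta gammabar V u -> forall p, dom gammabar p -> u p = V p.
  move=> vu p _; have h x : V (x, beta * clamp gammabar p.2) <=
    1 * V (x, beta * clamp gammabar p.2) by rewrite mul1r.
  apply/eqP; rewrite eq_le; apply/andP; split.
    have := value_le mdE mdA mdB dA0 dB0 hgammabar A1 A3 A4 bV.1 bb bV.1 bb ltr01 h vu vV.
    by rewrite mul1r.
  have := value_le mdE mdA mdB dA0 dB0 hgammabar A1 A3 A4 bV.1 bb bV.1 bb ltr01 h vV vu.
  by rewrite mul1r.
have VinfE p : dom gammabar p -> Vinf G beta p = V p.
  by move=> dp; rewrite /Vinf (val V bV uV p dp).1.
have VinfE' p : dom gammabar p -> forall x, Vinf G beta (x, beta * p.2) = V (x, beta * p.2).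
  by case: p => x g dp y; rewrite VinfE//; exact: (dom_next hbeta y dp).
have [s1 [s2 [ms1 ms2 h1 h2 topV]]] := value V bV uV.
have LopVinf p mu nu : dom gammabar p -> Lop G beta (Vinf G beta) p.1 p.2 mu nu =
    (mixed_payoff G beta gammabar V p mu nu)%:E.
  by move=> dp; apply: (LopE hbeta hgammabar bV) => //; exact: VinfE'.
have dgamma (x : E) : dom gammabar (x, gamma) by [].
split.
- split.
    split.
    + split.
        apply: (@subspace_eq_continuous _ _ _ V).
          by move=> p /set_mem dp; exact: (esym (VinfE p dp)).
        by apply: continuous_subspaceT; exact: bV.1.
      exists (expR (gammabar * (rbar G / (1 - beta)))) => p dp; rewrite VinfE//.
      by have /andP[v0 v1] := bb p; rewrite ger0_norm.
    + by move=> p dp; rewrite VinfE//; have := bV.2 p; rewrite dom_clamp.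
    + move=> p dp; rewrite VinfE// (topV _ p)//; exact: VinfE'.
  (* Uniqueness: the Shapley equation makes the one-shot values with continuation V' agree with V'
     on the domain, so V' is also the upper value of the game there. *)
  move=> v sv p dp; have [V' [bV' V'E]] := bracketed_extension hbeta hgammabar sv.
  have [_ _ vT] := sv.
  have V'E' (q : E * R) : dom gammabar q -> forall x, v (x, beta * q.2) = V' (x, beta * q.2).
    by case: q => x g dq y; rewrite -V'E//; exact: (dom_next hbeta y dq).
  have uV' u : is_value G beta gammabar V' u -> forall q, dom gammabar q -> u q = V' q.
    move=> vu q dq; have [[mu Gmu] [nu Cnu]] := vu q.
    have := vT q dq.
    rewrite (TopE mdA mdB dA0 dB0 hbeta hgammabar A1 bV' dq (V'E' q dq) Gmu Cnu).
    by rewrite V'E// => -[].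
  have := (val V' bV' uV' p dp).1; rewrite (val V bV uV p dp).1 V'E// => -[<-].
  by rewrite VinfE.
- exists s1, s2; split; [exact: ms1|exact: ms2|move=> p dp; split].
  + exact: (h1 p dp).1.
  + exact: (h2 p dp).1.
  + move=> mu muK; rewrite !LopVinf// lee_fin.
    exact: le_trans ((h2 p dp).2 mu muK) ((h1 p dp).2 _ (h2 p dp).1).
  + move=> nu nuK; rewrite !LopVinf// lee_fin.
    exact: le_trans ((h2 p dp).2 _ (h1 p dp).1) ((h1 p dp).2 nu nuK).
- by move=> p dp; have [-> ->] := val V bV uV p dp.
move=> mus nus [mm mn sp].
(* Any saddle point has value [V]: its two inequalities are combined with the bounds of the selected
   optimal strategies. So verification applies to arbitrary saddle selectors. *)
have h1' p : dom gammabar p -> carried (KA p) (mus p) /\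
    forall nu, carried (KB p) nu -> V p <= mixed_payoff G beta gammabar V p (mus p) nu.
  move=> dp; have [muK nuK o1 o2] := sp p dp; split; [exact: muK|move=> nu nuK'].
  have := o2 nu nuK'; rewrite !LopVinf// lee_fin; apply: le_trans.
  have := o1 _ (h1 p dp).1; rewrite !LopVinf// lee_fin; apply: le_trans.
  exact: (h1 p dp).2.
have h2' p : dom gammabar p -> carried (KB p) (nus p) /\
    forall mu, carried (KA p) mu -> mixed_payoff G beta gammabar V p mu (nus p) <= V p.
  move=> dp; have [muK nuK o1 o2] := sp p dp; split; [exact: nuK|move=> mu muK'].
  have := o1 mu muK'; rewrite !LopVinf// lee_fin => /le_trans; apply.
  have := o2 _ (h2 p dp).1; rewrite !LopVinf// lee_fin => /le_trans; apply.
  exact: (h2 p dp).2.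
have sel x := selectors_value mdA mdB hbeta hgammabar bV mm mn h1' h2' (dgamma x).
split; split.
- by have [_ _ []] := sel point.
- move=> g pg x; have [_ -> [_ h] _] := sel x; exact: h.
- by have [_ _ _ []] := sel point.
- move=> f pf x; have [-> _ _ [_ h]] := sel x; exact: h.
Qed.
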